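(* Let $n\ge1$ be an integer. Let $T$ and $R$ be contractions on a Hilbert space $\mathcal{H}$, let $T_t=(1-t)T+tR$ for $t\in[0,1]$, and let $\mathcal{E}_t$ be a semi-spectral measure of $T_t$. Suppose that $\varphi\in\big(B^n_{\infty1}\big)_+$. Then the function $$ t\mapsto\varphi(T_t),\quad 0\le t\le1, $$ has $n$th derivative in the operator norm and $$ \frac{d^n}{ds^n}\varphi(T_s)\Big|_{s=t}=n! \underbrace{\int\!\cdots\!\int}_{n+1}(\mathfrak{D}^{n}\varphi)(\zeta_1,\cdots,\zeta_{n+1})\,d\mathcal{E}_t(\zeta_1)\,(R-T)\cdots(R-T)\,d\mathcal{E}_t(\zeta_{n+1}), $$ the integral being taken over $\mathbb{T}^{n+1}$.
   Context: $\mathbb{D}$ is the open unit disk, $\mathbb{T}$ the unit circle. A contraction is an operator of norm at most $1$; each $T_t$ is a contraction. $C_A$ is the disk-algebra (functions analytic in $\mathbb{D}$ and continuous on the closed disk). For $f\in C_A$ and a contraction $T$, $f(T)$ is defined by extending the polynomial calculus by continuity using von Neumann's inequality $\|f(T)\|\le\max_{|\zeta|\le1}|f(\zeta)|$. Derivatives on $[0,1]$ are one-sided at the endpoints. Besov class: let $w\ge0$ be the piecewise linear function on $\mathbb{R}$ supported in $[1/2,2]$, with $w(1)=1$ and linear on $[1/2,1]$ and on $[1,2]$. Put $W_m(z)=\sum_{k\in\mathbb{Z}}w(k/2^m)z^k$ for $m\ge1$, $W_0(z)=\bar z+1+z$, $W_m^\#=\overline{W_m}$. For $s>0$, $1\le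 p,q\le\infty$, $B^s_{pq}$ consists of functions $f$ on $\mathbb{T}$ with $\{2^{ms}\|f*W_m\|_{L^p}\}_{m\ge0}\in\ell^q$ and $\{2^{ms}\|f*W_m^\#\|_{L^p}\}_{m\ge1}\in\ell^q$. $\big(B^s_{pq}\big)_+$ is the set of $f\in B^s_{pq}$ with $\hat f(k)=0$ for $k<0$; such functions are identified with their analytic extensions to $\mathbb{D}$. Divided differences: $\mathfrak{D}^0\varphi=\varphi$ and, for $k\ge1$ and distinct points $\lambda_1,\dots,\lambda_{k+1}\in\mathbb{T}$, $$(\mathfrak{D}^{k}\varphi)(\lambda_1,\dots,\lambda_{k+1})=\frac{(\mathfrak{D}^{k-1}\varphi)(\lambda_1,\dots,\lambda_{k-1},\lambda_k)-(\mathfrak{D}^{k-1}\varphi)(\lambda_1,\dots,\lambda_{k-1},\lambda_{k+1})}{\lambda_{k}-\lambda_{k+1}};$$ for $\varphi\in C^k(\mathbb{T})$, $\mathfrak{D}^k\varphi$ is extended by continuity to all points of $\mathbb{T}^{k+1}$. Semi-spectral measures: for a measurable space $(\mathcal{X},\mathcal{B})$ and a Hilbert space $\mathcal{H}$, a semi-spectral measure is a map $\mathcal{E}$ from $\mathcal{B}$ to the bounded operators on $\mathcal{H}$ with $\mathcal{E}(\Delta)\ge0$, $\mathcal{E}(\varnothing)=0$, $\mathcal{E}(\mathcal{X})=I$, countably additive in the weak operator topology. By Naimark's theorem it has a spectral dilation, i.e., a spectral measure $E$ on a Hilbert space $\mathcal{K}\supset\mathcal{H}$ with $\mathcal{E}(\Delta)=P_{\mathcal{H}}E(\Delta)|\mathcal{H}$,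 and $\int f\,d\mathcal{E}:=P_{\mathcal{H}}\left(\int f\,dE\right)\big|\mathcal{H}$ for bounded measurable $f$ (independent of the dilation). A semi-spectral measure of a contraction $T$ on $\mathcal{H}$ is $\mathcal{E}_T(\Delta)=P_{\mathcal{H}}E_U(\Delta)|\mathcal{H}$, $\Delta\subset\mathbb{T}$ Borel, where $E_U$ is the spectral measure of a unitary dilation $U$ of $T$ (a unitary operator on some $\mathcal{K}\supset\mathcal{H}$ with $T^m=P_{\mathcal{H}}U^m|\mathcal{H}$, $m\ge0$); thus $T^m=\int_{\mathbb{T}}\zeta^m\,d\mathcal{E}_T(\zeta)$, $m\ge0$. Multiple operator integrals: if $\Phi(\zeta_1,\dots,\zeta_{n+1})=\sum_{m}f_{1,m}(\zeta_1)\cdots f_{n+1,m}(\zeta_{n+1})$ with $f_{j,m}\in C_A$ and $\sum_m\|f_{1,m}\|_\infty\cdots\|f_{n+1,m}\|_\infty<\infty$ (i.e. $\Phi$ belongs to the $(n+1)$-fold projective tensor product $C_A\hat\otimes\cdots\hat\otimes C_A$), then for bounded operators $Q_1,\dots,Q_n$ and semi-spectral measures $\mathcal{E}_1,\dots,\mathcal{E}_{n+1}$ on $\mathbb{T}$, $$\int\!\cdots\!\int\Phi\,d\mathcal{E}_1\,Q_1\cdots Q_n\,d\mathcal{E}_{n+1}:=\sum_m\left(\int f_{1,m}\,d\mathcal{E}_1\right)Q_1\cdots Q_n\left(\int f_{n+1,m}\,d\mathcal{E}_{n+1}\right),$$ which does not depend on the representation. For $\varphi\in\big(B^n_{\infty1}\big)_+$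 it is known that $\mathfrak{D}^n\varphi$ belongs to the $(n+1)$-fold projective tensor product $C_A\hat\otimes\cdots\hat\otimes C_A$. *)

(* Defs.v *)
From HB Require Import structures.
From mathcomp Require Import all_boot all_order all_algebra.
From mathcomp Require Import all_classical all_reals all_analysis.
From mathcomp Require Import complex sesquilinear.
Set Implicit Arguments.
Unset Strict Implicit.
Unset Printing Implicit Defensive.
Import Order.TTheory GRing.Theory Num.Theory.
Import numFieldNormedType.Exports.
Local Open Scope classical_set_scope.
Local Open Scope ring_scope.
Local Open Scope complex_scope.

(* [R[i]^o] is [R[i]] seen as a normed space over itself: only the [^o] form
   carries the library's topology. *)

(* The norm of a normed module over [R[i]] takes its values in [R[i]];
   [rnorm] is the same norm as a real number. *)
Definition rnorm (R : realType) (V : normedModType R[i]) (x : V) : R :=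
  complex.Re `|x|.

(* The inner product is linear in its first argument. *)
HB.mixin Record CompleteNormedModule_isHilbert (R : realType) H
    of CompleteNormedModule R[i] H := {
  ip : {dot H for @Num.conj R[i]} ;
  ip_normE : forall x : H, ip x x = `|x| ^+ 2
}.

#[short(type="hilbertType")]
HB.structure Definition Hilbert (R : realType) :=
  {H of CompleteNormedModule_isHilbert R H & CompleteNormedModule R[i] H}.

Section Operators.
Context {R : realType}.
Local Open Scope ereal_scope.

Definition opnorm (U V : normedModType R[i]) (A : U -> V) : \bar R :=
  ereal_sup [set (rnorm (A x))%:E | x in [set x : U | (rnorm x <= 1)%R]].

Definition bounded_op (U V : normedModType R[i]) (A : U -> V) : Prop :=
  linear A /\ opnorm A < +oo.

Definition contractive (U V : normedModType R[i]) (A : U -> V) : Prop :=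
  linear A /\ opnorm A <= 1.

Definition op_cvg (U V : normedModType R[i]) (A : nat -> U -> V) (L : U -> V)
    : Prop :=
  opnorm (A k - L)%R @[k --> \oo] --> (0 : \bar R).

Local Close Scope ereal_scope.

Definition isometric_embedding (H K : hilbertType R) (V : H -> K) : Prop :=
  linear V /\ forall x y, ip (V x) (V y) = ip x y.

Definition unitary (K : hilbertType R) (U : K -> K) : Prop :=
  isometric_embedding U /\ forall y, exists x, U x = y.

Definition positive_op (H : hilbertType R) (A : H -> H) : Prop :=
  bounded_op A /\ forall x, 0 <= ip (A x) x.

(* [A = P_H B | H], where [H] is regarded as a closed subspace of [K] through
   [V]: the equation says that [B (V x) - V (A x)] is orthogonal to [V H]. *)
Definition compression (H K : hilbertType R) (V : H -> K)
    (B : K -> K) (A : H -> H) : Prop :=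
  bounded_op A /\ forall x y, ip (A x) y = ip (B (V x)) (V y).

End Operators.

Definition open_disk (R : realType) : set R[i] := [set z | `|z| < 1].
Definition closed_disk (R : realType) : set R[i] := [set z | `|z| <= 1].
Definition circle (R : realType) : set R[i] := [set z | `|z| = 1].

Arguments open_disk : clear implicits.
Arguments closed_disk : clear implicits.
Arguments circle : clear implicits.

Definition borel_circle (R : realType) : set (set R[i]) :=
  <<s circle R, [set circle R `&` U | U in @open R[i]^o] >>.
Arguments borel_circle : clear implicits.

Definition supnorm (R : realType) (f : R[i] -> R[i]) : \bar R :=
  ereal_sup [set (rnorm (f z : R[i]^o))%:E | z in closed_disk R].

Definition disk_algebra (R : realType) (f : R[i] -> R[i]) : Prop :=
  (forall z, open_disk R z -> derivable (f : R[i]^o -> R[i]^o) z 1) /\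
  {within (closed_disk R : set R[i]^o),
    continuous (f : R[i]^o -> R[i]^o)}.

Section DiskCalculus.
Context {R : realType} {H : hilbertType R}.

Definition poly_op (p : {poly R[i]}) (T : H -> H) : H -> H :=
  \sum_(i < size p) p`_i *: iter i T.

(* The value at [f] of the continuous extension of [p |-> p(T)]. *)
Definition disk_calc (f : R[i] -> R[i]) (T : H -> H) : H -> H :=
  xget 0 [set A | bounded_op A /\ exists p : nat -> {poly R[i]},
    supnorm (fun z => (p k).[z] - f z) @[k --> \oo] --> (0%E : \bar R) /\
    op_cvg (fun k => poly_op (p k) T) A].

End DiskCalculus.

Section Besov.
Context {R : realType}.

Definition expi (theta : R) : R[i] := cos theta +i* sin theta.

Lemma pi2_gt0 : 0 < 2 * pi :> R.
Proof. by rewrite mulr_gt0// pi_gt0. Qed.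

(* Normalized arc length, in the parameter [theta] of [expi theta]. *)
Definition arclen := uniform_prob pi2_gt0.

Definition circle_int (h : R -> R[i]) : R[i] :=
  (\int[arclen]_x complex.Re (h x))%R +i* (\int[arclen]_x complex.Im (h x))%R.

Definition circle_integrable (f : R[i] -> R[i]) : Prop :=
  arclen.-integrable setT (fun x => (complex.Re (f (expi x)))%:E) /\
  arclen.-integrable setT (fun x => (complex.Im (f (expi x)))%:E).

Definition circle_Lnorm (p : \bar R) (f : R[i] -> R[i]) : \bar R :=
  Lnorm arclen p (fun x => (rnorm (f (expi x) : R[i]^o))%:E).

Definition fourier (f : R[i] -> R[i]) (k : int) : R[i] :=
  circle_int (fun x => f (expi x) * expi x ^ (- k)).

Definition circle_conv (f g : R[i] -> R[i]) (z : R[i]) : R[i] :=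
  circle_int (fun x => f (expi x) * g (z * (expi x)^*)).

Definition tent (x : R) : R :=
  if 2^-1 <= x <= 1 then 2 * x - 1 else if 1 <= x <= 2 then 2 - x else 0.

(* For [m >= 1], [tent (k / 2 ^ m)] vanishes unless [0 <= k <= 2 ^ m.+1]. *)
Definition kernelW (m : nat) (z : R[i]) : R[i] :=
  if m is 0 then z^* + 1 + z
  else \sum_(k < (2 ^ m.+1).+1) (tent (k%:R / 2 ^+ m))%:C * z ^+ k.

Definition kernelW_sharp (m : nat) (z : R[i]) : R[i] := (kernelW m z)^*.

Definition besov (s : R) (p q : \bar R) (f : R[i] -> R[i]) : Prop :=
  [/\ circle_integrable f,
      (Lnorm counting q (fun m : nat =>
        (2 `^ (m%:R * s))%:E * circle_Lnorm p (circle_conv f (kernelW m)))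
        < +oo)%E &
      (Lnorm counting q (fun m : nat =>
        (2 `^ (m.+1%:R * s))%:E *
          circle_Lnorm p (circle_conv f (kernelW_sharp m.+1)))
        < +oo)%E].

Definition besov_plus (s : R) (p q : \bar R) (f : R[i] -> R[i]) : Prop :=
  besov s p q f /\ forall k : int, k < 0 -> fourier f k = 0.

(* [besov_plus] describes a function on the circle up to null sets; this is the
   function on the closed disk with which it is identified. *)
Definition analytic_ext (f : R[i] -> R[i]) (z : R[i]) : R[i] :=
  lim ((\sum_(k < N) fourier f k%:Z * z ^+ k : R[i]^o) @[N --> \oo]).

End Besov.

Section DividedDifferences.
Context {R : realType}.

(* The points are [l 0, ..., l k]. *)
Fixpoint divdiff (f : R[i] -> R[i]) (k : nat) (l : nat -> R[i]) : R[i] :=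
  if k is j.+1 then
    (divdiff f j l - divdiff f j (fun i => if i == j then l j.+1 else l i))
      / (l j - l j.+1)
  else f (l 0%N).

Definition torus n : set 'rV[R[i]^o]_n := [set l | forall i, `|l 0 i| = 1].

Definition distinct_points n : set 'rV[R[i]^o]_n :=
  [set l | injective (fun i => l 0 i)].

(* Extension by continuity to the whole torus. *)
Definition divided_difference (f : R[i] -> R[i]) (n : nat)
    (l : 'rV[R[i]^o]_n.+1) : R[i] :=
  lim ((divdiff f n (fun i => l' 0 (inord i)) : R[i]^o)
    @[l' --> within (@torus n.+1 `&` @distinct_points n.+1) (nbhs l)]).

End DividedDifferences.

Section SemiSpectral.
Context {R : realType}.

Definition semispectral (H : hilbertType R) (E : set R[i] -> H -> H) : Prop :=
  [/\ forall D, borel_circle R D -> positive_op (E D),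
      E set0 = 0,
      E (circle R) = id &
      forall D : nat -> set R[i], (forall k, borel_circle R (D k)) ->
        trivIset setT D -> forall x y : H,
        (\sum_(k < N) ip (E (D k) x) y : R[i]^o) @[N --> \oo] -->
          (ip (E (\bigcup_k D k) x) y : R[i]^o)].

(* A positive idempotent is an orthogonal projection. *)
Definition spectral (K : hilbertType R) (E : set R[i] -> K -> K) : Prop :=
  semispectral E /\ forall D, borel_circle R D -> E D \o E D = E D.

(* [A] is the integral of the bounded function [f]: the operator-norm limit of
   integrals of simple functions converging to [f] uniformly. *)
Definition is_spectral_int (K : hilbertType R) (E : set R[i] -> K -> K)
    (f : R[i] -> R[i]) (A : K -> K) : Prop :=
  bounded_op A /\
  forall e : R, 0 < e ->
  exists N (D : 'I_N -> set R[i]) (c : 'I_N -> R[i]),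
    [/\ forall i, borel_circle R (D i),
        trivIset setT D,
        \bigcup_i D i = circle R,
        forall i z, D i z -> `|f z - c i| <= e%:C &
        (opnorm (A - \sum_(i < N) c i *: E (D i))%R <= e%:E)%E].

Definition spectral_dilation (H K : hilbertType R) (V : H -> K)
    (E : set R[i] -> H -> H) (F : set R[i] -> K -> K) : Prop :=
  [/\ isometric_embedding V, spectral F &
      forall D, borel_circle R D -> compression V (F D) (E D)].

Definition semispectral_int (H : hilbertType R) (E : set R[i] -> H -> H)
    (f : R[i] -> R[i]) : H -> H :=
  xget 0 [set A | exists (K : hilbertType R) (V : H -> K)
      (F : set R[i] -> K -> K) (B : K -> K),
    [/\ spectral_dilation V E F, is_spectral_int F f B & compression V B A]].

Definition unitary_dilation (H K : hilbertType R) (V : H -> K)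
    (T : H -> H) (U : K -> K) : Prop :=
  [/\ isometric_embedding V, unitary U &
      forall m, compression V (iter m U) (iter m T)].

Definition semispectral_measure_of (H : hilbertType R) (T : H -> H)
    (E : set R[i] -> H -> H) : Prop :=
  semispectral E /\
  exists (K : hilbertType R) (V : H -> K) (U : K -> K)
      (F : set R[i] -> K -> K),
    [/\ unitary_dilation V T U,
        is_spectral_int F id U & spectral_dilation V E F].

End SemiSpectral.

Section MultipleOperatorIntegrals.
Context {R : realType} {H : hilbertType R}.

(* The functions [f m 0, ..., f m n] exhibit [Phi] as an element of the
   projective tensor power of the disk algebra. *)
Definition tensor_rep n (Phi : 'rV[R[i]^o]_n.+1 -> R[i])
    (f : nat -> 'I_n.+1 -> R[i] -> R[i]) : Prop :=
  [/\ forall m j, disk_algebra (f m j),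
      (\sum_(0 <= m <oo) (\prod_(j < n.+1) fine (supnorm (f m j)))%:E
        < +oo)%E &
      forall l, torus l ->
        (\sum_(m < N) \prod_(j < n.+1) f m j (l 0 j) : R[i]^o) @[N --> \oo]
          --> (Phi l : R[i]^o)].

(* [A_0 Q_0 A_1 Q_1 ... Q_(n-1) A_n] *)
Definition interleave n (A : 'I_n.+1 -> H -> H) (Q : 'I_n -> H -> H) : H -> H :=
  A ord0 \o \big[(fun B B' : H -> H => B \o B')/id]_(j < n)
              (Q j \o A (lift ord0 j)).

Definition multiple_op_int n (Phi : 'rV[R[i]^o]_n.+1 -> R[i])
    (E : 'I_n.+1 -> set R[i] -> H -> H) (Q : 'I_n -> H -> H) : H -> H :=
  xget 0 [set A | bounded_op A /\
    exists2 f, tensor_rep Phi f &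
      op_cvg (fun N => \sum_(m < N)
        interleave (fun j => semispectral_int (E j) (f m j)) Q) A].

End MultipleOperatorIntegrals.

Section OperatorDerivatives.
Context {R : realType} {H : hilbertType R}.

(* One-sided at the endpoints. *)
Definition op_derivative (F : R -> H -> H) (t : R) (L : H -> H) : Prop :=
  bounded_op L /\
  opnorm (((s - t)^-1)%:C *: (F s - F t) - L)
    @[s --> within (`[0, 1] : set R) t^'] --> (0%E : \bar R).

Definition nth_op_derivative n (F G : R -> H -> H) : Prop :=
  exists D : nat -> R -> H -> H,
    [/\ forall t, t \in `[0, 1] -> D 0 t = F t,
        forall k t, (k < n)%N -> t \in `[0, 1] ->
          op_derivative (D k) t (D k.+1 t) &
        forall t, t \in `[0, 1] -> D n t = G t].

End OperatorDerivatives.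

(* Main.v *)
(* Write [phi] as the sum of the polynomials [p_m = phi * W_m], whose exponents lie
   between [2 ^ (m - 1)] and [2 ^ (m + 1)] and for which
   [\sum_m 2 ^ (m * n) * |p_m|_oo] is finite. Put [Q = R - T]. The [k]-th divided
   difference of [X ^ l] is the sum of the monomials of degree [l - k] in the [k.+1]
   points, and the [k]-th derivative of [T_t ^ l] is [k!] times the sum of the
   corresponding words [T_t ^ a_0 Q T_t ^ a_1 ... Q T_t ^ a_k]; both are obtained from
   the same combination of elementary tensors. For [p_m] and [k <= n] this combination
   can be rewritten as a finite sum of tensors of total cost [O(2 ^ (m * k)) |p_m|_oo].
   Indeed [1 = min(1, a / P) + (1 - min(1, a / P))], for the exponent [a] of one
   variable: the first part is a difference of two Fejer sums, bounded by positivity of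
   the Fejer kernel; the second one only involves [a < P], and there the polynomial in
   the other variables still starts late enough to proceed by induction on [k].
   Hence, by von Neumann's inequality, the series of the words of [p_m] converge
   absolutely for every [k <= n], uniformly in [t], and can be differentiated term by
   term; and the series of the tensors for [k = n] represents the divided difference of
   [phi]. A multiple operator integral does not depend on the representation because,
   after approximating finitely many factors by step functions on a common partition
   of the circle, the coefficients are the values of the integrand. *)
Require Import Defs.
From HB Require Import structures.
From mathcomp Require Import all_boot all_order all_algebra.
From mathcomp Require Import all_classical all_reals all_analysis.
From mathcomp Require Import complex sesquilinear.
From mathcomp Require Import ring lra zify.
Import Order.TTheory GRing.Theory Num.Theory.
Import numFieldNormedType.Exports.
Local Open Scope classical_set_scope.
Local Open Scope ring_scope.
Local Open Scope complex_scope.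
Set Implicit Arguments.
Unset Strict Implicit.
Unset Printing Implicit Defensive.

(** [disk_calc], [semispectral_int] and [multiple_op_int] pick some operator with a given property,
    so exhibiting one value is not enough: each needs a uniqueness argument, resting on estimates
    that do not see the choice (step operators of the measure itself, or von Neumann's inequality).
    No dilation theorem enters: a semi-spectral measure of [T] comes with a unitary dilation and its
    spectral measure, and von Neumann's inequality is read off from the resulting integral. The
    obstacle is the cost of the tensors. Expanding the words of [p_m] into monomials costs a sum of
    moduli of coefficients instead of a sup norm, and a sharp cut-off of one variable at [P] costs a
    logarithm; ramps cost a factor [D / P]. So [P] is a fixed fraction of [2 ^ m]: large enough to
    keep [D / P] bounded, small enough that removing exponents below [P] in up to [n] variables
    stays under the first frequency of the block. The second-order remainders of the words have no
    usable growth in [m]. They serve only for finitely many [m]; the tail of the series is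
    controlled by Lipschitz bounds drawn from the next derivative. *)

Section RealNorm.
Context {R : realType}.
Implicit Types V : normedModType R[i].

Lemma rnormE V (x : V) : `|x| = (rnorm x)%:C.
Proof. by rewrite /rnorm RRe_real// ger0_real. Qed.

Lemma rnorm_le V (x : V) (e : R) : (`|x| <= e%:C) = (rnorm x <= e).
Proof. by rewrite rnormE lecR. Qed.

Lemma rnorm_ge0 V (x : V) : 0 <= rnorm x.
Proof. by rewrite -lecR -rnormE normr_ge0. Qed.

Lemma rnorm0 V : rnorm (0 : V) = 0.
Proof. by rewrite /rnorm normr0. Qed.

Lemma rnorm_eq0 V (x : V) : rnorm x = 0 -> x = 0.
Proof. by move=> h; apply/eqP; rewrite -normr_eq0 rnormE h. Qed.

Lemma rnormN V (x : V) : rnorm (- x) = rnorm x.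
Proof. by rewrite /rnorm normrN. Qed.

Lemma rnormB V (x y : V) : rnorm (x - y) = rnorm (y - x).
Proof. by rewrite -rnormN opprB. Qed.

Lemma rnormD V (x y : V) : rnorm (x + y) <= rnorm x + rnorm y.
Proof. by rewrite -lecR rmorphD/= -!rnormE ler_normD. Qed.

Lemma rnorm_triB V (y x z : V) : rnorm (x - z) <= rnorm (x - y) + rnorm (y - z).
Proof. by rewrite -{1}(subrK y x) -addrA rnormD. Qed.

Lemma rnormBD V (x y : V) : rnorm (x - y) <= rnorm x + rnorm y.
Proof. by rewrite (le_trans (rnormD _ _))// rnormN. Qed.

Lemma rnorm_sum V (I : Type) (r : seq I) (P : pred I) (F : I -> V) :
  rnorm (\sum_(i <- r | P i) F i) <= \sum_(i <- r | P i) rnorm (F i).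
Proof.
elim/big_rec2: _ => [|i x y _ h]; first by rewrite rnorm0.
by rewrite (le_trans (rnormD _ _))// lerD2l.
Qed.

Lemma rnormZ V (a : R[i]) (x : V) :
  rnorm (a *: x) = rnorm (a : R[i]^o) * rnorm x.
Proof. by apply: complexI; rewrite rmorphM/= -!rnormE normrZ. Qed.

Local Notation cn z := (rnorm (z : R[i]^o)).

Lemma cn_le (z : R[i]) (e : R) : (`|z| <= e%:C) = (cn z <= e).
Proof. exact: (rnorm_le (z : R[i]^o)). Qed.

Lemma cnE (z : R[i]) : `|z| = (cn z)%:C.
Proof. exact: (rnormE (z : R[i]^o)). Qed.

Lemma cnM (a b : R[i]) : cn (a * b) = cn a * cn b.
Proof. exact: (rnormZ a (b : R[i]^o)). Qed.

Lemma cn1 : cn 1 = 1. Proof. by rewrite /rnorm normr1. Qed.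

Lemma cnX (a : R[i]) k : cn (a ^+ k) = cn a ^+ k.
Proof. by elim: k => [|k ih]; rewrite ?expr0 ?cn1// !exprS cnM ih. Qed.

Lemma cnR (a : R) : cn a%:C = `|a|.
Proof. by rewrite /rnorm normc_def/= expr0n/= addr0 sqrtr_sqr. Qed.

Lemma cn_nat k : cn k%:R = k%:R.
Proof. by rewrite -(rmorph_nat (real_complex R)) cnR normr_nat. Qed.

Lemma cnV (a : R[i]) : cn a^-1 = (cn a)^-1.
Proof.
apply: complexI; rewrite -cnE normfV cnE.
by rewrite fmorphV.
Qed.

Lemma cn_conj (a : R[i]) : cn a^* = cn a.
Proof. by apply: complexI; rewrite -!cnE normcJ. Qed.

Lemma circleE (z : R[i]) : circle R z <-> cn z = 1.
Proof.
rewrite /circle/= cnE; split=> [|->//].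
by move/(@complexI R _ 1).
Qed.

Lemma closed_diskE (z : R[i]) : closed_disk R z <-> cn z <= 1.
Proof. by rewrite /closed_disk/= -[1]/(1%:C) cn_le. Qed.

Lemma circle_closed_disk (z : R[i]) : circle R z -> closed_disk R z.
Proof. by move/circleE => h; apply/closed_diskE; rewrite h. Qed.

Lemma conj_circle (z : R[i]) : cn z = 1 -> z^* = z^-1.
Proof. by move=> h; rewrite invc_norm cnE h expr1n invr1 mul1r. Qed.

(** Positive elements of [R[i]] are real, so convergence over [R[i]] may be tested with real [e]. *)
Lemma cvg_rnorm V (T : Type) (F : set_system T) {FF : Filter F} (f : T -> V) (l : V) :
  f t @[t --> F] --> l <->
  forall e : R, 0 < e -> \forall t \near F, rnorm (l - f t) < e.
Proof.
split=> [/cvgrPdist_lt h e e0|h].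
  have := h e%:C; rewrite ltcR => /(_ e0).
  by apply: filterS => t; rewrite rnormE ltcR.
apply/cvgrPdist_lt => e e0; have ee : e = (complex.Re e)%:C by rewrite RRe_real// gtr0_real.
have := h (complex.Re e); rewrite -ltcR -ee => /(_ e0).
by apply: filterS => t; rewrite rnormE ee -!ltcR.
Qed.

Lemma cvg_rnorm_seq V (f : nat -> V) (l : V) :
  f k @[k --> \oo] --> l <->
  forall e : R, 0 < e -> exists N, forall k, (N <= k)%N -> rnorm (l - f k) < e.
Proof.
rewrite cvg_rnorm; split=> h e e0.
  by have [N _ hN] := h e e0; exists N => k Nk; exact: hN.
by have [N hN] := h e e0; exists N.
Qed.

Lemma cvg_rnorm_le V (f : nat -> V) (l x : V) (e : R) N :
  f k @[k --> \oo] --> l -> (forall k, (N <= k)%N -> rnorm (f k - x) <= e) ->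
  rnorm (l - x) <= e.
Proof.
move=> /cvg_rnorm_seq fl h; apply/ler_addgt0Pr => d d0.
have [M hM] := fl _ d0; pose k := maxn N M.
rewrite (le_trans (rnorm_triB (f k) _ _))// addrC lerD ?h ?leq_maxl//.
by rewrite ltW// hM// leq_maxr.
Qed.

Lemma eps_le (c a b : R) : 0 <= c -> (forall e, 0 < e -> a <= b + c * e) -> a <= b.
Proof.
move=> c0 h; apply/ler_addgt0Pr => d d0.
have c1 : 0 < c + 1 by rewrite ltr_wpDl.
rewrite (le_trans (h (d / (c + 1)) _)) ?divr_gt0// lerD2l.
by rewrite mulrA ler_pdivrMr// mulrC ler_wpM2l ?lerDl// ltW.
Qed.

Lemma rnorm_eps (V : normedModType R[i]) (x y : V) (c : R) :
  0 <= c -> (forall e : R, 0 < e -> rnorm (x - y) <= c * e) -> x = y.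
Proof.
move=> c0 h; apply/eqP; rewrite -subr_eq0; apply/eqP/rnorm_eq0/le_anti.
by rewrite rnorm_ge0 andbT (@eps_le c)// => e e0; rewrite add0r h.
Qed.

Lemma cauchy_rnorm (V : completeNormedModType R[i]) (f : nat -> V) :
  (forall e : R, 0 < e -> exists N, forall j k, (N <= j)%N -> (N <= k)%N ->
     rnorm (f j - f k) <= e) ->
  f k @[k --> \oo] --> lim (f k @[k --> \oo]).
Proof.
move=> h; apply: cauchy_cvg.
apply: cauchy_exP => e e0.
have ee : e = (complex.Re e)%:C by rewrite RRe_real// gtr0_real.
have e2 : 0 < complex.Re e / 2 by rewrite divr_gt0// -ltcR -ee.
have [N hN] := h _ e2.
exists (f N), N => // k /= Nk; rewrite -ball_normE/= ee rnormE ltcR.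
rewrite (le_lt_trans (hN _ _ _ _))//.
by rewrite ltr_pdivrMr// mulr_natr mulr2n ltrDl -ltcR -ee.
Qed.

Lemma complex_cauchy (f : nat -> R[i]) :
  (forall e : R, 0 < e -> exists N, forall j k, (N <= j)%N -> (N <= k)%N ->
     cn (f j - f k) <= e) ->
  exists l : R[i], (f k : R[i]^o) @[k --> \oo] --> (l : R[i]^o).
Proof.
move=> h.
have cRe (z : R[i]) : `|complex.Re z| <= cn z.
  by rewrite -lecR -cnE normc_ge_Re.
have cIm (z : R[i]) : `|complex.Im z| <= cn z.
  have -> : complex.Im z = complex.Re (- 'i * z) by case: z => a b; simpc.
  by rewrite (le_trans (cRe _))// cnM rnormN [cn 'i]/rnorm normc_def/= expr0n expr1n add0r sqrtr1 mul1r.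
have cv (p : R[i] -> R) : (forall z w, p (z - w) = p z - p w) ->
    (forall z, `|p z| <= cn z) -> cvg (p (f k) @[k --> \oo]).
  move=> pB ple; apply: cauchy_cvg; apply: cauchy_exP => e e0.
  have e2 : 0 < e / 2 by rewrite divr_gt0.
  have [N hN] := h _ e2.
  exists (p (f N)), N => // k /= Nk; rewrite -ball_normE/= -pB (le_lt_trans (ple _))//.
  rewrite (le_lt_trans (hN _ _ _ _))//.
  by rewrite ltr_pdivrMr// mulr_natr mulr2n ltrDl.
have /cvg_ex[a /cvgrPdist_lt ha] : cvg (complex.Re (f k) @[k --> \oo]).
  by apply: cv cRe => -[? ?] [? ?].
have /cvg_ex[b /cvgrPdist_lt hb] : cvg (complex.Im (f k) @[k --> \oo]).
  by apply: cv cIm => -[? ?] [? ?].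
exists (a +i* b); apply/cvg_rnorm => e e0.
have e2 : 0 < e / 2 by rewrite divr_gt0.
have /= := ha _ e2; have /= := hb _ e2.
apply: filterS2 => k h2 h1.
have -> : a +i* b - f k = (a - complex.Re (f k))%:C + 'i * (b - complex.Im (f k))%:C.
  by case: (f k) => u v /=; simpc.
rewrite (le_lt_trans (rnormD _ _))// cnM !cnR [cn 'i]/rnorm normc_def/= expr0n expr1n add0r sqrtr1 mul1r.
by rewrite [ltRHS](splitr e) ltrD.
Qed.

End RealNorm.

(** * Linear maps and operator bounds *)

Section LinearMaps.
Context {R : realType} {U V W : lmodType R[i]}.
Implicit Types (A B : U -> V).

Lemma linD A (hA : linear A) x y : A (x + y) = A x + A y.
Proof. by rewrite -[x]scale1r hA !scale1r. Qed.

Lemma lin0 A (hA : linear A) : A 0 = 0.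
Proof. by apply: (addIr (A 0)); rewrite -linD// !add0r. Qed.

Lemma linZ A (hA : linear A) a x : A (a *: x) = a *: A x.
Proof. by rewrite -[a *: x]addr0 hA lin0// addr0. Qed.

Lemma linN A (hA : linear A) x : A (- x) = - A x.
Proof. by rewrite -scaleN1r linZ// scaleN1r. Qed.

Lemma linB A (hA : linear A) x y : A (x - y) = A x - A y.
Proof. by rewrite linD// linN. Qed.

Lemma lin_sum A (hA : linear A) (I : Type) (r : seq I) (P : pred I) (F : I -> U) :
  A (\sum_(i <- r | P i) F i) = \sum_(i <- r | P i) A (F i).
Proof. by apply: (big_morph _ (linD hA) (lin0 hA)). Qed.

Lemma linear_zero : linear (0 : U -> V).
Proof. by move=> a x y; rewrite /= scaler0 addr0. Qed.

Lemma linear_add A B : linear A -> linear B -> linear (A + B).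
Proof. by move=> hA hB a x y; rewrite !fctE hA hB scalerDr addrACA. Qed.

Lemma linear_scale A c : linear A -> linear (c *: A).
Proof. by move=> hA a x y; rewrite !fctE hA scalerDr !scalerA mulrC. Qed.

Lemma linear_opp A : linear A -> linear (- A).
Proof. by move=> hA a x y; rewrite !fctE hA opprD scalerN. Qed.

Lemma linear_sub A B : linear A -> linear B -> linear (A - B).
Proof. by move=> hA hB; apply/linear_add/linear_opp. Qed.

Lemma linear_sum (I : Type) (r : seq I) (P : pred I) (F : I -> U -> V) :
  (forall i, P i -> linear (F i)) -> linear (\sum_(i <- r | P i) F i).
Proof.
move=> h; elim/big_ind: _ => //; [exact: linear_zero|].
by move=> A B; apply: linear_add.
Qed.

Lemma linear_comp A (B : V -> W) : linear A -> linear B -> linear (B \o A).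
Proof. by move=> hA hB a x y; rewrite /= hA hB. Qed.

Lemma sumfE (I : Type) (r : seq I) (P : pred I) (F : I -> U -> V) x :
  (\sum_(i <- r | P i) F i) x = \sum_(i <- r | P i) F i x.
Proof. by apply: (big_morph (fun f : U -> V => f x)) => // f g; rewrite fctE. Qed.

End LinearMaps.

Section OpBound.
Context {R : realType}.
Implicit Types U V W : normedModType R[i].
Local Notation cn z := (rnorm (z : R[i]^o)).

(** The working form of [opnorm A <= C], equivalent to it for linear maps by [opnorm_le]: sums,
    scalings and compositions are estimated with real constants, without extended reals. *)
Definition opbnd U V (A : U -> V) (C : R) := forall x, rnorm (A x) <= C * rnorm x.

Lemma opbnd_le U V (A : U -> V) C D : C <= D -> opbnd A C -> opbnd A D.
Proof. by move=> CD h x; rewrite (le_trans (h x))// ler_wpM2r// rnorm_ge0. Qed.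

Lemma opbndD U V (A B : U -> V) C D : opbnd A C -> opbnd B D -> opbnd (A + B) (C + D).
Proof. by move=> hA hB x; rewrite fctE (le_trans (rnormD _ _))// mulrDl lerD. Qed.

Lemma opbndN U V (A : U -> V) C : opbnd A C -> opbnd (- A) C.
Proof. by move=> hA x; rewrite fctE rnormN. Qed.

Lemma opbndB U V (A B : U -> V) C D : opbnd A C -> opbnd B D -> opbnd (A - B) (C + D).
Proof. by move=> hA hB; apply/opbndD/opbndN. Qed.

Lemma opbnd_distC U V (A B : U -> V) C : opbnd (A - B) C -> opbnd (B - A) C.
Proof. by move=> /opbndN; rewrite opprB. Qed.

Lemma opbnd_tri U V (B A C : U -> V) c d :
  opbnd (A - B) c -> opbnd (B - C) d -> opbnd (A - C) (c + d).
Proof. by move=> h1 h2; rewrite -(subrKA B); apply: opbndD. Qed.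

Lemma opbndZ U V (A : U -> V) C a : opbnd A C -> opbnd (a *: A) (cn a * C).
Proof.
by move=> hA x; rewrite fctE rnormZ -mulrA ler_wpM2l// rnorm_ge0.
Qed.

Lemma opbnd0 U V : opbnd (0 : U -> V) 0.
Proof. by move=> x; rewrite rnorm0 mul0r. Qed.

Lemma opbnd_sum U V (I : Type) (r : seq I) (P : pred I) (F : I -> U -> V) (c : I -> R) :
  (forall i, P i -> opbnd (F i) (c i)) ->
  opbnd (\sum_(i <- r | P i) F i) (\sum_(i <- r | P i) c i).
Proof.
move=> h; elim/big_ind2: _ => //; first exact: opbnd0.
by move=> A a B b; apply: opbndD.
Qed.

Lemma opbnd_comp U V W (A : U -> V) (B : V -> W) C D :
  0 <= D -> opbnd A C -> opbnd B D -> opbnd (B \o A) (D * C).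
Proof.
by move=> D0 hA hB x /=; rewrite (le_trans (hB _))// -mulrA ler_wpM2l.
Qed.

Lemma opbnd_eps U V (A : U -> V) b c : 0 <= c ->
  (forall e : R, 0 < e -> opbnd A (b + c * e)) -> opbnd A b.
Proof.
move=> c0 h x; apply: (@eps_le _ (c * rnorm x)) => [|e e0].
  by rewrite mulr_ge0// rnorm_ge0.
by rewrite (le_trans (h e e0 x))// mulrDl mulrAC.
Qed.

Lemma opbnd_eq U V (A B : U -> V) c : 0 <= c ->
  (forall e : R, 0 < e -> opbnd (A - B) (c * e)) -> A = B.
Proof.
move=> c0 h; apply/funext => x; apply: (@rnorm_eps _ _ _ _ (c * rnorm x)).
  by rewrite mulr_ge0// rnorm_ge0.
by move=> e e0; rewrite (le_trans (h e e0 x))// mulrAC.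
Qed.

Lemma opnorm_le U V (A : U -> V) C : linear A -> 0 <= C ->
  (opnorm A <= C%:E)%E <-> opbnd A C.
Proof.
move=> lA C0; split=> [h x|h]; last first.
  apply: ge_ereal_sup => _ [x /= x1 <-]; rewrite lee_fin (le_trans (h x))//.
  by rewrite ler_piMr.
have [x0|x0] := eqVneq (rnorm x) 0.
  by rewrite (rnorm_eq0 x0) lin0// !rnorm0 mulr0.
have xp : 0 < rnorm x by rewrite lt_neqAle eq_sym x0 rnorm_ge0.
have y1 : rnorm ((rnorm x)^-1%:C *: x) <= 1.
  by rewrite rnormZ cnR ger0_norm ?invr_ge0 ?rnorm_ge0// mulVf.
have : ((rnorm (A ((rnorm x)^-1%:C *: x)))%:E <= C%:E)%E.
  by apply: le_trans h; apply: ereal_sup_ubound => /=; exists ((rnorm x)^-1%:C *: x).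
rewrite lee_fin linZ// rnormZ cnR ger0_norm ?invr_ge0 ?rnorm_ge0//.
by rewrite mulrC ler_pdivrMr.
Qed.

Lemma opnorm_ge0 U V (A : U -> V) : linear A -> (0 <= opnorm A)%E.
Proof.
move=> lA; apply: ereal_sup_ubound => /=; exists 0; last by rewrite lin0// rnorm0.
by rewrite rnorm0.
Qed.

Lemma bounded_opP U V (A : U -> V) :
  bounded_op A <-> linear A /\ exists C, 0 <= C /\ opbnd A C.
Proof.
split=> -[lA h]; split=> //.
  have fA : opnorm A \is a fin_num by rewrite ge0_fin_numE// opnorm_ge0.
  exists (fine (opnorm A)); split; first by rewrite fine_ge0// opnorm_ge0.
  by apply/opnorm_le => //; rewrite ?fine_ge0 ?opnorm_ge0// fineK.
have [C [C0 hC]] := h.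
by apply: (@le_lt_trans _ _ C%:E); [apply/opnorm_le|rewrite ltry].
Qed.

Lemma contractiveP U V (A : U -> V) : contractive A <-> linear A /\ opbnd A 1.
Proof. by split=> -[lA h]; split=> //; apply/opnorm_le. Qed.

Lemma cvge0P (T : Type) (F : set_system T) {FF : Filter F} (u : T -> \bar R) :
  (forall t, (0 <= u t)%E) ->
  u t @[t --> F] --> (0 : \bar R) <->
  forall e : R, 0 < e -> \forall t \near F, (u t <= e%:E)%E.
Proof.
move=> u0; split.
  move/fine_cvgP => [h1 /cvgrPdist_le h2] e e0; have := h2 e e0.
  apply: filterS2 h1 => t ft; rewrite /= sub0r normrN ger0_norm ?fine_ge0//.
  by move=> h; rewrite -(fineK ft) lee_fin.
move=> h; apply/fine_cvgP; split.
  apply: filterS (h 1 ltr01) => t ht; rewrite ge0_fin_numE//.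
  by rewrite (le_lt_trans ht)// ltry.
apply/cvgrPdist_le => e e0; apply: filterS (h e e0) => t ht /=.
have ft : u t \is a fin_num by rewrite ge0_fin_numE// (le_lt_trans ht)// ltry.
by rewrite sub0r normrN ger0_norm ?fine_ge0// -lee_fin fineK.
Qed.

Lemma opcvgP U V (T : Type) (F : set_system T) {FF : Filter F} (A : T -> U -> V) :
  (forall t, linear (A t)) ->
  opnorm (A t) @[t --> F] --> (0%E : \bar R) <->
  forall e : R, 0 < e -> \forall t \near F, opbnd (A t) e.
Proof.
move=> lA; rewrite cvge0P//; last by move=> t; apply: opnorm_ge0.
by split=> h e e0; apply: filterS (h e e0) => t /opnorm_le; apply => //; rewrite ltW.
Qed.

Lemma op_cvgP U V (A : nat -> U -> V) (L : U -> V) :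
  (forall k, linear (A k)) -> linear L ->
  op_cvg A L <-> forall e : R, 0 < e -> exists N, forall k, (N <= k)%N -> opbnd (A k - L) e.
Proof.
move=> lA lL; rewrite /op_cvg opcvgP//; last by move=> k; apply: linear_sub.
split=> h e e0.
  by have [N _ hN] := h e e0; exists N => k Nk; exact: hN.
by have [N hN] := h e e0; exists N.
Qed.

(** The last clause carries each Cauchy estimate over to the limit, so that explicit rates
    survive. *)
Lemma op_cauchy U (V : completeNormedModType R[i]) (A : nat -> U -> V) C :
  (forall k, linear (A k)) -> (forall k, opbnd (A k) C) -> 0 <= C ->
  (forall e : R, 0 < e -> exists N, forall j k, (N <= j)%N -> (N <= k)%N ->
    opbnd (A j - A k) e) ->
  exists L, [/\ linear L, opbnd L C & forall e N, 
    (forall j k, (N <= j)%N -> (N <= k)%N -> opbnd (A j - A k) e) ->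
    forall k, (N <= k)%N -> opbnd (L - A k) e].
Proof.
move=> lA bA C0 h; pose L x := lim (A k x @[k --> \oo]).
have AL x : A k x @[k --> \oo] --> L x.
  apply: cauchy_rnorm => e e0.
  have e1 : 0 < e / (rnorm x + 1) by rewrite divr_gt0// ltr_wpDl// rnorm_ge0.
  have [N hN] := h _ e1; exists N => j k Nj Nk.
  have := hN j k Nj Nk x; rewrite !fctE => /le_trans; apply.
  rewrite mulrAC ler_pdivrMr; last by rewrite ltr_wpDl// rnorm_ge0.
  by rewrite ler_wpM2l ?lerDl// ltW.
exists L; split.
- move=> a x y; rewrite {1}/L; apply: cvg_lim; first exact: norm_hausdorff.
  have -> : (fun k => A k (a *: x + y)) = (fun k => a *: A k x + A k y).
    by apply/funext => k; rewrite lA.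
  by apply: cvgD => //; apply: cvgZr.
- move=> x; have := @cvg_rnorm_le _ _ (fun k => A k x) (L x) 0 (C * rnorm x) 0 (AL x).
  by rewrite subr0; apply => k _; rewrite subr0 bA.
- move=> e N hN k Nk x; rewrite !fctE.
  apply: (cvg_rnorm_le (AL x) (N := N)) => j Nj.
  by have := hN j k Nj Nk x; rewrite !fctE.
Qed.

End OpBound.

(** * Inner products and compressions *)

Section InnerProduct.
Context {R : realType}.
Implicit Types H K : hilbertType R.

Lemma ip_linl H (z : H) : linear (fun x => ip x z : R[i]^o).
Proof. by move=> a x y; rewrite linearPl. Qed.

Lemma ipDl H (x y z : H) : ip (x + y) z = ip x z + ip y z.
Proof. by rewrite linearDl. Qed.

Lemma ipBl H (x y z : H) : ip (x - y) z = ip x z - ip y z.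
Proof. by rewrite linearBl. Qed.

Lemma ipZl H a (x z : H) : ip (a *: x) z = a * ip x z.
Proof. by rewrite linearZl_LR. Qed.

Lemma ip_suml H (I : Type) (r : seq I) (P : pred I) (F : I -> H) z :
  ip (\sum_(i <- r | P i) F i) z = \sum_(i <- r | P i) ip (F i) z.
Proof. exact: (lin_sum (ip_linl z)). Qed.

Lemma ipC H (x y : H) : ip x y = Num.conj (ip y x).
Proof. by rewrite hermC expr0 mul1r. Qed.

Lemma ipDr H (x y z : H) : ip x (y + z) = ip x y + ip x z.
Proof. by rewrite ipC ipDl rmorphD/= -!ipC. Qed.

Lemma ipZr H a (x z : H) : ip x (a *: z) = Num.conj a * ip x z.
Proof. by rewrite ipC ipZl rmorphM/= -ipC. Qed.

Lemma ipBr H (x y z : H) : ip x (y - z) = ip x y - ip x z.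
Proof. by rewrite -[- z]scaleN1r ipDr ipZr rmorphN1 mulN1r. Qed.

Lemma ip0r H (x : H) : ip x 0 = 0.
Proof. by rewrite -[0](subrr x) ipBr subrr. Qed.

Lemma ip_sumr H (I : Type) (r : seq I) (P : pred I) (F : I -> H) z :
  ip z (\sum_(i <- r | P i) F i) = \sum_(i <- r | P i) ip z (F i).
Proof. by apply: (big_morph _ (@ipDr _ z) (ip0r z)). Qed.

Lemma ip_sqr H (x : H) : ip x x = (rnorm x ^+ 2)%:C.
Proof. by rewrite ip_normE rnormE rmorphXn. Qed.

Lemma ip_eq H (x y : H) : (forall z, ip x z = ip y z) -> x = y.
Proof.
move=> h; apply/eqP; rewrite -subr_eq0; apply/eqP/rnorm_eq0.
have : ip (x - y) (x - y) = 0 by rewrite ipBl h subrr.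
by rewrite ip_sqr => /(@complexI R _ 0) /eqP; rewrite sqrf_eq0 => /eqP.
Qed.

Lemma ip_CauchySchwarz H (x y : H) :
  rnorm (ip x y : R[i]^o) <= rnorm x * rnorm y.
Proof.
have [y0|y0] := eqVneq (rnorm y) 0.
  by rewrite (rnorm_eq0 y0) ip0r !rnorm0 mulr0.
have yp : 0 < rnorm y by rewrite lt_neqAle eq_sym y0 rnorm_ge0.
(* [u] is the part of [x] orthogonal to [y]; Pythagoras bounds [|a| |y|] by [|x|]. *)
pose a := ip x y / ip y y; pose u := x - a *: y.
have yy : ip y y != 0 by rewrite ip_sqr (inj_eq (@complexI R) _ 0) sqrf_eq0.
have uy : ip u y = 0 by rewrite ipBl ipZl divfK// subrr.
have yu : ip y u = 0 by rewrite ipC uy rmorph0.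
have : ip x x = ip u u + a * Num.conj a * ip y y.
  have -> : ip x x = ip (u + a *: y) (u + a *: y) by rewrite subrK.
  move: (u) uy yu => v uy yu.
  by rewrite ipDl !ipDr !ipZl !ipZr yu uy !mulr0 addr0 add0r mulrA.
rewrite !ip_sqr -normCK (rnormE (a : R[i]^o)) -rmorphXn -rmorphM -rmorphD.
move=> /complexI e1.
have : (rnorm (a : R[i]^o) * rnorm y) ^+ 2 <= rnorm x ^+ 2.
  by rewrite e1 exprMn lerDr sqr_ge0.
rewrite ler_pXn2r ?nnegrE ?mulr_ge0 ?rnorm_ge0// /a cnM cnV ip_sqr cnR.
rewrite ger0_norm ?sqr_ge0// expr2 invfM mulrA mulfVK// ler_pdivrMr//.
Qed.

(** The identity in [compression] without its boundedness clause: it passes to linear combinations,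
    and bounds and linearity descend from [B] to [A] when [V] is isometric. *)
Definition cmpr H K (V : H -> K) (B : K -> K) (A : H -> H) :=
  forall x y, ip (A x) y = ip (B (V x)) (V y).

Lemma isom_rnorm H K (V : H -> K) x : isometric_embedding V -> rnorm (V x) = rnorm x.
Proof.
move=> [_ h]; have := h x x; rewrite !ip_sqr => /complexI /eqP.
by rewrite eqrXn2 ?rnorm_ge0// => /eqP.
Qed.

(** Test the identity on [y = A x] and use Cauchy-Schwarz, then divide by [|A x|]. *)
Lemma cmpr_bnd H K (V : H -> K) B A C : isometric_embedding V ->
  cmpr V B A -> opbnd B C -> opbnd A C.
Proof.
move=> iV h bB x; have [A0|A0] := eqVneq (rnorm (A x)) 0.
  rewrite A0 -(isom_rnorm x iV); exact: le_trans (rnorm_ge0 _) (bB _).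
have Ap : 0 < rnorm (A x) by rewrite lt_neqAle eq_sym A0 rnorm_ge0.
rewrite -(ler_pM2r Ap).
have -> : rnorm (A x) * rnorm (A x) = rnorm (ip (A x) (A x) : R[i]^o).
  by rewrite ip_sqr cnR ger0_norm ?sqr_ge0// expr2.
rewrite h (le_trans (ip_CauchySchwarz _ _))// (isom_rnorm _ iV).
by rewrite ler_wpM2r ?rnorm_ge0// (le_trans (bB _))// (isom_rnorm _ iV).
Qed.

Lemma cmpr_linear H K (V : H -> K) B A : isometric_embedding V -> linear B ->
  cmpr V B A -> linear A.
Proof.
move=> [lV _] lB h a x y; apply: ip_eq => z.
by rewrite ipDl ipZl !h lV lB ipDl ipZl.
Qed.

Lemma cmpr_sub H K (V : H -> K) B A B' A' :
  cmpr V B A -> cmpr V B' A' -> cmpr V (B - B') (A - A').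
Proof. by move=> h h' x y; rewrite !fctE !ipBl h h'. Qed.

Lemma cmpr_lincomb H K (V : H -> K) (I : Type) (r : seq I) (c : I -> R[i])
    (B : I -> K -> K) (A : I -> H -> H) : (forall i, cmpr V (B i) (A i)) ->
  cmpr V (\sum_(i <- r) c i *: B i) (\sum_(i <- r) c i *: A i).
Proof.
move=> h x y; rewrite !sumfE !ip_suml; apply: eq_bigr => i _.
by rewrite !fctE !ipZl h.
Qed.

(** Polarization: the quadratic form is real at [x + y] and at [x + 'i *: y], which settles the
    imaginary and the real part respectively. *)
Lemma positive_selfadj H (A : H -> H) : linear A -> (forall x, 0 <= ip (A x) x) ->
  forall x y, ip (A x) y = ip x (A y).
Proof.
move=> lA pA x y; rewrite [RHS]ipC.
set a := ip (A x) y; set b := ip (A y) x.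
have rl z : complex.Im (ip (A z) z) = 0 by apply: ger0_Im.
have h1 : complex.Im (a + b) = 0.
  have := rl (x + y); rewrite (linD lA) ipDl !ipDr -/a -/b.
  rewrite -addrA [b + _]addrC !addrA => h.
  have := rl x; have := rl y; move: h; rewrite -!addrA.
  by move: (ip (A x) x) (ip (A y) y) a b => [? ?] [? ?] [? ?] [? ?] /= h0 h1 h2; lra.
have h2 : complex.Im ('i * (b - a)) = 0.
  have := rl (x + 'i *: y); rewrite (linD lA) (linZ lA) ipDl !ipDr !ipZl !ipZr -/a -/b.
  have -> : Num.conj ('i : R[i]) = - 'i by rewrite -complexiE conjCi.
  have := rl x; have := rl y.
  clear h1; move: (ip (A x) x) (ip (A y) y) a b => [? ?] [? ?] [? ?] [? ?] /=.
  by rewrite !(mul0r, mul1r, add0r, subr0, oppr0, addr0, mulN1r, sub0r, opprK, mulr0) => h0 h1' h3; lra.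
move: a b h1 h2 => [a1 a2] [b1 b2] /=.
rewrite !(mul0r, mul1r, add0r, subr0, oppr0, addr0) => h1 h2.
have -> : Num.conj (b1 +i* b2) = b1 -i* b2 by [].
by apply/eqP; rewrite eq_complex/=; apply/andP; split; apply/eqP; lra.
Qed.

End InnerProduct.

(** * Integrals with respect to semi-spectral measures *)

Section BorelPartition.
Context {R : realType}.
Local Notation borel := (borel_circle R).

Lemma borel_sub D : borel D -> D `<=` circle R.
Proof.
move=> h; apply: (h [set X | X `<=` circle R]); split; last first.
  by move=> _ [U _ <-] z [].
split=> /=; [by move=> z []|by move=> A _ z []|].
by move=> A hA z [k _]; apply: hA.
Qed.

Lemma borel0 : borel set0. Proof. exact: sigma_algebra0. Qed.

Lemma borelC D : borel D -> borel (circle R `\` D).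
Proof. exact: sigma_algebraCD. Qed.

Lemma borelU A B : borel A -> borel B -> borel (A `|` B).
Proof.
move=> hA hB; rewrite -bigcup2E; apply: sigma_algebra_bigcup => -[|[|k]] //=.
exact: borel0.
Qed.

Lemma borelI A B : borel A -> borel B -> borel (A `&` B).
Proof.
move=> hA hB; have -> : A `&` B = circle R `\` ((circle R `\` A) `|` (circle R `\` B)).
  apply/seteqP; split=> z /=.
    move=> [Az Bz]; split; first exact: borel_sub Az.
    by move=> [[]|[]].
  move=> [Cz /not_orP[h1 h2]].
  by split; apply: contrapT => h; [apply: h1|apply: h2].
by apply: borelC; apply: borelU; apply: borelC.
Qed.

Lemma borelD A B : borel A -> borel B -> borel (A `\` B).
Proof.
move=> hA hB; have -> : A `\` B = A `&` (circle R `\` B).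
  apply/seteqP; split=> z /=; last by move=> [? []].
  by move=> [Az Bz]; split=> //; split=> //; apply: borel_sub Az.
by apply: borelI => //; apply: borelC.
Qed.

Lemma borel_open (U : set R[i]) : @open R[i]^o U -> borel (circle R `&` U).
Proof. by move=> oU; apply: sub_sigma_algebra; exists U. Qed.

(** Any finite type may index the cells, so that a common refinement is indexed by a product; cells
    may be empty. *)
Record borel_partition (I : finType) (D : I -> set R[i]) : Prop := BorelPartition {
  partition_borel : forall i, borel (D i);
  partition_disj : forall i j z, D i z -> D j z -> i = j;
  partition_cover : forall z, circle R z -> exists i, D i z }.

Definition refine (I J : finType) (D : I -> set R[i]) (D' : J -> set R[i]) (p : I * J) :=
  D p.1 `&` D' p.2.

Lemma refine_partition (I J : finType) (D : I -> set R[i]) (D' : J -> set R[i]) :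
  borel_partition D -> borel_partition D' -> borel_partition (refine D D').
Proof.
move=> h h'; split.
- by move=> p; apply: borelI; apply: partition_borel.
- move=> [i j] [i' j'] z [/= a b] [/= c d].
  by rewrite (partition_disj h a c) (partition_disj h' b d).
- move=> z cz; have [i Di] := partition_cover h cz.
  by have [j Dj] := partition_cover h' cz; exists (i, j).
Qed.

End BorelPartition.

Section SemispectralSums.
Context {R : realType} {H : hilbertType R}.
Variable E : set R[i] -> H -> H.
Hypothesis hE : semispectral E.
Local Notation borel := (borel_circle R).

Lemma semispectral_linear D : borel D -> linear (E D).
Proof. by case: hE => h _ _ _ /h [[]]. Qed.

Lemma semispectral0 x : E set0 x = 0.
Proof. by case: hE => _ -> _ _. Qed.

Lemma semispectral_ge0 D x : borel D -> 0 <= ip (E D x) x.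
Proof. by case: hE => h _ _ _ /h [_]; apply. Qed.

Lemma semispectral_fin (I : finType) (D : I -> set R[i]) x :
  (forall i, borel (D i)) -> (forall i j z, D i z -> D j z -> i = j) ->
  E (\bigcup_i D i) x = \sum_i E (D i) x.
Proof.
move=> bD dD; apply: ip_eq => y; rewrite ip_suml.
case: hE => _ E0 _ hadd.
(* Countable additivity is applied to the enumerated family continued by empty sets, on which [E]
   vanishes; the partial sums are constant from [#|I|] on. *)
pose D' k := if insub k is Some j then D (@enum_val I predT j) else set0.
have D'E k z : D' k z -> exists i, k = enum_rank i :> nat /\ D i z.
  rewrite /D'; case: insubP => // j _ jk Dz; exists (enum_val j).
  by rewrite enum_valK.
have bD' k : borel (D' k) by rewrite /D'; case: insubP => // *; apply: borel0.
have tD' : trivIset setT D'.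
  move=> i j _ _ [z [/D'E [a [-> Da]] /D'E [b [-> Db]]]].
  by rewrite (dD _ _ _ Da Db).
have -> : \bigcup_i D i = \bigcup_k D' k.
  apply/seteqP; split=> z [i _]; last by move=> /D'E [a [_ Da]]; exists a.
  move=> Di; exists (enum_rank i) => //; rewrite /D' insubT// => lt.
  by rewrite (_ : Sub _ _ = enum_rank i) ?enum_rankK//; apply: val_inj.
have /cvg_rnorm_seq hl := hadd D' bD' tD' x y.
apply: (@rnorm_eps _ _ _ _ 1) => // e e0; have [N hN] := hl _ e0.
rewrite mul1r; have := hN (#|I| + N)%N (leq_addl _ _).
rewrite big_split_ord/= [X in _ - (_ + X)]big1 ?addr0 => [|k _]; last first.
  by rewrite /D' insubF ?E0/= ?linear0l// ltnNge leq_addr.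
move=> /ltW; congr (rnorm (_ - _) <= _).
rewrite (reindex enum_rank)/=; last first.
  by apply: onW_bij; exists enum_val; [exact: enum_rankK|exact: enum_valK].
apply: eq_bigr => i _; rewrite /D' insubT// => lt.
by rewrite (_ : Sub _ _ = enum_rank i) ?enum_rankK//; apply: val_inj.
Qed.

Lemma semispectral_refine (I J : finType) (D : I -> set R[i]) (D' : J -> set R[i]) x i :
  borel_partition D -> borel_partition D' ->
  E (D i) x = \sum_j E (refine D D' (i, j)) x.
Proof.
move=> h h'; rewrite -(@semispectral_fin _ (fun j => refine D D' (i, j))).
- congr (E _ x); apply/seteqP; split=> z; last by move=> [j _ []].
  move=> Dz; have [j Dj] := partition_cover h' (borel_sub (partition_borel h i) Dz).
  by exists j.
- by move=> j; apply: (partition_borel (refine_partition h h')).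
- by move=> j k z hj hk; have [] := partition_disj (refine_partition h h') hj hk.
Qed.

Lemma semispectral_sum1 (I : finType) (D : I -> set R[i]) x :
  borel_partition D -> \sum_i E (D i) x = x.
Proof.
move=> h; rewrite -semispectral_fin; [|exact: partition_borel|exact: partition_disj].
case: hE => _ _ E1 _; rewrite -[RHS]/(id x) -E1; congr (E _ x).
apply/seteqP; split=> z; first by move=> [i _]; apply: borel_sub; apply: partition_borel.
by move=> cz; have [i Di] := partition_cover h cz; exists i.
Qed.

Definition step_op (I : finType) (D : I -> set R[i]) (c : I -> R[i]) :=
  \sum_i c i *: E (D i).

Lemma step_opE (I : finType) (D : I -> set R[i]) c x :
  step_op D c x = \sum_i c i *: E (D i) x.
Proof. by rewrite /step_op sumfE. Qed.

Lemma step_op_linear (I : finType) (D : I -> set R[i]) c :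
  borel_partition D -> linear (step_op D c).
Proof.
move=> h; apply: linear_sum => i _; apply: linear_scale.
by apply: semispectral_linear; apply: partition_borel.
Qed.

(** Two step operators can be compared only on a common refinement; there their difference is again
    a step operator, so one norm bound covers both size and distance. *)
Lemma step_op_sub (I J : finType) (D : I -> set R[i]) (D' : J -> set R[i]) c c' :
  borel_partition D -> borel_partition D' ->
  step_op D c - step_op D' c' =
    step_op (refine D D') (fun p => c p.1 - c' p.2).
Proof.
move=> h h'; apply/funext => x; rewrite !fctE !step_opE.
under [RHS]eq_bigr do rewrite scalerBl.
rewrite sumrB; congr (_ - _).
  rewrite (eq_bigr (fun p => c p.1 *: E (refine D D' (p.1, p.2)) x)); last by case.
  rewrite -(pair_bigA _ (fun i j => c i *: E (refine D D' (i, j)) x))/=.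
  by apply: eq_bigr => i _; rewrite -scaler_sumr -semispectral_refine.
rewrite (eq_bigr (fun p => c' p.2 *: E (refine D D' (p.1, p.2)) x)); last by case.
rewrite -(pair_bigA _ (fun i j => c' j *: E (refine D D' (i, j)) x))/=.
rewrite exchange_big/=; apply: eq_bigr => j _; rewrite -scaler_sumr.
rewrite (semispectral_refine _ _ h' h); congr (_ *: _); apply: eq_bigr => i _.
by rewrite /refine/= setIC.
Qed.

End SemispectralSums.

Section SpectralSums.
Context {R : realType} {K : hilbertType R}.
Variable F : set R[i] -> K -> K.
Hypothesis hF : spectral F.
Local Notation cn z := (rnorm (z : R[i]^o)).
Local Notation borel := (borel_circle R).
Let sF : semispectral F := proj1 hF.

Lemma spectral_idem D x : borel D -> F D (F D x) = F D x.
Proof. by move=> h; have /= := congr1 (fun f => f x) (proj2 hF D h). Qed.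

Lemma spectral_selfadj D x y : borel D -> ip (F D x) y = ip x (F D y).
Proof.
move=> h; apply: positive_selfadj; first exact: semispectral_linear.
by move=> z; apply: semispectral_ge0.
Qed.

(* With [P = F D] and [Q = F D'], additivity on [D `|` D'] gives [P Q + Q P = 0]; for
   idempotents this forces [P Q = 0]. *)
Lemma spectral_orth D D' x : borel D -> borel D' ->
  (forall z, D z -> D' z -> False) -> F D (F D' x) = 0.
Proof.
move=> bD bD' dis; set P := F D; set Q := F D'.
have lP : linear P by apply: semispectral_linear.
have lQ : linear Q by apply: semispectral_linear.
have PQ y : F (D `|` D') y = P y + Q y.
  have := @semispectral_fin _ _ _ sF bool (fun b : bool => if b then D else D') y.
  rewrite big_bool/= => <-.
  - by congr (F _ y); apply/seteqP; split=> z; [case; [exists true|exists false]|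
      case=> -[] _ ?; [left|right]].
  - by case.
  - by move=> [] [] // z a b; case: (dis z).
have PQ0 y : P (Q y) + Q (P y) = 0.
  have := spectral_idem y (borelU bD bD'); rewrite !PQ (linD lP) (linD lQ).
  rewrite /P /Q !spectral_idem// -/P -/Q -addrA => /addrI; rewrite addrA => h.
  by apply: (addIr (Q y)); rewrite add0r.
have h1 : P (Q x) + P (Q (P x)) = 0.
  have := congr1 P (PQ0 x); rewrite (linD lP) (lin0 lP).
  by rewrite -{1}[Q x](spectral_idem x bD') /P spectral_idem// -/P spectral_idem.
have h2 : P (Q (P x)) + Q (P x) = 0.
  by have := PQ0 (P x); rewrite /P spectral_idem.
have h3 : P (Q x) = Q (P x).
  by apply: (addIr (P (Q (P x)))); rewrite h1 addrC h2.
have /eqP := PQ0 x; rewrite -h3 -mulr2n -scaler_nat scaler_eq0 pnatr_eq0/=.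
by move/eqP.
Qed.

(** The ranges of the [F (D i)] are mutually orthogonal, so this is Parseval:
    [|step_op F D c x| ^ 2] is the sum of [|c i| ^ 2 |F (D i) x| ^ 2]. *)
Lemma step_op_bnd (I : finType) (D : I -> set R[i]) (c : I -> R[i]) M : borel_partition D ->
  0 <= M -> (forall i z, D i z -> cn (c i) <= M) -> opbnd (step_op F D c) M.
Proof.
move=> h M0 hc x; rewrite -(@ler_pXn2r _ 2)// ?nnegrE ?mulr_ge0 ?rnorm_ge0//.
have bD := partition_borel h.
have orth i j : j != i -> ip (F (D i) x) (F (D j) x) = 0.
  move=> ij; rewrite spectral_selfadj// spectral_orth ?ip0r// => z Di Dj.
  by rewrite (partition_disj h Di Dj) eqxx in ij.
have sq i : ip (F (D i) x) (F (D i) x) = ip (F (D i) x) x.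
  by rewrite -spectral_selfadj// spectral_idem.
have -> : rnorm (step_op F D c x) ^+ 2 =
    \sum_i cn (c i) ^+ 2 * rnorm (F (D i) x) ^+ 2.
  apply: complexI; rewrite -ip_sqr step_opE ip_suml rmorph_sum/=.
  apply: eq_bigr => i _; rewrite ip_sumr (bigD1 i)//= big1 ?addr0; last first.
    by move=> j ji; rewrite ipZl ipZr orth// !mulr0.
  by rewrite ipZl ipZr mulrA -normCK ip_sqr cnE -rmorphXn -rmorphM.
have -> : (M * rnorm x) ^+ 2 = \sum_i M ^+ 2 * rnorm (F (D i) x) ^+ 2.
  rewrite -mulr_sumr exprMn; congr (_ * _); apply: complexI.
  rewrite -ip_sqr -{1}(semispectral_sum1 sF x h) ip_suml rmorph_sum/=.
  by apply: eq_bigr => i _; rewrite -ip_sqr sq.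
apply: ler_sum => i _.
(* The bound on [c i] is known only on a nonempty cell; on an empty one [F (D i)] is zero. *)
have [Di|Di] := pselect (exists z, D i z).
  have [z Dz] := Di; apply: ler_wpM2r; first exact: sqr_ge0.
  by rewrite ler_pXn2r ?nnegrE ?rnorm_ge0//; apply: hc Dz.
rewrite (_ : D i = set0) ?(semispectral0 sF) ?rnorm0 ?expr0n ?mulr0//.
by apply/seteqP; split=> z // Dz; case: Di; exists z.
Qed.

Lemma step_op_dist (I J : finType) (D : I -> set R[i]) (D' : J -> set R[i]) c c' e :
  borel_partition D -> borel_partition D' -> 0 <= e ->
  (forall i j z, D i z -> D' j z -> cn (c i - c' j) <= e) ->
  opbnd (step_op F D c - step_op F D' c') e.
Proof.
move=> h h' e0 he; rewrite (step_op_sub sF)//; apply: step_op_bnd => //.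
  exact: refine_partition.
by move=> [i j] z [/= Di Dj]; apply: he Di Dj.
Qed.

(** Orthogonality kills the mixed products and idempotence keeps the diagonal ones: integration of
    step functions is multiplicative. *)
Lemma step_op_exp (I : finType) (D : I -> set R[i]) c m x :
  borel_partition D -> iter m (step_op F D c) x = step_op F D (fun i => c i ^+ m) x.
Proof.
move=> h; have bD := partition_borel h.
elim: m => [|m ih] /=.
  rewrite step_opE (eq_bigr (fun i => F (D i) x)); last first.
    by move=> i _; rewrite expr0 scale1r.
  by rewrite (semispectral_sum1 sF).
rewrite ih !step_opE; apply: eq_bigr => i _.
rewrite (lin_sum (semispectral_linear sF (bD i))) (bigD1 i)//= big1 ?addr0; last first.
  move=> j ji; rewrite (linZ (semispectral_linear sF (bD i))) spectral_orth ?scaler0//.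
  by move=> z Di Dj; rewrite (partition_disj h Di Dj) eqxx in ji.
by rewrite (linZ (semispectral_linear sF (bD i))) spectral_idem// scalerA exprS.
Qed.

End SpectralSums.

(** * Compactness of the disk and partitions of small oscillation *)

Section CompactDisk.
Context {R : realType}.
Local Notation cn z := (rnorm (z : R[i]^o)).

Lemma ge_Re (z : R[i]) : `|complex.Re z| <= cn z.
Proof. by rewrite -lecR -cnE normc_ge_Re. Qed.

Lemma cn_i : cn 'i = 1.
Proof. by rewrite /rnorm normc_def/= expr0n expr1n add0r sqrtr1. Qed.

Lemma ge_Im (z : R[i]) : `|complex.Im z| <= cn z.
Proof.
have -> : complex.Im z = complex.Re (- 'i * z) by case: z => a b; simpc.
by rewrite (le_trans (ge_Re _))// cnM rnormN cn_i mul1r.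
Qed.

Lemma le_ReIm (z : R[i]) : cn z <= `|complex.Re z| + `|complex.Im z|.
Proof.
have {1}-> : z = (complex.Re z)%:C + 'i * (complex.Im z)%:C by case: z => a b; simpc.
by rewrite (le_trans (rnormD _ _))// cnM !cnR cn_i mul1r.
Qed.

Lemma continuous_cn : continuous (fun z : R[i]^o => cn z).
Proof.
move=> z; apply/(@cvgrPdist_lt R R R[i]^o (nbhs z) _ (fun z => cn z) (cn z)) => e e0.
have : \forall w \near nbhs z, cn (z - w) < e.
  by apply: (proj1 (@cvg_rnorm R R[i]^o _ (nbhs z) _ (fun w => w) z)) => //; exact: cvg_id.
apply: filterS => w; apply: le_lt_trans.
rewrite ler_norml; apply/andP; split; last first.
  by rewrite lerBlDr -{1}(subrK w z) rnormD.
rewrite lerNl opprB lerBlDr rnormB -{1}(subrK z w); exact: rnormD.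
Qed.

Lemma compact_closed_disk : compact (closed_disk R : set R[i]^o).
Proof.
pose f (p : R * R) : R[i]^o := p.1 +i* p.2.
have cf : continuous f.
  move=> [a b]; apply/cvg_rnorm => e e0.
  have e2 : 0 < e / 2 by rewrite divr_gt0.
  have : \forall p \near (a, b), ball a (e / 2) p.1 /\ ball b (e / 2) p.2.
    by exists (ball a (e / 2), ball b (e / 2)) => //; split=> /=; apply: nbhsx_ballx.
  apply: filterS => -[x y]; rewrite -!ball_normE /= => -[ax by_].
  by rewrite (le_lt_trans (le_ReIm _))//= [ltRHS](splitr e) ltrD.
have cI : compact (`[-1, 1] `*` `[-1, 1] : set (R * R)).
  by apply: compact_setX; apply: segment_compact.
have := continuous_compact (continuous_subspaceT cf) cI.
move=> cQ; apply: (subclosed_compact _ cQ).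
- have -> : (closed_disk R : set R[i]^o) = (fun z : R[i]^o => cn z) @^-1` [set x | x <= 1].
    by apply/seteqP; split => z /closed_diskE.
  by apply: closed_comp; [move=> z _; exact: continuous_cn|exact: closed_le].
- move=> z /closed_diskE z1; exists (complex.Re z, complex.Im z); last by case: z z1.
  by split=> /=; rewrite in_itv/= -ler_norml (le_trans _ z1)// ?ge_Re ?ge_Im.
Qed.

Lemma compact_circle : compact (circle R : set R[i]^o).
Proof.
apply: (subclosed_compact _ compact_closed_disk).
  have -> : (circle R : set R[i]^o) = (fun z : R[i]^o => cn z) @^-1` [set x | x = 1].
    by apply/seteqP; split => z /circleE.
  by apply: closed_comp; [move=> z _; exact: continuous_cn|exact: closed_eq].
exact: circle_closed_disk.
Qed.

Lemma within_cn (A : set R[i]) (f : R[i] -> R[i]) z e :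
  {within (A : set R[i]^o), continuous (f : R[i]^o -> R[i]^o)} -> A z -> 0 < e ->
  exists2 r : R, 0 < r & forall w, A w -> cn (w - z) < r -> cn (f w - f z) < e.
Proof.
move=> /subspace_continuousP /= cf Az e0.
have := cf z Az; rewrite cvg_rnorm => /(_ _ e0).
rewrite near_withinE -filter_from_ballE => -[r /= r0 hr].
have rr : r = (complex.Re r)%:C by rewrite RRe_real// gtr0_real.
exists (complex.Re r); first by rewrite -ltcR -rr.
move=> w Aw wz; rewrite rnormB; apply: hr => //.
by rewrite -ball_normE/= rr cnE ltcR rnormB.
Qed.

(** One cover serves all functions of a finite family; the uniqueness of multiple integrals needs a
    partition common to many factors. *)
Lemma finite_oscillation (A : set R[i]) (K : finType) (h : K -> R[i] -> R[i]) e :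
  compact (A : set R[i]^o) ->
  (forall k, {within (A : set R[i]^o), continuous (h k : R[i]^o -> R[i]^o)}) ->
  0 < e -> exists N (U : 'I_N -> set R[i]) (c : 'I_N -> R[i]),
    [/\ forall i, @open R[i]^o (U i), forall i, A (c i),
        forall z, A z -> exists i, U i z &
        forall i k z, A z -> U i z -> cn (h k z - h k (c i)) <= e].
Proof.
move=> cA ch e0.
have hr z : exists r : R, A z -> 0 < r /\
    forall k w, A w -> cn (w - z) < r -> cn (h k w - h k z) < e.
  have [Az|nAz] := pselect (A z); last by exists 0.
  pose P k r := 0 < r /\ forall w, A w -> cn (w - z) < r -> cn (h k w - h k z) < e.
  have /choice[r hr] : forall k, exists r, P k r.
    by move=> k; have [r r0 hr] := within_cn (ch k) Az e0; exists r.
  (* The default [1] keeps the radius positive even when [K] is empty. *)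
  exists (\big[Num.min/1]_k r k) => _; split.
    by apply: lt_bigmin => // k _; case: (hr k).
  move=> k w Aw wr; apply: (hr k).2 => //; apply: lt_le_trans wr _.
  by apply: bigmin_le_cond; rewrite ?mem_index_enum.
move/choice: hr => [r hr].
pose U z : set R[i]^o := [set w | cn (w - z) < r z].
have oU z : open (U z).
  have -> : U z = (fun w : R[i]^o => cn (w - z)) @^-1` [set x | x < r z] by [].
  apply: open_comp => [w _|]; last exact: open_lt.
  apply: (@continuous_comp _ _ _ (fun w : R[i]^o => w - (z : R[i]^o)) (fun z : R[i]^o => cn z));
    last exact: continuous_cn.
  by apply: (@cvgD R[i] R[i]^o _ (nbhs w) _ id (cst (- (z : R[i]^o)))); [exact: cvg_id|exact: cvg_cst].
rewrite compact_cover in cA.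
have [|z Az|F FA AF] := cA R[i] A U; first by [].
  by exists z => //; rewrite /U/= subrr rnorm0; case: (hr z Az).
pose s : seq R[i] := finmap.enum_fset F.
have sA i : (i < size s)%N -> A (nth 0 s i).
  by move=> lt; apply/set_mem/FA/mem_nth.
exists (size s), (fun i => U (nth 0 s i)), (fun i => nth 0 s i); split.
- by move=> i; apply: oU.
- by move=> i; apply: sA.
- move=> z /AF[x /= xF Uxz].
  have xs : x \in s by [].
  by exists (Ordinal (eq_ind_r is_true xs (index_mem x s))); rewrite /= nth_index.
- by move=> i k z Az Uz; apply/ltW/(hr _ (sA _ (ltn_ord i))).2.
Qed.

(** Each cell is a set of the open cover with the earlier ones removed. Hence [c i] lies on the
    circle but possibly outside [D i], and the oscillation is measured from it all the same. *)
Lemma oscillation_partition (K : finType) (h : K -> R[i] -> R[i]) e :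
  (forall k, {within (circle R : set R[i]^o), continuous (h k : R[i]^o -> R[i]^o)}) ->
  0 < e -> exists N (D : 'I_N -> set R[i]) (c : 'I_N -> R[i]),
    [/\ borel_partition D, forall i, circle R (c i) &
        forall i k z, D i z -> cn (h k z - h k (c i)) <= e].
Proof.
move=> ch e0; have [N [U [c [oU cA cov osc]]]] := finite_oscillation compact_circle ch e0.
pose D (i : 'I_N) := (circle R `&` U i) `\` (circle R `&` \bigcup_(j in [set j : 'I_N | (j < i)%N]) U j).
have DU i z : D i z -> circle R z /\ U i z by case.
exists N, D, c; split=> //; last by move=> i k z /DU[zc Uz]; apply: osc.
split.
- move=> i; apply: borelD; first exact: borel_open.
  by apply: borel_open; apply: bigcup_open => j _; apply: oU.
- have D_lt i j z : D i z -> D j z -> (i < j)%N -> False.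
    by move=> [[cz Uiz] _] [_ hj] ij; apply: hj; split=> //; exists i.
  move=> i j z Di Dj; apply: val_inj; case: (ltngtP i j) => //.
    by move=> /(D_lt _ _ _ Di Dj).
  by move=> /(D_lt _ _ _ Dj Di).
- move=> z cz; have [i0 Ui0] := cov z cz.
  (* A point belongs to the cell of the least index whose open set contains it. *)
  have ex : exists n, `[< exists i : 'I_N, i = n :> nat /\ U i z >].
    by exists i0; apply/asboolP; exists i0.
  case: (ex_minnP ex) => n /asboolP[i [ein Ui]] nmin; exists i.
  split=> // -[_ [j /= ji Uj]].
  have := nmin j; rewrite leqNgt -ein ji => h'.
  by have : false by apply: h'; apply/asboolP; exists j.
Qed.

Lemma disk_algebra_circle (f : R[i] -> R[i]) : disk_algebra f ->
  {within (circle R : set R[i]^o), continuous (f : R[i]^o -> R[i]^o)}.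
Proof. by move=> [_]; apply/continuous_subspaceW/circle_closed_disk. Qed.

Lemma supnorm_ge (f : R[i] -> R[i]) z : closed_disk R z ->
  ((cn (f z))%:E <= supnorm f)%E.
Proof. by move=> dz; apply: ereal_sup_ubound; exists z. Qed.

Lemma supnorm_le (f : R[i] -> R[i]) M : (forall z, cn z <= 1 -> cn (f z) <= M) ->
  (supnorm f <= M%:E)%E.
Proof.
by move=> h; apply: ge_ereal_sup => _ [z /closed_diskE dz <-]; rewrite lee_fin h.
Qed.

Lemma supnorm_ge0 (f : R[i] -> R[i]) : (0 <= supnorm f)%E.
Proof.
apply: (@le_trans _ _ (cn (f 0))%:E); first by rewrite lee_fin rnorm_ge0.
by apply: supnorm_ge; apply/closed_diskE; rewrite rnorm0.
Qed.

Lemma supnorm_fin (f : R[i] -> R[i]) : disk_algebra f -> supnorm f \is a fin_num.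
Proof.
move=> [_ cf]; rewrite ge0_fin_numE ?supnorm_ge0//.
have [N [U [c [_ cA cov osc]]]] :=
  @finite_oscillation _ unit (fun _ => f) 1 compact_closed_disk (fun=> cf) ltr01.
apply: (@le_lt_trans _ _ (\sum_i cn (f (c i)) + 1)%:E); last by rewrite ltry.
apply: supnorm_le => z /closed_diskE dz; have [i Ui] := cov z dz.
rewrite -{1}(subrK (f (c i)) (f z)) addrC (le_trans (rnormD _ _))// lerD ?(osc i tt)//.
by rewrite (bigD1 i)//= lerDl sumr_ge0// => j _; rewrite rnorm_ge0.
Qed.

Lemma cn_supnorm (f : R[i] -> R[i]) z : disk_algebra f -> circle R z ->
  cn (f z) <= fine (supnorm f).
Proof.
move=> hf cz; rewrite -lee_fin fineK ?supnorm_fin//.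
by apply/supnorm_ge/circle_closed_disk.
Qed.


End CompactDisk.

(** * Spectral integrals of continuous functions *)

Section SpectralIntegral.
Context {R : realType}.
Implicit Types H K : hilbertType R.
Local Notation cn z := (rnorm (z : R[i]^o)).
Local Notation circle_continuous f :=
  {within (circle R : set R[i]^o), continuous (f : R[i]^o -> R[i]^o)}.

Lemma is_spectral_intP K (F : set R[i] -> K -> K) f A : spectral F ->
  is_spectral_int F f A <-> bounded_op A /\ forall e : R, 0 < e ->
  exists N (D : 'I_N -> set R[i]) (c : 'I_N -> R[i]),
    [/\ borel_partition D, forall i z, D i z -> cn (f z - c i) <= e &
        opbnd (A - step_op F D c) e].
Proof.
move=> hF; split=> -[bA h]; split=> // e e0; have [N [D [c]]] := h e e0.
  case=> bD tD cD fc AD; exists N, D, c.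
  have pD : borel_partition D.
    split=> //; last by move=> z; rewrite -cD => -[i _]; exists i.
    by move=> i j z Di Dj; apply: (tD i j) => //; exists z.
  split=> //; first by move=> i z /fc; rewrite cn_le.
  apply/opnorm_le => //; last exact: ltW.
  by apply: linear_sub; [case: bA|apply: step_op_linear (proj1 hF) _ _ _ pD].
case=> pD fc AD; exists N, D, c; split.
- exact: partition_borel.
- by move=> i j _ _ [z [Di Dj]]; apply: partition_disj Di Dj.
- apply/seteqP; split=> z; first by move=> [i _]; apply: borel_sub; apply: partition_borel.
  by move=> cz; have [i Di] := partition_cover pD cz; exists i.
- by move=> i z /fc; rewrite cn_le.
- apply/opnorm_le => //; last exact: ltW.
  by apply: linear_sub; [case: bA|apply: step_op_linear (proj1 hF) _ _ _ pD].
Qed.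

(** The definition of the integral supplies some good partition for each accuracy; comparison with
    it on a common refinement shows that every partition adapted to [f] is good. *)
Lemma spectral_int_dist K (F : set R[i] -> K -> K) f B (I : finType)
    (D : I -> set R[i]) (c : I -> R[i]) e :
  spectral F -> is_spectral_int F f B -> borel_partition D -> 0 <= e ->
  (forall i z, D i z -> cn (f z - c i) <= e) -> opbnd (B - step_op F D c) e.
Proof.
move=> hF /(is_spectral_intP _ _ hF)[_ hB] pD e0 hc.
apply: (@opbnd_eps _ _ _ _ _ 2) => // d d0.
have [N [D' [c' [pD' hc' bB]]]] := hB d d0.
have -> : e + 2 * d = d + (e + d) by lra.
apply: opbnd_tri bB _; apply: step_op_dist => //; first by rewrite addr_ge0// ltW.
move=> i j z Di Dj; rewrite (le_trans (rnorm_triB (f z : R[i]^o) _ _))//.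
by rewrite addrC lerD// ?hc// rnormB hc'.
Qed.

Lemma circle_bounded (f : R[i] -> R[i]) : circle_continuous f ->
  exists M, forall z, circle R z -> cn (f z) <= M.
Proof.
move=> cf; have [N [D [c [pD _ hc]]]] :=
  @oscillation_partition R unit (fun=> f) 1 (fun=> cf) ltr01.
exists (\sum_i cn (f (c i)) + 1) => z cz; have [i Di] := partition_cover pD cz.
rewrite -(subrK (f (c i)) (f z)) addrC (le_trans (rnormD _ _))// lerD ?(hc i tt)//.
by rewrite (bigD1 i)//= lerDl sumr_ge0// => j _; rewrite rnorm_ge0.
Qed.

(** What is used of Naimark's theorem. A semi-spectral measure of a contraction has this property by
    definition. *)
Definition dilatable H (E : set R[i] -> H -> H) :=
  semispectral E /\ exists K (V : H -> K) (F : set R[i] -> K -> K),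
    spectral_dilation V E F.

Lemma cmpr_step_op H K (V : H -> K) E F (I : finType) (D : I -> set R[i])
    (c : I -> R[i]) : spectral_dilation V E F -> borel_partition D ->
  cmpr V (step_op F D c) (step_op E D c).
Proof.
move=> [_ _ h] pD; apply: cmpr_lincomb => i.
by case: (h _ (partition_borel pD i)).
Qed.

(** Step operators along ever finer partitions are Cauchy for [F]; their compressions, the step
    operators for [E], are then Cauchy with the same rate, and the compression identity passes to
    the limit. *)
Lemma spectral_int_exists H K (V : H -> K) E F f :
  semispectral E -> spectral_dilation V E F -> circle_continuous f ->
  exists B A, is_spectral_int F f B /\ compression V B A.
Proof.
move=> hE dil cf; have [iV hF _] := dil.
have [M hM] := circle_bounded cf.
have M0 : 0 <= M.
  by rewrite (le_trans _ (hM 1 _)) ?rnorm_ge0//; apply/circleE; rewrite cn1.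
(* The number of cells varies with [k], hence the dependent pair. *)
pose P (k : nat) (p : {N & (('I_N -> set R[i]) * ('I_N -> R[i]))%type}) :=
  [/\ borel_partition (projT2 p).1, forall i, cn ((projT2 p).2 i) <= M &
    forall i z, (projT2 p).1 i z -> cn (f z - (projT2 p).2 i) <= k.+1%:R^-1].
have /choice[p hp] : forall k, exists p, P k p.
  move=> k; have [||N [D [c [pD cc hc]]]] :=
    @oscillation_partition R unit (fun=> f) k.+1%:R^-1 => //.
  exists (existT _ N (D, fun i => f (c i))); split => //=.
    by move=> i; apply: hM.
  by move=> i z; apply: (hc i tt).
pose S k := step_op F (projT2 (p k)).1 (projT2 (p k)).2.
pose S' k := step_op E (projT2 (p k)).1 (projT2 (p k)).2.
have cS k : cmpr V (S k) (S' k) by apply: cmpr_step_op => //; case: (hp k).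
have lS k : linear (S k) by apply: step_op_linear (proj1 hF) _ _ _ _; case: (hp k).
have lS' k : linear (S' k) by apply: cmpr_linear (cS k).
have bS k : opbnd (S k) M.
  by apply: step_op_bnd => // [|i z _]; case: (hp k).
have bS' k : opbnd (S' k) M by apply: cmpr_bnd (cS k) (bS k).
have dS j k : opbnd (S j - S k) (j.+1%:R^-1 + k.+1%:R^-1).
  have [pj _ hj] := hp j; have [pk _ hk] := hp k.
  apply: step_op_dist => // i l z Di Dl.
  rewrite (le_trans (rnorm_triB (f z : R[i]^o) _ _))// lerD ?hk//.
  by rewrite rnormB hj.
have dS' j k : opbnd (S' j - S' k) (j.+1%:R^-1 + k.+1%:R^-1).
  by apply: (cmpr_bnd iV _ (dS j k)); apply: (cmpr_sub (cS j) (cS k)).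
have small (e : R) : 0 < e -> exists N, forall j k, (N <= j)%N -> (N <= k)%N ->
    (j.+1%:R^-1 + k.+1%:R^-1 : R) <= e.
  move=> e0; have e2 : 0 < e / 2 by rewrite divr_gt0.
  have [N _ hN] := near_infty_natSinv_lt (PosNum e2).
  by exists N => j k /hN /= hj /hN /= hk; rewrite [leRHS](splitr e) lerD// ltW.
have [e e0|B [lB bB hB]] := op_cauchy lS bS M0.
  by have [N hN] := small e e0; exists N => j k Nj Nk; apply: opbnd_le (dS j k); apply: hN.
have [e e0|A [lA bA hA]] := op_cauchy lS' bS' M0.
  by have [N hN] := small e e0; exists N => j k Nj Nk; apply: opbnd_le (dS' j k); apply: hN.
exists B, A; split.
  apply/is_spectral_intP => //; split; first by apply/bounded_opP; split=> //; exists M.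
  move=> e e0; have [N hN] := small e e0.
  exists (projT1 (p N)), (projT2 (p N)).1, (projT2 (p N)).2.
  have [pD _ hc] := hp N; split => //.
    move=> i z /hc h; apply: le_trans h _; rewrite -(lerD2r N.+1%:R^-1).
    by rewrite (le_trans (hN N N _ _))// lerDl invr_ge0.
  apply: (hB e N) => // j k Nj Nk; apply: opbnd_le (dS j k); exact: hN.
split; first by apply/bounded_opP; split=> //; exists M.
move=> x y; apply: (@rnorm_eps R R[i]^o _ _ (2 * (rnorm x * rnorm y))).
  by rewrite !mulr_ge0// rnorm_ge0.
move=> e e0; have [N hN] := small e e0.
have bN : opbnd (B - S N) e.
  by apply: (hB e N) => // j k Nj Nk; apply: opbnd_le (dS j k); exact: hN.
have aN : opbnd (A - S' N) e.
  by apply: (hA e N) => // j k Nj Nk; apply: opbnd_le (dS' j k); exact: hN.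
have -> : ip (A x) y - ip (B (V x)) (V y) =
    ip ((A - S' N) x) y - ip ((B - S N) (V x)) (V y).
  by rewrite !fctE !ipBl cS opprB addrA subrK.
rewrite (le_trans (rnormBD _ _))// !mulrDl mul1r.
rewrite lerD// (le_trans (ip_CauchySchwarz _ _))//.
  by rewrite [leRHS]mulrC mulrA ler_wpM2r ?rnorm_ge0.
rewrite !(isom_rnorm _ iV) [leRHS]mulrC mulrA.
by rewrite ler_wpM2r ?rnorm_ge0// (le_trans (bN _))// (isom_rnorm _ iV).
Qed.

End SpectralIntegral.

Section PolyFun.
Variable K : numFieldType.

Lemma continuous_poly_fun (p : {poly K}) : continuous (fun z : K^o => p.[z] : K^o).
Proof.
elim/poly_ind: p => [|p a ih] z.
  have -> : (fun y : K^o => (0 : {poly K}).[y] : K^o) = cst 0.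
    by apply/funext => y; rewrite horner0.
  exact: cst_continuous.
rewrite (_ : (fun _ => _) = (fun y : K^o => p.[y] * y + a)); last first.
  by apply/funext => y; rewrite hornerMXaddC.
apply: (@cvgD K K^o _ (nbhs z) _ (fun y : K^o => p.[y] * y : K^o) (cst (a : K^o))).
  by apply: (@cvgM K _ (nbhs z) _ (fun y : K^o => p.[y]) id); [exact: ih|exact: cvg_id].
exact: cvg_cst.
Qed.

Lemma derivable_poly_fun (p : {poly K}) z : derivable (fun z : K^o => p.[z] : K^o) z 1.
Proof.
elim/poly_ind: p => [|p a ih].
  have -> : (fun y : K^o => (0 : {poly K}).[y] : K^o) = cst 0.
    by apply/funext => y; rewrite horner0.
  exact: derivable_cst.
rewrite (_ : (fun _ => _) = (fun y : K^o => p.[y] * y + a)); last first.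
  by apply/funext => y; rewrite hornerMXaddC.
apply: derivableD; last exact: derivable_cst.
by apply: derivableM; [exact: ih|exact: derivable_id].
Qed.

End PolyFun.

(** * Integrals against dilatable measures and von Neumann's inequality *)

Section DilatableCalculus.
Context {R : realType}.
Implicit Types H K : hilbertType R.
Local Notation cn z := (rnorm (z : R[i]^o)).
Local Notation circle_continuous f :=
  {within (circle R : set R[i]^o), continuous (f : R[i]^o -> R[i]^o)}.

Lemma semispectral_intP H (E : set R[i] -> H -> H) f : dilatable E -> circle_continuous f ->
  exists K (V : H -> K) F B, [/\ spectral_dilation V E F, is_spectral_int F f B &
    compression V B (semispectral_int E f)].
Proof.
move=> [hE [K [V [F dil]]]] cf; rewrite /semispectral_int.
apply: (@xgetPex _ 0 [set A | exists K (V : H -> K) F B, [/\ spectral_dilation V E F,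
  is_spectral_int F f B & compression V B A]]).
have [B [A [h1 h2]]] := spectral_int_exists hE dil cf.
by exists A, K, V, F, B.
Qed.

Lemma compressed_int_dist H K (V : H -> K) E F f B A (I : finType)
    (D : I -> set R[i]) (c : I -> R[i]) e :
  spectral_dilation V E F -> is_spectral_int F f B -> cmpr V B A ->
  borel_partition D -> 0 <= e -> (forall i z, D i z -> cn (f z - c i) <= e) ->
  opbnd (A - step_op E D c) e.
Proof.
move=> dil hB hA pD e0 hc; have [iV hF _] := dil.
apply: (@cmpr_bnd _ _ _ V (B - step_op F D c)) => //.
  by apply: cmpr_sub => //; apply: cmpr_step_op.
exact: (spectral_int_dist hF hB pD e0 hc).
Qed.

Lemma ssint_dist H (E : set R[i] -> H -> H) f (I : finType) (D : I -> set R[i])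
    (c : I -> R[i]) e : dilatable E -> circle_continuous f ->
  borel_partition D -> 0 <= e -> (forall i z, D i z -> cn (f z - c i) <= e) ->
  opbnd (semispectral_int E f - step_op E D c) e.
Proof.
move=> hE cf; have [K [V [F [B [dil hB [_ hc]]]]]] := semispectral_intP hE cf.
exact: compressed_int_dist dil hB hc.
Qed.

(** The approximants [step_op E D c] involve only [E], so any dilation leads to the same
    operator. *)
Lemma ssint_uniq H K (V : H -> K) E F f B A : dilatable E -> circle_continuous f ->
  spectral_dilation V E F -> is_spectral_int F f B -> cmpr V B A ->
  semispectral_int E f = A.
Proof.
move=> hE cf dil hB hA; apply: (@opbnd_eq _ _ _ _ _ 2) => // e e0.
have [N [D [c [pD _ hc]]]] := @oscillation_partition _ unit (fun=> f) e (fun=> cf) e0.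
have -> : 2 * e = e + e by lra.
apply: opbnd_tri (opbnd_distC _).
  by apply: (ssint_dist hE cf pD (ltW e0) (fun i => hc i tt)).
by apply: (compressed_int_dist dil hB hA pD (ltW e0) (fun i => hc i tt)).
Qed.

Lemma ssint_linear H (E : set R[i] -> H -> H) f : dilatable E -> circle_continuous f ->
  linear (semispectral_int E f).
Proof. by move=> hE cf; have [K [V [F [B [_ _ [[]]]]]]] := semispectral_intP hE cf. Qed.

(** The [E (D i)] need not be orthogonal; the bound is taken in the dilation, where they become
    projections, and compressed. *)
Lemma step_op_dilatable_bnd H (E : set R[i] -> H -> H) (I : finType)
    (D : I -> set R[i]) (c : I -> R[i]) M : dilatable E -> borel_partition D ->
  0 <= M -> (forall i z, D i z -> cn (c i) <= M) -> opbnd (step_op E D c) M.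
Proof.
move=> [_ [K [V [F dil]]]] pD M0 hc; have [iV hF _] := dil.
by apply: (@cmpr_bnd _ _ _ V (step_op F D c)) => //; [exact: cmpr_step_op|exact: step_op_bnd].
Qed.

Lemma ssint_bnd H (E : set R[i] -> H -> H) f M : dilatable E -> circle_continuous f ->
  (forall z, circle R z -> cn (f z) <= M) -> opbnd (semispectral_int E f) M.
Proof.
move=> hE cf hM; apply: (@opbnd_eps _ _ _ _ _ 1) => // e e0.
have M0 : 0 <= M.
  by rewrite (le_trans _ (hM 1 _)) ?rnorm_ge0//; apply/circleE; rewrite cn1.
have [N [D [c [pD cc hc]]]] := @oscillation_partition _ unit (fun=> f) e (fun=> cf) e0.
rewrite mul1r -(subrK (step_op E D (fun i => f (c i))) (semispectral_int E f)) addrC.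
apply: opbndD; first by apply: step_op_dilatable_bnd => // i z _; apply: hM.
by apply: (ssint_dist hE cf pD (ltW e0) (fun i => hc i tt)).
Qed.

Lemma cn_expB (z w : R[i]) k : cn z <= 1 -> cn w <= 1 ->
  cn (z ^+ k - w ^+ k) <= k%:R * cn (z - w).
Proof.
move=> z1 w1; rewrite subrXX cnM mulrC ler_wpM2r ?rnorm_ge0//.
rewrite (le_trans (rnorm_sum _ _ _))//.
apply: (@le_trans _ _ (\sum_(i < k) 1)); last by rewrite sumr_const card_ord.
apply: ler_sum => i _; rewrite cnM !cnX mulr_ile1 ?exprn_ge0 ?rnorm_ge0//.
  by rewrite exprn_ile1 ?rnorm_ge0.
by rewrite exprn_ile1 ?rnorm_ge0.
Qed.

Lemma opbnd_iter H (A : H -> H) k : opbnd A 1 -> opbnd (iter k A) 1.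
Proof.
move=> h; elim: k => [|k ih] x /=; first by rewrite mul1r.
by rewrite (le_trans (h _))// !mul1r (le_trans (ih x))// mul1r.
Qed.

Lemma linear_iter H (A : H -> H) k : linear A -> linear (iter k A).
Proof. by move=> h; elim: k => [|k ih] a x y //=; rewrite ih h. Qed.

Lemma opbnd_iterB H (A B : H -> H) k d : linear A -> opbnd A 1 -> opbnd B 1 ->
  opbnd (A - B) d -> 0 <= d -> opbnd (iter k A - iter k B) (k%:R * d).
Proof.
move=> lA bA bB bAB d0; elim: k => [|k ih]; first by rewrite mul0r subrr; exact: opbnd0.
rewrite (_ : iter k.+1 A - iter k.+1 B =
  (A \o (iter k A - iter k B)) + ((A - B) \o iter k B)); last first.
  by apply/funext => x; rewrite !fctE /= (linB lA) addrA subrK.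
rewrite -natr1 mulrDl mul1r; apply: opbndD.
  by rewrite -[_ * d]mul1r; apply: opbnd_comp.
by rewrite -[d in opbnd _ d]mulr1; apply: opbnd_comp => //; apply: opbnd_iter.
Qed.

Lemma poly_op_linear H (p : {poly R[i]}) (T : H -> H) : linear T -> linear (poly_op p T).
Proof. by move=> lT; apply: linear_sum => i _; apply/linear_scale/linear_iter. Qed.

(** A step operator near [U] has powers that are step operators, so [p] of it integrates a step
    function near [p]. *)
Lemma spectral_int_poly K (F : set R[i] -> K -> K) U (p : {poly R[i]}) : spectral F ->
  is_spectral_int F id U -> linear U -> opbnd U 1 ->
  is_spectral_int F (fun z => p.[z]) (poly_op p U).
Proof.
move=> hF hU lU bU; apply/is_spectral_intP => //; split.
  apply/bounded_opP; split; first exact: poly_op_linear.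
  exists (\sum_(i < size p) cn p`_i * 1); split.
    by apply: sumr_ge0 => i _; rewrite mulr_ge0// rnorm_ge0.
  by apply: opbnd_sum => i _; apply/opbndZ/opbnd_iter.
(* [S] is a Lipschitz constant of [p] on the closed disk; dividing by [S + 1] avoids the case
   [S = 0]. *)
move=> e e0; pose S := \sum_(k < size p) cn p`_k * k%:R.
have S0 : 0 <= S by apply: sumr_ge0 => i _; rewrite mulr_ge0// rnorm_ge0.
have S1 : 0 < S + 1 by rewrite ltr_wpDl.
pose d := e / (S + 1); have d0 : 0 < d by rewrite divr_gt0.
have dS : S * d <= e by rewrite /d mulrA ler_pdivrMr// mulrC ler_wpM2l ?lerDl// ltW.
have d2 : 0 < d / 2 by rewrite divr_gt0.
have [N [D [c0 [pD hc0 _]]]] := ((is_spectral_intP _ _ hF).1 hU).2 _ d2.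
(* The values [c0 i] may leave the disk. They are replaced by points of the cells, which costs a
   factor 2 and makes the step operator a contraction; an empty cell gets the value [1]. *)
have /choice[c hc] : forall i, exists w, circle R w /\ forall z, D i z -> cn (z - w) <= d.
  move=> i; have [[w Dw]|nD] := pselect (exists w, D i w); last first.
    exists 1; split; first by apply/circleE; rewrite cn1.
    by move=> z Dz; case: nD; exists z.
  exists w; split; first exact: (borel_sub (partition_borel pD i)).
  move=> z Dz; rewrite (le_trans (rnorm_triB (c0 i : R[i]^o) _ _))//.
  by rewrite (splitr d) lerD ?hc0// rnormB hc0.
have c1 i : cn (c i) <= 1 by rewrite (circleE _).1//; case: (hc i).
have US : opbnd (U - step_op F D c) d.
  by apply: (spectral_int_dist hF hU pD (ltW d0)) => i z Dz; case: (hc i) => _; apply.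
have bS : opbnd (step_op F D c) 1 by apply: step_op_bnd.
have DC i z : D i z -> cn z <= 1.
  by move=> Dz; rewrite (circleE _).1//; apply: borel_sub Dz; apply: partition_borel.
exists N, D, (fun i => p.[c i]); split => //.
  move=> i z Dz; rewrite !horner_coef -sumrB (le_trans (rnorm_sum _ _ _))//.
  apply: le_trans dS; rewrite mulr_suml; apply: ler_sum => k _.
  rewrite -mulrBr cnM -mulrA ler_wpM2l ?rnorm_ge0//.
  rewrite (le_trans (cn_expB _ _ _))//; first exact: DC Dz.
  by rewrite ler_wpM2l//; case: (hc i) => _; apply.
have -> : step_op F D (fun i => p.[c i]) = \sum_(k < size p) p`_k *: iter k (step_op F D c).
  apply/funext => x; rewrite step_opE sumfE.
  rewrite (eq_bigr (fun k : 'I_(size p) => \sum_i (p`_k * c i ^+ k) *: F (D i) x)).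
    rewrite exchange_big/=; apply: eq_bigr => i _.
    by rewrite horner_coef scaler_suml.
  move=> k _; rewrite fctE (step_op_exp hF)// step_opE scaler_sumr.
  by apply: eq_bigr => i _; rewrite scalerA.
rewrite /poly_op -sumrB; apply: (opbnd_le dS); rewrite mulr_suml.
apply: opbnd_sum => k _; rewrite -scalerBr -mulrA; apply: opbndZ.
by apply: opbnd_iterB => //; exact: ltW.
Qed.

Lemma circle_continuous_poly (p : {poly R[i]}) : circle_continuous (fun z => p.[z]).
Proof. by apply: continuous_subspaceT; exact: continuous_poly_fun. Qed.

Lemma disk_algebra_poly (p : {poly R[i]}) : disk_algebra (fun z => p.[z]).
Proof.
split; last by apply: continuous_subspaceT; exact: continuous_poly_fun.
by move=> z _; exact: derivable_poly_fun.
Qed.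

Lemma measure_dilatable H (T : H -> H) E : semispectral_measure_of T E -> dilatable E.
Proof.
by move=> [hE [K [V [U [F [_ _ dil]]]]]]; split=> //; exists K, V, F.
Qed.

Lemma ssint_poly H (T : H -> H) E (p : {poly R[i]}) : semispectral_measure_of T E ->
  semispectral_int E (fun z => p.[z]) = poly_op p T.
Proof.
move=> hE; have dE := measure_dilatable hE.
case: hE => hE [K [V [U [F [[iV [iU _] cUT] hU dil]]]]].
have [_ hF _] := dil.
apply: (ssint_uniq dE (@circle_continuous_poly p) dil).
  apply: spectral_int_poly hU _ _ => //; first by case: iU.
  by move=> x; rewrite (isom_rnorm x iU) mul1r.
by apply: cmpr_lincomb => k; case: (cUT k).
Qed.

Lemma von_Neumann H (T : H -> H) E (p : {poly R[i]}) M : semispectral_measure_of T E ->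
  (forall z, cn z = 1 -> cn p.[z] <= M) -> opbnd (poly_op p T) M.
Proof.
move=> hE hM; rewrite -(ssint_poly p hE); apply: ssint_bnd.
- exact: measure_dilatable hE.
- exact: circle_continuous_poly.
- by move=> z /circleE; apply: hM.
Qed.

End DilatableCalculus.

(** * Multiple operator integrals *)

Section Interleave.
Context {R : realType} {H : hilbertType R}.

Lemma interleave0 (A : 'I_1 -> H -> H) (Q : 'I_0 -> H -> H) : interleave A Q = A ord0.
Proof. by rewrite /interleave big_ord0. Qed.

Lemma interleaveS n (A : 'I_n.+2 -> H -> H) (Q : 'I_n.+1 -> H -> H) :
  interleave A Q = (A ord0 \o Q ord0) \o
    interleave (fun j => A (lift ord0 j)) (fun j => Q (lift ord0 j)).
Proof. by rewrite /interleave big_ord_recl. Qed.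

Lemma interleave_linear n (A : 'I_n.+1 -> H -> H) (Q : 'I_n -> H -> H) :
  (forall j, linear (A j)) -> (forall i, linear (Q i)) -> linear (interleave A Q).
Proof.
elim: n A Q => [|n ih] A Q lA lQ; first by rewrite interleave0.
rewrite interleaveS; apply: linear_comp; first by apply: ih.
exact: linear_comp.
Qed.

Lemma interleave_bnd n (A : 'I_n.+1 -> H -> H) (Q : 'I_n -> H -> H) a q :
  (forall j, 0 <= a j) -> (forall i, 0 <= q i) ->
  (forall j, opbnd (A j) (a j)) -> (forall i, opbnd (Q i) (q i)) ->
  opbnd (interleave A Q) (\prod_j a j * \prod_i q i).
Proof.
elim: n A Q a q => [|n ih] A Q a q a0 q0 bA bQ.
  by rewrite interleave0 big_ord_recl !big_ord0 !mulr1.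
rewrite interleaveS big_ord_recl [\prod_i q i]big_ord_recl mulrACA.
apply: opbnd_comp; first by rewrite mulr_ge0.
  by apply: ih.
exact: opbnd_comp.
Qed.

(** [C] depends only on the bounds [a] and [q]: it must be known before the partition, which decides
    [d], is chosen. *)
Lemma interleave_lipschitz n (a : 'I_n.+1 -> R) (q : 'I_n -> R) :
  (forall j, 0 <= a j) -> (forall i, 0 <= q i) ->
  exists C, 0 <= C /\ forall (A A' : 'I_n.+1 -> H -> H) (Q : 'I_n -> H -> H) d,
    0 <= d -> (forall j, linear (A' j)) -> (forall i, linear (Q i)) ->
    (forall i, opbnd (Q i) (q i)) ->
    (forall j, opbnd (A j) (a j)) -> (forall j, opbnd (A' j) (a j)) ->
    (forall j, opbnd (A j - A' j) d) ->
    opbnd (interleave A Q - interleave A' Q) (C * d).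
Proof.
elim: n a q => [|n ih] a q a0 q0.
  exists 1; split=> // A A' Q d _ _ _ _ _ _ h; rewrite !interleave0 mul1r; exact: h.
have [||C [C0 hC]] := ih (fun j => a (lift ord0 j)) (fun j => q (lift ord0 j)) => //.
pose P := \prod_j a (lift ord0 j) * \prod_j q (lift ord0 j).
have P0 : 0 <= P by rewrite mulr_ge0// prodr_ge0.
exists (q ord0 * P + a ord0 * q ord0 * C); split.
  apply: addr_ge0; first by apply: mulr_ge0.
  by apply: mulr_ge0 => //; apply: mulr_ge0.
move=> A A' Q d d0 lA' lQ bQ bA bA' bAA'; rewrite !interleaveS.
set I1 := interleave _ _; set I2 := interleave _ _.
have -> : ((A ord0 \o Q ord0) \o I1) - ((A' ord0 \o Q ord0) \o I2) =
    (((A ord0 - A' ord0) \o Q ord0) \o I1) + ((A' ord0 \o Q ord0) \o (I1 - I2)).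
  by apply/funext => x; rewrite !fctE /= (linB (lQ _)) (linB (lA' _)) addrA subrK.
rewrite mulrDl; apply: opbndD.
  rewrite mulrC mulrA; apply: opbnd_comp; first by rewrite mulr_ge0.
    by apply: interleave_bnd.
  exact: opbnd_comp.
rewrite -[_ * C * d]mulrA; apply: opbnd_comp; first by rewrite mulr_ge0.
  by apply: hC.
exact: opbnd_comp.
Qed.

End Interleave.

Section Eventually.
Context {R : realType}.

Lemma fin_eventually (I : finType) (P : I -> nat -> Prop) :
  (forall i, exists N, forall k, (N <= k)%N -> P i k) ->
  exists N, forall i k, (N <= k)%N -> P i k.
Proof.
move=> /choice[N hN]; exists (\max_i N i)%N => i k h; apply: hN.
exact: leq_trans (leq_bigmax i) h.
Qed.

Lemma nneseries_tail (u : nat -> R) : (forall m, 0 <= u m) ->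
  (\sum_(0 <= m <oo) (u m)%:E < +oo)%E ->
  forall e, 0 < e -> exists N1, forall N, (N1 <= N)%N -> \sum_(N1 <= m < N) u m <= e.
Proof.
move=> u0 fin e e0.
have u0' m : (0 <= (u m)%:E)%E by rewrite lee_fin.
set S := (\sum_(0 <= m <oo) (u m)%:E)%E in fin.
have S0 : (0 <= S)%E by apply: nneseries_ge0.
have fS : S \is a fin_num by rewrite ge0_fin_numE.
have cv : \sum_(0 <= m < N) (u m)%:E @[N --> \oo] --> S.
  exact: (@is_cvg_nneseries _ _ xpredT 0).
have {}cv : (\sum_(0 <= m < N) u m) @[N --> \oo] --> fine S.
  rewrite -(fineK fS) in cv; move: cv => /fine_cvg.
  by rewrite (_ : fine \o _ = (fun N => \sum_(0 <= m < N) u m))//; apply/funext => N; rewrite /= sumEFin.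
move/cvgrPdist_le: cv => cv; have [N1 _ hN1] := cv _ e0.
exists N1 => N N1N.
have leS M : \sum_(0 <= m < M) u m <= fine S.
  rewrite -lee_fin fineK// -sumEFin; apply: nneseries_lim_ge => //.
have := hN1 N1 (leqnn _); rewrite /= ger0_norm ?subr_ge0//; apply: le_trans.
by rewrite lerBrDl -big_cat_nat.
Unshelve. all: by end_near. Qed.

Lemma nneseries_lt_pinfty (u : nat -> R) C : (forall m, 0 <= u m) ->
  (forall N, \sum_(0 <= m < N) u m <= C) -> (\sum_(0 <= m <oo) (u m)%:E < +oo)%E.
Proof.
move=> u0 h; apply: (@le_lt_trans _ _ C%:E); last by rewrite ltry.
apply: lime_le; first by apply: is_cvg_nneseries => m _ _; rewrite lee_fin.
by near=> N; rewrite sumEFin lee_fin.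
Unshelve. all: by end_near. Qed.

End Eventually.

(** * Independence of the multiple operator integral from the representation *)

Section MultipleIntegralUniqueness.
Context {R : realType} {H : hilbertType R}.
Local Notation cn z := (rnorm (z : R[i]^o)).

(** With all factors constant on the cells of one partition, expanding gives finitely many products
    of cell operators, and the coefficient of the product indexed by [g] is the scalar sum at the
    points [c (g j)]. The signs [s] allow a difference of two series; in the induction they absorb
    the value of the factor that is peeled off. *)
Lemma sum_step_cvg0 (I T : finType) (D : I -> set R[i]) (c : I -> R[i]) n
    (E : 'I_n.+1 -> set R[i] -> H -> H) (Q : 'I_n -> H -> H)
    (h : nat -> T -> 'I_n.+1 -> R[i] -> R[i]) (s : nat -> T -> R[i]) :
  (forall j, semispectral (E j)) -> borel_partition D ->
  (forall i, linear (Q i)) -> (forall i, exists q, 0 <= q /\ opbnd (Q i) q) ->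
  (forall g : 'I_n.+1 -> I, forall e : R, 0 < e -> exists N0, forall N, (N0 <= N)%N ->
     cn (\sum_(m < N) \sum_t s m t * \prod_j h m t j (c (g j))) <= e) ->
  forall e : R, 0 < e -> exists N0, forall N, (N0 <= N)%N ->
    opbnd (\sum_(m < N) \sum_t s m t *:
      interleave (fun j => step_op (E j) D (fun i => h m t j (c i))) Q) e.
Proof.
move=> + pD; elim: n E Q h s => [|n ih] E Q h s hE lQ bQ hs e e0.
  have bE i : exists B, 0 <= B /\ opbnd (E ord0 (D i)) B.
    have [pE _ _ _] := hE ord0; have [bE _] := pE _ (partition_borel pD i).
    by have [_ [B hB]] := (bounded_opP _).1 bE; exists B.
  have /choice[B hB] := bE.
  pose S := \sum_i B i; have S0 : 0 <= S by apply: sumr_ge0 => i _; case: (hB i).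
  have S1 : 0 < S + 1 by rewrite ltr_wpDl.
  have e1 : 0 < e / (S + 1) by rewrite divr_gt0.
  have [N0 hN0] := fin_eventually (fun i => hs (fun=> i) _ e1).
  exists N0 => N /hN0 {}hN0.
  rewrite (_ : (\sum_(m < N) _)%R = \sum_i (\sum_(m < N) \sum_t s m t * h m t ord0
    (c i)) *: E ord0 (D i)); last first.
    apply/funext => x; rewrite !sumfE.
    under [RHS]eq_bigr do rewrite fctE scaler_suml.
    rewrite exchange_big/=; apply: eq_bigr => m _; rewrite sumfE.
    under [RHS]eq_bigr do rewrite scaler_suml.
    rewrite exchange_big/=; apply: eq_bigr => t _.
    rewrite interleave0 fctE step_opE scaler_sumr; apply: eq_bigr => i _.
    by rewrite scalerA.
  apply: (@opbnd_le _ _ _ _ (\sum_i e / (S + 1) * B i)).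
    rewrite -mulr_sumr -/S mulrAC ler_pdivrMr// ler_wpM2l ?lerDl//; exact: ltW.
  apply: opbnd_sum => i _; apply: (@opbnd_le _ _ _ _ (cn (\sum_(m < N) \sum_t s m t * h m t ord0
    (c i)) * B i)).
    apply: ler_wpM2r; first by case: (hB i).
    have := hN0 i; under eq_bigr do under eq_bigr do rewrite big_ord_recl big_ord0 mulr1.
    by [].
  by apply: opbndZ; case: (hB i).
have bE i : exists B, 0 <= B /\ opbnd (E ord0 (D i) \o Q ord0) B.
  have [pE _ _ _] := hE ord0; have [bE _] := pE _ (partition_borel pD i).
  have [_ [B [B0 hB]]] := (bounded_opP _).1 bE; have [q [q0 hq]] := bQ ord0.
  by exists (B * q); split; [rewrite mulr_ge0|apply: opbnd_comp].
have /choice[B hB] := bE.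
pose S := \sum_i B i; have S0 : 0 <= S by apply: sumr_ge0 => i _; case: (hB i).
have S1 : 0 < S + 1 by rewrite ltr_wpDl.
have e1 : 0 < e / (S + 1) by rewrite divr_gt0.
pose rest i N := \sum_(m < N) \sum_t (s m t * h m t ord0 (c i)) *:
      interleave (fun j : 'I_n.+1 => step_op (E (lift ord0 j)) D (fun i => h m t (lift ord0 j) (c i)))
        (fun j => Q (lift ord0 j)).
have hrest i : exists N0, forall N, (N0 <= N)%N -> opbnd (rest i N) (e / (S + 1)).
  apply: (ih (fun j => E (lift ord0 j)) (fun j => Q (lift ord0 j))
    (fun m t j => h m t (lift ord0 j)) (fun m t => s m t * h m t ord0 (c i))) => //.
  (* A choice of cells for the remaining factors is completed by the cell [i] of the first one. *)
  move=> g d d0; have [N0 hN0] := hs (fun j => if unlift ord0 j is Some j' then g j' else i) d d0.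
  exists N0 => N /hN0; under eq_bigr do under eq_bigr do rewrite big_ord_recl mulrA unlift_none.
  by under eq_bigr do under eq_bigr do under eq_bigr do rewrite liftK.
have [N0 hN0] := fin_eventually hrest.
exists N0 => N /hN0 {}hN0.
have lD i : linear (E ord0 (D i)).
  by apply: semispectral_linear => //; apply: partition_borel.
have lE i : linear (E ord0 (D i) \o Q ord0) by apply: linear_comp.
rewrite (_ : (\sum_(m < N) _)%R = \sum_i ((E ord0 (D i) \o Q ord0) \o rest i N)); last first.
  apply/funext => x; rewrite !sumfE.
  transitivity (\sum_i (E ord0 (D i) \o Q ord0) (rest i N x)); last by [].
  under [RHS]eq_bigr do rewrite /rest sumfE (lin_sum (lE _)).
  rewrite exchange_big/=; apply: eq_bigr => m _; rewrite sumfE.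
  under [RHS]eq_bigr do rewrite sumfE (lin_sum (lQ _)) (lin_sum (lD _)).
  rewrite exchange_big/=; apply: eq_bigr => t _.
  rewrite interleaveS !fctE /= step_opE scaler_sumr; apply: eq_bigr => i _.
  by rewrite (linZ (lQ _)) (linZ (lD _)) scalerA.
apply: (@opbnd_le _ _ _ _ (\sum_i B i * (e / (S + 1)))).
  rewrite -mulr_suml -/S mulrA ler_pdivrMr// mulrC ler_wpM2l ?lerDl//; exact: ltW.
by apply: opbnd_sum => i _; case: (hB i) => ? ?; apply: opbnd_comp.
Qed.

Lemma multiple_op_int_uniq n (Phi : 'rV[R[i]^o]_n.+1 -> R[i])
    (E : 'I_n.+1 -> set R[i] -> H -> H) (Q : 'I_n -> H -> H) (f : bool -> nat -> 'I_n.+1 -> R[i] -> R[i])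
    (A : bool -> H -> H) :
  (forall j, dilatable (E j)) -> (forall i, linear (Q i)) ->
  (forall i, exists q, 0 <= q /\ opbnd (Q i) q) ->
  (forall b, tensor_rep Phi (f b)) -> (forall b, linear (A b)) ->
  (forall b, op_cvg (fun N => \sum_(m < N)
     interleave (fun j => semispectral_int (E j) (f b m j)) Q) (A b)) ->
  A true = A false.
Proof.
move=> dE lQ /choice[q hq] hf lA hA.
have q0 i : 0 <= q i by case: (hq i).
have bQ i : opbnd (Q i) (q i) by case: (hq i).
have da b m j : disk_algebra (f b m j) by case: (hf b).
have cf b m j := disk_algebra_circle (da b m j).
pose a b m j := fine (supnorm (f b m j)).
have a0 b m j : 0 <= a b m j by rewrite fine_ge0// supnorm_ge0.
pose J b m := interleave (fun j => semispectral_int (E j) (f b m j)) Q.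
have lI b m j : linear (semispectral_int (E j) (f b m j)) by apply: ssint_linear.
have bI b m j : opbnd (semispectral_int (E j) (f b m j)) (a b m j).
  by apply: ssint_bnd => // z; apply: cn_supnorm.
have lJ b m : linear (J b m) by apply: interleave_linear.
pose qq := \prod_i q i; have qq0 : 0 <= qq by apply: prodr_ge0.
pose al b m := \prod_j a b m j; have al0 b m : 0 <= al b m by apply: prodr_ge0.
have lS b N : linear (\sum_(m < N) J b m) by apply: linear_sum.
apply: (@opbnd_eq _ _ _ _ _ (5 + 4 * qq)); first by rewrite addr_ge0// mulr_ge0.
move=> e e0.
(* Only the terms with [m < N1] can be approximated by step functions at once; the later ones, exact
   or stepped, are bounded by the tail of the costs. *)
have [N1 hN1] : exists N1, forall b N, (N1 <= N)%N -> \sum_(N1 <= m < N) al b m <= e.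
  have tl b : exists N1, forall N, (N1 <= N)%N -> \sum_(N1 <= m < N) al b m <= e.
    by apply: nneseries_tail => //; case: (hf b).
  have [Nt ht] := tl true; have [Nf hf'] := tl false.
  exists (maxn Nt Nf) => b N Nle.
  have sub M : (M <= maxn Nt Nf)%N -> \sum_(maxn Nt Nf <= m < N) al b m <= \sum_(M <= m < N) al b m.
    by move=> MN; rewrite [leRHS](big_cat_nat MN)//= lerDr sumr_ge0.
  case: b in sub *.
    by rewrite (le_trans (sub _ (leq_maxl _ _)))// ht// (leq_trans (leq_maxl _ _) Nle).
  by rewrite (le_trans (sub _ (leq_maxr _ _)))// hf'// (leq_trans (leq_maxr _ _) Nle).
have Lip b m := interleave_lipschitz (H := H) (a0 b m) q0.
have /choice[C hC] : forall p : bool * 'I_N1, exists C, _ := fun p => Lip p.1 p.2.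
pose S := \sum_p C p; have S0 : 0 <= S by apply: sumr_ge0 => p _; case: (hC p).
have S1 : 0 < S + 1 by rewrite ltr_wpDl.
(* With [S] the sum of all Lipschitz constants, the approximation errors of the first [N1] terms add
   up to at most [e]. *)
pose d := e / (S + 1); have d0 : 0 < d by rewrite divr_gt0.
have dS : S * d <= e by rewrite /d mulrA ler_pdivrMr// mulrC ler_wpM2l ?lerDl// ltW.
have [M [D [c [pD cc hc]]]] := @oscillation_partition _ (bool * 'I_N1 * 'I_n.+1)%type
  (fun p => f p.1.1 p.1.2 p.2) d (fun p => cf _ _ _) d0.
pose st b m j := step_op (E j) D (fun i => f b m j (c i)).
pose J' b m := interleave (st b m) Q.
have bst b m j : opbnd (st b m j) (a b m j).
  by apply: step_op_dilatable_bnd => // i z _; apply: cn_supnorm.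
have lst b m j : linear (st b m j).
  by apply: step_op_linear pD; case: (dE j).
have bJ b m : opbnd (J b m) (al b m * qq) by apply: interleave_bnd.
have bJ' b m : opbnd (J' b m) (al b m * qq) by apply: interleave_bnd.
have near b N : (N1 <= N)%N ->
    opbnd (\sum_(m < N) J b m - \sum_(m < N) J' b m) (e + 2 * qq * e).
  move=> N1N; rewrite -sumrB -(big_mkord xpredT (fun m => J b m - J' b m)) (big_cat_nat _ N1N)//=.
  apply: opbndD.
    apply: (opbnd_le dS); rewrite big_mkord.
    apply: (@opbnd_le _ _ _ _ (\sum_(m < N1) C (b, m) * d)).
      rewrite -mulr_suml ler_wpM2r ?(ltW d0)// /S.
      rewrite (eq_bigr (fun p => C (p.1, p.2))); last by case.
      rewrite -(pair_bigA _ (fun b m => C (b, m)))/= (bigD1 b)//= lerDl.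
      apply: sumr_ge0 => b' _; apply: sumr_ge0 => m' _.
      by case: (hC (b', m')).
    apply: opbnd_sum => m _; have [_ {}hC] := hC (b, m).
    apply: hC => //; first exact: ltW.
    move=> j; apply: ssint_dist => //; first exact: ltW.
    by move=> i z; apply: (hc i (b, m, j)).
  apply: (@opbnd_le _ _ _ _ (\sum_(N1 <= m < N) (2 * qq * al b m))).
    rewrite -mulr_sumr ler_wpM2l ?mulr_ge0//; exact: hN1.
  apply: opbnd_sum => m _.
  have -> : 2 * qq * al b m = al b m * qq + al b m * qq by lra.
  exact: opbndB.
(* At each grid point both scalar series converge to the same value of [Phi], so their difference
   tends to zero. *)
have [N2 hN2] : exists N2, forall N, (N2 <= N)%N ->
    opbnd (\sum_(m < N) J' true m - \sum_(m < N) J' false m) e.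
  have hs g (e1 : R) : 0 < e1 -> exists N0, forall N, (N0 <= N)%N ->
     cn (\sum_(m < N) \sum_(t : bool) (if t then 1 else -1) * \prod_j f t m j (c (g j))) <= e1.
    move=> e10; pose l : 'rV[R[i]^o]_n.+1 := \row_j c (g j).
    have tl : torus l by move=> j; rewrite mxE; apply: cc.
    have e2 : 0 < e1 / 2 by rewrite divr_gt0.
    have lim b : exists N0, forall N, (N0 <= N)%N ->
        cn (Phi l - \sum_(m < N) \prod_j f b m j (c (g j))) < e1 / 2.
      have [_ _ /(_ l tl) /cvg_rnorm_seq /(_ _ e2) [N0 hN0]] := hf b.
      exists N0 => N /hN0; under eq_bigr do under eq_bigr do rewrite mxE.
      by [].
    have [N0 hN0] := fin_eventually lim.
    exists N0 => N NN; under eq_bigr do rewrite big_bool/= mul1r mulN1r.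
    rewrite sumrB (le_trans (rnorm_triB (Phi l : R[i]^o) _ _))//.
    by rewrite [leRHS](splitr e1) lerD// ltW// ?hN0// rnormB hN0.
  have sE j : semispectral (E j) by case: (dE j).
  have [N2 hN2] := sum_step_cvg0 (T := bool) (c := c) (h := fun m t => f t m)
    (s := fun m (t : bool) => if t then 1 else -1) sE pD lQ (fun i => ex_intro _ (q i) (hq i)) hs e0.
  exists N2 => N /hN2; congr (opbnd _ _).
  by rewrite -sumrB; apply: eq_bigr => m _; rewrite big_bool/= scale1r scaleN1r.
have cA b : exists N3, forall N, (N3 <= N)%N -> opbnd (\sum_(m < N) J b m - A b) e.
  by apply: ((op_cvgP (A := fun N => \sum_(m < N) J b m) _ _).1 (hA b)).
have [N3 hN3] := fin_eventually cA.
pose N := maxn N1 (maxn N2 N3).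
have -> : (5 + 4 * qq) * e = (e + ((e + 2 * qq * e) + (e + ((e + 2 * qq * e) + e)))) by lra.
have N3N : (N3 <= N)%N by rewrite !leq_max leqnn !orbT.
apply: opbnd_tri (opbnd_distC (hN3 true N N3N)) _.
apply: (opbnd_tri (near true N (leq_maxl _ _))).
apply: (@opbnd_tri _ _ _ (\sum_(m < N) J' false m)).
  by apply: hN2; rewrite !leq_max leqnn orbT.
apply: opbnd_tri (opbnd_distC (near false N (leq_maxl _ _))) _.
exact: hN3.
Qed.

End MultipleIntegralUniqueness.

(** * Bounds for polynomials on the circle *)

Section RootsOfUnity.
Context {R : realType}.
Local Notation cn z := (rnorm (z : R[i]^o)).

Lemma expiD (x y : R) : expi (x + y) = expi x * expi y.
Proof. by rewrite /expi cosD sinD; simpc; rewrite [sin x * cos y + _]addrC. Qed.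

Lemma expi0 : expi (0 : R) = 1.
Proof. by rewrite /expi cos0 sin0. Qed.

Lemma expi_mulrn (x : R) k : expi (x *+ k) = expi x ^+ k.
Proof. by elim: k => [|k ih]; rewrite ?mulr0n ?expi0// mulrS expiD ih exprS. Qed.

Lemma cn_expi (x : R) : cn (expi x) = 1.
Proof. by rewrite /rnorm normc_def/= cos2Dsin2 sqrtr1. Qed.

Lemma expi_neq1 (x : R) : 0 < x < 2 * pi -> expi x != 1.
Proof.
move=> /andP[x0 x2]; apply/negP => /eqP /(congr1 (@complex.Re R)) /= c1.
have : 0 < sin (x / 2).
  by apply: sin_gt0_pi; rewrite divr_gt0//= ltr_pdivrMr// mulrC.
have h : cos x = cos (x / 2) ^+ 2 - sin (x / 2) ^+ 2.
  by rewrite {1}(splitr x) cosD -!expr2.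
move=> s0; have : 0 < sin (x / 2) ^+ 2 by rewrite exprn_gt0.
by have := cos2Dsin2 (x / 2); rewrite c1 in h; lra.
Qed.

Definition unity_root M : R[i] := expi (2 * pi / M%:R).

Lemma unity_root_cn M : cn (unity_root M) = 1. Proof. exact: cn_expi. Qed.

Lemma unity_root_neq0 M : unity_root M != 0.
Proof.
apply/eqP => h; have := unity_root_cn M; rewrite h rnorm0 => /eqP.
by rewrite eq_sym oner_eq0.
Qed.

Lemma unity_rootX1 M : (0 < M)%N -> unity_root M ^+ M = 1.
Proof.
move=> M0; rewrite /unity_root -expi_mulrn -[_ *+ M]mulr_natr divfK ?pnatr_eq0 -?lt0n//.
by rewrite mulr_natl /expi cos2pi sin2pi.
Qed.

Lemma unity_rootX_neq1 M k : (0 < k < M)%N -> unity_root M ^+ k != 1.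
Proof.
move=> /andP[k0 kM]; have M0 := ltn_trans k0 kM.
rewrite /unity_root -expi_mulrn; apply: expi_neq1.
rewrite -[_ *+ k]mulr_natr mulr_gt0 ?ltr0n ?divr_gt0 ?ltr0n ?mulr_gt0 ?pi_gt0//=.
by rewrite mulrAC ltr_pdivrMr ?ltr0n// ltr_pM2l ?mulr_gt0 ?pi_gt0// ltr_nat.
Qed.

(** The mean over the [M]-th roots of unity replaces the integral over the circle: exponents that
    differ by less than [M] are still orthogonal, so it is exact once [M] is large. *)
Definition root_avg M (f : R[i] -> R[i]) : R[i] :=
  M%:R^-1 * \sum_(j < M) f (unity_root M ^+ j).

Lemma geometric_root (x : R[i]) M : x != 1 -> x ^+ M = 1 -> \sum_(j < M) x ^+ j = 0.
Proof.
move=> x1 xM; have := subrX1 x M; rewrite xM subrr => /esym/eqP.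
by rewrite mulf_eq0 subr_eq0 (negPf x1)/= => /eqP.
Qed.

Lemma root_avg_orth M a b : (0 < M)%N -> (a < b + M)%N -> (b < a + M)%N ->
  root_avg M (fun w => w ^+ a / w ^+ b) = (a == b)%:R.
Proof.
move=> M0 aM bM; rewrite /root_avg.
have w0 := unity_root_neq0 M.
have [<-|ab] := eqVneq a b.
  under eq_bigr do rewrite divff ?expf_neq0 ?expf_neq0//.
  by rewrite sumr_const card_ord mulVf// pnatr_eq0 -lt0n.
rewrite mulr0n; case: (ltngtP a b) => [lt|gt|e]; last by rewrite e eqxx in ab.
  rewrite (eq_bigr (fun j : 'I_M => ((unity_root M ^+ (b - a))^-1) ^+ j)).
    rewrite geometric_root ?mulr0//.
      by rewrite invr_eq1 unity_rootX_neq1// subn_gt0 lt ltn_subLR// ltnW.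
    by rewrite exprVn exprAC unity_rootX1// expr1n invr1.
  move=> j _; rewrite exprVn -!exprM mulrC -{1}(subnKC (ltnW lt)) mulnDr exprD.
  by rewrite invfM mulrAC mulVf ?mul1r ?expf_neq0// mulnC.
rewrite (eq_bigr (fun j : 'I_M => (unity_root M ^+ (a - b)) ^+ j)).
  rewrite geometric_root ?mulr0//.
    by rewrite unity_rootX_neq1// subn_gt0 gt ltn_subLR// ltnW.
  by rewrite exprAC unity_rootX1// expr1n.
move=> j _; rewrite -!exprM -{1}(subnKC (ltnW gt)) mulnDr exprD.
by rewrite mulrAC divff ?mul1r ?expf_neq0// mulnC.
Qed.

Lemma root_avgZ M a f : root_avg M (fun w => a * f w) = a * root_avg M f.
Proof. by rewrite /root_avg -mulr_sumr mulrCA. Qed.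

Lemma root_avg_cst M a : (0 < M)%N -> root_avg M (fun=> a) = a.
Proof.
move=> M0; rewrite /root_avg sumr_const card_ord -(mulr_natl a M) mulrA mulVf ?mul1r//.
by rewrite pnatr_eq0 -lt0n.
Qed.

Lemma root_avg_sum M (I : Type) (r : seq I) (P : pred I) (F : I -> R[i] -> R[i]) :
  root_avg M (fun w => \sum_(i <- r | P i) F i w) = \sum_(i <- r | P i) root_avg M (F i).
Proof. by rewrite /root_avg exchange_big/= mulr_sumr. Qed.

Lemma eq_root_avg M f g : (forall w, cn w = 1 -> f w = g w) -> root_avg M f = root_avg M g.
Proof.
move=> h; rewrite /root_avg; congr (_ * _); apply: eq_bigr => j _; apply: h.
by rewrite cnX unity_root_cn expr1n.
Qed.

Lemma root_avg_le M f (g : R[i] -> R) : (0 < M)%N ->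
  (forall w, cn w = 1 -> cn (f w) <= g w) ->
  cn (root_avg M f) <= complex.Re (root_avg M (fun w => (g w)%:C)).
Proof.
move=> M0 h; have -> : root_avg M (fun w => (g w)%:C) =
    (M%:R^-1 * \sum_(j < M) g (unity_root M ^+ j))%:C.
  by rewrite /root_avg rmorphM rmorph_sum/= fmorphV rmorph_nat.
rewrite /root_avg cnM cnV cn_nat/= ler_wpM2l ?invr_ge0//.
rewrite (le_trans (rnorm_sum _ _ _))//; apply: ler_sum => j _; apply: h.
by rewrite cnX unity_root_cn expr1n.
Qed.

(** The size conditions exclude aliasing: no exponent of [p] other than [b] is congruent to [b]
    modulo [M]. *)
Lemma root_avg_coef M (p : {poly R[i]}) b : (0 < M)%N -> (size p <= b + M)%N ->
  (b < M)%N -> root_avg M (fun w => p.[w] / w ^+ b) = p`_b.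
Proof.
move=> M0 sM bM; transitivity (\sum_(i < size p) p`_i * (nat_of_ord i == b)%:R).
  rewrite (@eq_root_avg _ _ (fun w => \sum_(i < size p) p`_i * (w ^+ i / w ^+ b))).
    rewrite root_avg_sum; apply: eq_bigr => i _; rewrite root_avgZ root_avg_orth//.
      exact: leq_trans (ltn_ord i) _.
    exact: leq_trans bM (leq_addl _ _).
  by move=> w _; rewrite horner_coef mulr_suml; apply: eq_bigr => i _; rewrite mulrA.
have [lt|ge] := ltnP b (size p); last first.
  rewrite nth_default// big1// => i _; case: eqP => [ib|_]; last by rewrite mulr0.
  by have := ltn_ord i; rewrite ib ltnNge ge.
rewrite (bigD1 (Ordinal lt))//= eqxx mulr1 big1 ?addr0// => i ib.
by rewrite (_ : (nat_of_ord i == b) = false) ?mulr0//; apply: negPf.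
Qed.

Lemma expr_bound (a b c : R) : 0 <= a -> 0 <= b -> 0 < c ->
  (forall k, a ^+ k * c <= b ^+ k) -> a <= b.
Proof.
move=> a0 b0 c0 h; rewrite leNgt; apply/negP => ba.
have ap : 0 < a by apply: le_lt_trans ba.
have ba1 : `|b / a| < 1 by rewrite ger0_norm ?divr_ge0// ltr_pdivrMr// mul1r.
have /cvgrPdist_lt /(_ c c0) [k _ /(_ k (leqnn _))] := cvg_expr ba1.
rewrite /= sub0r normrN ger0_norm ?exprn_ge0 ?divr_ge0// expr_div_n ltr_pdivrMr ?exprn_gt0//.
by rewrite mulrC ltNge h.
Qed.

(* [p(z)^k = avg p(w)^k sum_j (z/w)^j] over roots of unity [w], so
   [|p(z)|^k <= B^k / (1 - |z|)]; take [k]th roots. *)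
Lemma max_modulus (p : {poly R[i]}) B : (forall z, cn z = 1 -> cn p.[z] <= B) ->
  forall z, cn z <= 1 -> cn p.[z] <= B.
Proof.
move=> hB z; rewrite le_eqVlt => /orP[/eqP|z1]; first exact: hB.
have B0 : 0 <= B by apply: le_trans (hB 1 (cn1)); rewrite rnorm_ge0.
have c0 : 0 < 1 - cn z by rewrite subr_gt0.
apply: (@expr_bound _ _ (1 - cn z)) => // [|k]; first exact: rnorm_ge0.
pose q := p ^+ k; pose M := (size q).+1.
have -> : cn p.[z] ^+ k = cn q.[z] by rewrite -cnX horner_exp.
have -> : q.[z] = root_avg M (fun w => q.[w] * \sum_(j < M) (z / w) ^+ j).
  rewrite (@eq_root_avg _ _ (fun w => \sum_(j < M) z ^+ j * (q.[w] / w ^+ j))).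
    rewrite root_avg_sum (horner_coef_wide _ (leqnSn (size q))).
    apply: eq_bigr => j _; rewrite root_avgZ root_avg_coef; [by rewrite mulrC|by []| |exact: ltn_ord].
    exact: leq_trans (leqnSn _) (leq_addl _ _).
  move=> w _; rewrite mulr_sumr; apply: eq_bigr => j _.
  by rewrite expr_div_n mulrCA.
rewrite -ler_pdivlMr//.
have := @root_avg_le M (fun w => q.[w] * \sum_(j < M) (z / w) ^+ j) (fun=> B ^+ k / (1 - cn z)) isT.
rewrite root_avg_cst//=.
apply => w w1; rewrite cnM /q horner_exp cnX; apply: ler_pM.
- by rewrite exprn_ge0 ?rnorm_ge0.
- exact: rnorm_ge0.
- by rewrite lerXn2r ?nnegrE ?rnorm_ge0// hB.
rewrite (le_trans (rnorm_sum _ _ _))// -[leRHS]mul1r ler_pdivlMr//.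
under eq_bigr do rewrite cnX cnM cnV w1 invr1 mulr1.
have := subrX1 (cn z) M => h.
have -> : (\sum_(i < M) cn z ^+ i) * (1 - cn z) = 1 - cn z ^+ M.
  by rewrite -opprB mulrN mulrC -h opprB.
by rewrite gerBl exprn_ge0 ?rnorm_ge0.
Qed.

Lemma poly_supnorm (p : {poly R[i]}) B : (forall z, cn z = 1 -> cn p.[z] <= B) ->
  fine (supnorm (fun z => p.[z])) <= B.
Proof.
move=> /max_modulus h; rewrite -lee_fin fineK; first exact: supnorm_le.
by apply/supnorm_fin/disk_algebra_poly.
Qed.

Lemma sum_leq_ord N c : (\sum_(i < N) (c <= i) = N - c)%N.
Proof.
elim: N => [|N ih]; first by rewrite big_ord0.
rewrite big_ord_recr/= ih; case: leqP => h; first by rewrite addn1 subSn.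
by rewrite addn0 (eqP (ltnW h : (N - c == 0)%N)) (eqP (h : (N.+1 - c == 0)%N)).
Qed.

(* The ramp [b - e] is truncated subtraction. *)
Definition ramp_poly (p : {poly R[i]}) D e s : {poly R[i]} :=
  \poly_(b < D.+1) ((b - e)%:R * p`_(b + s)).

(** An exponent [b <= D] equals [D - i' + i] for exactly [b - e] pairs, the rising edge of a Fejer
    triangle centred at [D]. On the falling edge [b > D] the coefficient of [p] vanishes, so the
    ramp is a whole Fejer window. *)
Lemma ramp_poly_fejer (p : {poly R[i]}) D e s z : (e <= D)%N -> (size p <= D.+1)%N ->
  (ramp_poly p D e s).[z] =
    \sum_(i' < D - e) \sum_(i < D - e) p`_(D - i' + i + s) * z ^+ (D - i' + i).
Proof.
move=> eD sp; set N := (D - e)%N; pose F b := p`_(b + s) * z ^+ b.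
have F0 b : (D < b)%N -> F b = 0.
  move=> Db; rewrite /F nth_default ?mul0r// (leq_trans sp)//.
  exact: leq_trans Db (leq_addr _ _).
rewrite horner_poly.
transitivity (\sum_(b < D.+1) \sum_(i' < N) (D - b <= i')%:R * F b).
  apply: eq_bigr => b _; rewrite -mulr_suml -natr_sum sum_leq_ord -mulrA /F.
  by congr (_%:R * _); rewrite /N; have := ltn_ord b; lia.
rewrite exchange_big/=; apply: eq_bigr => i' _.
transitivity (\sum_(D - i' <= b < D.+1) F b).
  rewrite -(big_mkord xpredT (fun b => (D - b <= i')%:R * F b)).
  rewrite (@big_cat_nat _ _ _ (D - i')%N)//=; last by lia.
  rewrite big_nat big1 ?add0r => [|b /andP[_ h]].
    apply: eq_big_nat => b /andP[h1 h2].
    by rewrite (_ : (D - b <= i')%N) ?mul1r//; lia.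
  by rewrite (_ : (D - b <= i')%N = false) ?mul0r//; lia.
rewrite -(big_mkord xpredT (fun i => F (D - i' + i)%N)).
have hi := ltn_ord i'.
have -> : \sum_(0 <= i < N) F (D - i' + i)%N = \sum_(D - i' <= b < N + (D - i')) F b.
  have := big_addn 0 (N + (D - i')) (D - i') xpredT F; rewrite add0n addnK => ->.
  by apply: eq_bigr => i _; rewrite addnC.
rewrite [RHS](@big_cat_nat _ _ _ D.+1)//=; [|by lia|by rewrite /N in hi *; lia].
by rewrite [X in _ + X]big_nat [X in _ + X]big1 ?addr0// => b /andP[h _]; apply: F0.
Qed.

(* [ramp_poly] averages [p] against [|\sum_(i < D - e) u ^ i| ^ 2], whose mean is [D - e]. *)
Lemma ramp_poly_bnd (p : {poly R[i]}) D e s B : (e <= D)%N -> (size p <= D.+1)%N ->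
  (forall z, cn z = 1 -> cn p.[z] <= B) ->
  forall z, cn z = 1 -> cn (ramp_poly p D e s).[z] <= (D - e)%:R * B.
Proof.
(* [M] exceeds every exponent and difference of exponents below, which makes the averages exact. *)
move=> eD sp hB z z1; set N := (D - e)%N; pose M := (D.+1 + s + D + N + N).+1.
have cw w : cn w = 1 -> w != 0.
  by move=> w1; apply/eqP => w0; move: w1; rewrite w0 rnorm0 => /eqP; rewrite eq_sym oner_eq0.
have z0 := cw z z1.
pose sg (u : R[i]) := \sum_(i < N) u ^+ i.
have conj_sg u : cn u = 1 -> conjc (sg u) = \sum_(i < N) (u ^+ i)^-1.
  by move=> u1; rewrite /sg rmorph_sum/=; apply: eq_bigr => i _; rewrite rmorphXn/= conj_circle// exprVn.
have u1 w : cn w = 1 -> cn (z / w) = 1 by move=> w1; rewrite cnM cnV z1 w1 invr1 mulr1.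
have sq w : cn w = 1 -> sg (z / w) * conjc (sg (z / w)) =
    \sum_(i' < N) \sum_(i < N) (z / w) ^+ i / (z / w) ^+ i'.
  by move=> w1; rewrite conj_sg ?u1// mulr_sumr; apply: eq_bigr => i' _; rewrite mulr_suml.
have -> : (ramp_poly p D e s).[z] = root_avg M (fun w =>
    p.[w] / w ^+ s * (z / w) ^+ D * (sg (z / w) * conjc (sg (z / w)))).
  rewrite ramp_poly_fejer// (@eq_root_avg _ _ (fun w => \sum_(i' < N) \sum_(i < N)
      z ^+ (D - i' + i) * (p.[w] / w ^+ (D - i' + i + s)))).
    rewrite root_avg_sum; apply: eq_bigr => i' _; rewrite root_avg_sum.
    apply: eq_bigr => i _; rewrite root_avgZ root_avg_coef; [by rewrite mulrC|by []| |].
      by rewrite (leq_trans sp)// /M /N; lia.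
    by have := ltn_ord i; have := ltn_ord i'; rewrite /M /N; lia.
  move=> w w1; have w0 := cw w w1.
  rewrite sq// mulr_sumr; apply: eq_bigr => i' _; rewrite mulr_sumr; apply: eq_bigr => i _.
  have i'D : (i' <= D)%N by have := ltn_ord i'; rewrite /N; lia.
  have uE : (z / w) ^+ D = (z / w) ^+ (D - i') * (z / w) ^+ i' by rewrite -exprD subnK.
  have u0 : z / w != 0 by rewrite mulf_neq0 ?invr_eq0.
  rewrite uE -!mulrA [_ ^+ i' * _]mulrC -!mulrA mulVf ?expf_neq0// mulr1.
  rewrite -exprD expr_div_n [w ^+ (_ + s)]exprD invfM; set Y := _^-1; set X := _^-1.
  by rewrite [Y * _]mulrCA [RHS]mulrCA [X * Y]mulrC.
apply: (le_trans (@root_avg_le M _ (fun w => B * cn (sg (z / w)) ^+ 2) isT _)).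
  move=> w w1; rewrite !cnM cnX u1// expr1n mulr1 cnV cnX w1 expr1n invr1 mulr1.
  by rewrite cn_conj -expr2 ler_wpM2r ?sqr_ge0// hB.
rewrite (@eq_root_avg _ _ (fun w => B%:C * \sum_(i' < N) \sum_(i < N) (z ^+ i / z ^+ i') *
  (w ^+ i' / w ^+ i))).
  rewrite root_avgZ root_avg_sum.
  under eq_bigr do rewrite root_avg_sum.
  have -> : \sum_(i' < N) \sum_(i < N) root_avg M (fun w => z ^+ i / z ^+ i' *
    (w ^+ i' / w ^+ i)) = (N%:R : R)%:C.
    rewrite rmorph_nat -[N in RHS]card_ord -sumr_const; apply: eq_bigr => i' _.
    rewrite (bigD1 i')//= root_avgZ root_avg_orth ?eqxx; [|by []|by rewrite /M /N;
      lia|by rewrite /M /N; lia].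
    rewrite mulr1 divff ?expf_neq0// big1 ?addr0// => i ii'.
    rewrite root_avgZ root_avg_orth; [|by []| |].
    - rewrite (_ : (nat_of_ord i' == i) = false) ?mulr0//.
      by rewrite eq_sym; apply: negPf.
    - by have := ltn_ord i'; rewrite /M /N; lia.
    - by have := ltn_ord i; rewrite /M /N; lia.
  by rewrite -rmorphM/= mulrC.
move=> w w1; rewrite rmorphM rmorphXn/= -cnE sqr_normc sq//; congr (_ * _).
apply: eq_bigr => i' _; apply: eq_bigr => i _.
rewrite !expr_div_n invf_div -!mulrA; congr (_ * _).
by rewrite mulrCA [RHS]mulrCA; congr (_ * _); rewrite mulrC.
Qed.

End RootsOfUnity.

(** * Tensor decomposition of divided differences *)

Section TensorLists.
Context {R : realType}.
Local Notation cn z := (rnorm (z : R[i]^o)).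
Local Notation C := R[i].

(* Lists of polynomials stand for elementary tensors, the head being the factor
   in the last variable. *)
Definition multilinear (V : lmodType C) (L : seq {poly C} -> V) :=
  forall s1 s2 (a : C) p q, L (s1 ++ (a *: p + q) :: s2) =
    a *: L (s1 ++ p :: s2) + L (s1 ++ q :: s2).

Lemma multilinear_cons (V : lmodType C) (L : seq {poly C} -> V) p :
  multilinear L -> multilinear (fun s => L (p :: s)).
Proof. by move=> h s1 s2 a q r; rewrite -!cat_cons h. Qed.

Section Head.
Variables (V : lmodType C) (L : seq {poly C} -> V) (s : seq {poly C}).
Hypothesis hL : multilinear L.

Lemma multilinear0 : L (0 :: s) = 0.
Proof.
have := hL [::] s (-1) 0 0; rewrite scaler0 addr0 /= scaleN1r addNr //.
Qed.

Lemma multilinearZ a p : L (a *: p :: s) = a *: L (p :: s).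
Proof. by have := hL [::] s a p 0; rewrite addr0 /= multilinear0 addr0. Qed.

Lemma multilinearD p q : L (p + q :: s) = L (p :: s) + L (q :: s).
Proof. by have := hL [::] s 1 p q; rewrite !scale1r. Qed.

Lemma multilinear_sum (I : Type) (r : seq I) (P : pred I) (F : I -> {poly C}) :
  L ((\sum_(i <- r | P i) F i) :: s) = \sum_(i <- r | P i) L (F i :: s).
Proof. exact: (big_morph (fun p => L (p :: s)) multilinearD multilinear0). Qed.

End Head.

Fixpoint multi_index k D : seq (seq nat) :=
  if k is k'.+1 then [seq a :: s | a <- iota 0 D.+1, s <- multi_index k' D] else [:: [::]].

Lemma size_multi_index k D : size (multi_index k D) = (D.+1 ^ k)%N.
Proof. by elim: k => // k ih; rewrite (size_allpairs _ (iota 0 D.+1)) ih size_iota expnS. Qed.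

Lemma multi_index_size k D a : a \in multi_index k D -> size a = k.
Proof.
elim: k a => [|k ih] a; first by rewrite inE => /eqP->.
by move=> /allpairsP[[b s] /= [_ hs ->]]; rewrite /= ih.
Qed.

(** The polynomial in [k] variables whose coefficient at a monomial depends only on its total
    degree, each exponent at most [D], seen through a multilinear [L]. *)
Definition multi_sum (V : lmodType C) (L : seq {poly C} -> V) (c : nat -> C) k D : V :=
  \sum_(a <- multi_index k D) c (sumn a) *: L [seq 'X^i | i <- a].

Lemma multi_sumS (V : lmodType C) (L : seq {poly C} -> V) (c : nat -> C) k D :
  multi_sum L c k.+1 D = \sum_(0 <= a < D.+1)
    multi_sum (fun s => L ('X^a :: s)) (fun l => c (a + l)%N) k D.
Proof. by rewrite /multi_sum big_allpairs_dep. Qed.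

Lemma multi_sum_eq0 (V : lmodType C) (L : seq {poly C} -> V) (c : nat -> C) k D :
  (forall l, c l = 0) -> multi_sum L c k D = 0.
Proof. by move=> h; apply: big1 => a _; rewrite h scale0r. Qed.

Definition poly_norm (p : {poly C}) : R := fine (supnorm (fun z => p.[z])).

Lemma poly_norm_ge0 p : 0 <= poly_norm p.
Proof. by rewrite fine_ge0// supnorm_ge0. Qed.

Lemma cn_poly_norm p z : cn z = 1 -> cn p.[z] <= poly_norm p.
Proof. by move=> /circleE; apply: cn_supnorm; apply: disk_algebra_poly. Qed.

Definition tensor_cost (s : seq {poly C}) : R := \prod_(p <- s) poly_norm p.

Lemma tensor_cost_ge0 s : 0 <= tensor_cost s.
Proof. by apply: prodr_ge0 => p _; apply: poly_norm_ge0. Qed.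

Lemma tensor_cost_cons p s : tensor_cost (p :: s) = poly_norm p * tensor_cost s.
Proof. by rewrite /tensor_cost big_cons. Qed.

Lemma poly_normZXn a k : cn a <= 1 -> poly_norm (a *: 'X^k) <= 1.
Proof.
move=> a1; apply: poly_supnorm => z z1.
by rewrite hornerZ hornerXn cnM cnX z1 expr1n mulr1.
Qed.

Lemma tensor_cost_monomial (a : seq nat) : tensor_cost [seq 'X^i | i <- a] <= 1.
Proof.
elim: a => [|i a ih]; first by rewrite /tensor_cost big_nil.
rewrite tensor_cost_cons mulr_ile1 ?poly_norm_ge0 ?tensor_cost_ge0//.
by rewrite -['X^i]scale1r poly_normZXn// cn1.
Qed.

Lemma poly_wide (p : {poly C}) D : (size p <= D.+1)%N ->
  p = \sum_(0 <= a < D.+1) p`_a *: 'X^a.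
Proof.
move=> sp; rewrite big_mkord -poly_def; apply/polyP => i; rewrite coef_poly.
by case: ltnP => // h; rewrite nth_default// (leq_trans sp).
Qed.

Lemma drop_poly_circle (p : {poly C}) a z : (forall l, (l < a)%N -> p`_l = 0) ->
  cn z = 1 -> cn (drop_poly a p).[z] = cn p.[z].
Proof.
move=> h z1; rewrite -{2}(poly_take_drop a p) (_ : take_poly a p = 0).
  by rewrite add0r hornerM hornerXn cnM cnX z1 expr1n mulr1.
by apply/polyP => i; rewrite coef_take_poly coef0; case: ltnP => // /h.
Qed.

(** When the exponent [a < P] of the head is removed, a polynomial starting at [k.+1 * P] still
    starts above [k * P], as the induction requires. Quantifying over all [V] lets one list serve
    numbers and operators, and its cost is counted once. *)
Lemma tensor_decomposition k D P (p : {poly C}) B : (0 < P)%N -> (size p <= D.+1)%N ->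
  (forall l, (l < k * P)%N -> p`_l = 0) -> (forall z, cn z = 1 -> cn p.[z] <= B) ->
  exists L : seq (seq {poly C}), [/\ all (fun s => size s == k.+1) L,
    forall (V : lmodType C) (lam : seq {poly C} -> V), multilinear lam ->
      \sum_(s <- L) lam s = multi_sum lam (fun i => p`_i) k.+1 D &
    \sum_(s <- L) tensor_cost s <= (k%:R * (2 * D%:R / P%:R) + 1) * D.+1%:R ^+ k * B].
Proof.
move=> P0; elim: k p => [|k ih] p sp p0 hB.
  exists [:: [:: p]]; split=> //.
    move=> V lam hlam; rewrite big_seq1 {1}(poly_wide sp) multilinear_sum// multi_sumS.
    apply: eq_bigr => a _; rewrite multilinearZ// /multi_sum big_seq1/= addn0//.
  by rewrite big_seq1 /tensor_cost big_seq1 mul0r add0r expr0 !mul1r; apply: poly_supnorm.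
have B0 : 0 <= B by apply: le_trans (hB 1 (cn1)); rewrite rnorm_ge0.
(* For [D < P] no coefficient is left and the empty list does; otherwise the ramp at [P] fits below
   [D]. *)
have [PD|DP] := leqP P D; last first.
  have p00 l : p`_l = 0.
    have [lP|Pl] := ltnP l P; first by apply: p0; rewrite mulSn ltn_addr.
    by rewrite nth_default// (leq_trans sp)// (leq_trans DP).
  exists [::]; split=> //; first by move=> V lam _; rewrite big_nil multi_sum_eq0.
  rewrite big_nil !mulr_ge0 ?exprn_ge0// addr_ge0// mulr_ge0// mulr_ge0//.
(* [al a = min(1, a / P)], the difference of the ramps at [0] and [P]. *)
pose al a : C := (a - (a - P))%N%:R / P%:R.
have al_le1 a : cn (1 - al a) <= 1.
  have -> : 1 - al a = (1 - (a - (a - P))%N%:R / P%:R : R)%:C.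
    by rewrite rmorphB rmorphM fmorphV !rmorph_nat.
  have h0 : (0 : R) <= (a - (a - P))%N%:R / P%:R by rewrite divr_ge0.
  have h1 : ((a - (a - P))%N%:R / P%:R : R) <= 1.
    by rewrite ler_pdivrMr ?ltr0n// mul1r ler_nat; lia.
  by rewrite cnR ger0_norm ?subr_ge0// gerBl.
have al1 a : (P <= a)%N -> 1 - al a = 0.
  by move=> Pa; rewrite /al subKn// divff ?subrr// pnatr_eq0 -lt0n.
(* The factor [1 - al a] stays in the identity because it vanishes for [P <= a], where the shortened
   polynomial may start too low; the list is then empty. *)
pose D' a (L : seq (seq {poly C})) := [/\ all (fun s => size s == k.+1) L,
    forall (V : lmodType C) (lam : seq {poly C} -> V), multilinear lam ->
      (1 - al a) *: \sum_(s <- L) lam s = (1 - al a) *: multi_sum lam (fun i => p`_(a + i)) k.+1 D &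
    \sum_(s <- L) tensor_cost s <= (k%:R * (2 * D%:R / P%:R) + 1) * D.+1%:R ^+ k * B].
have /choice[L hL] : forall a, exists L, D' a L.
  move=> a; have [aP|Pa] := ltnP a P; last first.
    exists [::]; split=> //; first by move=> V lam _; rewrite al1// !scale0r.
    by rewrite big_nil !mulr_ge0 ?exprn_ge0// addr_ge0// mulr_ge0// mulr_ge0.
  have [|l lk|z z1|L [h1 h2 h3]] := ih (drop_poly a p).
  - by rewrite size_drop_poly (leq_trans (leq_subr _ _)).
  - by rewrite coef_drop_poly p0// mulSn; move: lk aP; set X := (k * P)%N; lia.
  - rewrite drop_poly_circle// ?hB// => l la; apply: p0.
    by rewrite mulSn (leq_trans la)// (leq_trans (ltnW aP))// leq_addr.
  - exists L; split=> // V lam hlam; rewrite h2//; congr (_ *: _).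
    by apply: eq_bigr => b _; rewrite coef_drop_poly addnC.
pose G s : {poly C} := P%:R^-1 *: (ramp_poly p D 0 s - ramp_poly p D P s).
have GE s : G s = \sum_(0 <= a < D.+1) (al a * p`_(a + s)) *: 'X^a.
  rewrite big_mkord -(poly_def D.+1 (fun a => al a * p`_(a + s))).
  apply/polyP => i; rewrite coefZ coefB !coef_poly.
  case: ltnP => _; last by rewrite subr0 mulr0.
  rewrite subn0 -mulrBl -natrB ?leq_subr// mulrA [P%:R^-1 * _]mulrC //.
have nG s : poly_norm (G s) <= 2 * D%:R / P%:R * B.
  apply: poly_supnorm => z z1; rewrite hornerZ hornerD hornerN cnM cnV cn_nat.
  rewrite mulrAC mulrC ler_wpM2r ?invr_ge0//.
  rewrite (le_trans (rnormBD _ _))// mulrDl mulrDl mul1r lerD//.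
    by rewrite (le_trans (ramp_poly_bnd s (leq0n D) sp hB z1))// subn0.
  rewrite (le_trans (ramp_poly_bnd s PD sp hB z1))// ler_wpM2r// ler_nat.
  exact: leq_subr.
(* In the first group the head is summed up against each monomial of the other variables; in the
   second the head is a single monomial with a factor of modulus at most 1. *)
exists ([seq G (sumn a) :: [seq 'X^i | i <- a] | a <- multi_index k.+1 D] ++
  flatten [seq [seq (1 - al a) *: 'X^a :: s | s <- L a] | a <- iota 0 D.+1]).
split.
- rewrite all_cat all_map; apply/andP; split.
    by apply/allP => a ha /=; rewrite size_map (multi_index_size ha).
  apply/allP => s /flattenP[_ /mapP[a _ ->] /mapP[t ht ->]] /=.
  by case: (hL a) => /allP /(_ _ ht) /eqP-> _ _.
- move=> V lam hlam; rewrite big_cat.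
  rewrite [in RHS]multi_sumS.
  transitivity (\sum_(0 <= a < D.+1) (al a *: multi_sum (fun s => lam ('X^a :: s))
    (fun l => p`_(a + l)) k.+1 D) +
     \sum_(0 <= a < D.+1) ((1 - al a) *: multi_sum (fun s => lam ('X^a :: s)) (fun l => p`_(a +
       l)) k.+1 D)); last first.
    rewrite -big_split; apply: eq_bigr => a _.
    by apply: etrans (esym (scalerDl _ _ _)) _; rewrite addrC subrK scale1r.
  apply: congr2; [rewrite big_map|rewrite big_allpairs_dep].
    under eq_bigr do rewrite GE multilinear_sum//.
    rewrite exchange_big; apply: eq_bigr => a _.
    rewrite /multi_sum scaler_sumr; apply: eq_bigr => s _.
    by rewrite multilinearZ// scalerA.
  apply: eq_bigr => a _; have [_ h2 _] := hL a; rewrite -h2; last exact: multilinear_cons.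
  by rewrite scaler_sumr; apply: eq_bigr => s _; rewrite multilinearZ.
- rewrite big_cat.
  (* The constant solves the recursion: [D.+1 ^ k.+1] tensors of cost at most [2 D / P B], plus
     [D.+1] lists from the induction. *)
  have -> : (k.+1%:R * (2 * D%:R / P%:R) + 1) * D.+1%:R ^+ k.+1 * B =
    D.+1%:R ^+ k.+1 * (2 * D%:R / P%:R * B) +
    D.+1%:R * ((k%:R * (2 * D%:R / P%:R) + 1) * D.+1%:R ^+ k * B).
    by rewrite exprS -[k.+1%:R]natr1; ring.
  apply: lerD; [rewrite big_map|rewrite big_allpairs_dep].
    apply: (@le_trans _ _ (\sum_(a <- multi_index k.+1 D) (2 * D%:R / P%:R * B))).
      apply: ler_sum => a _; rewrite tensor_cost_cons -[leRHS]mulr1.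
      by apply: ler_pM; rewrite ?poly_norm_ge0 ?tensor_cost_ge0// tensor_cost_monomial.
    by rewrite big_const_seq count_predT iter_addr_0 size_multi_index -natrX [leRHS]mulr_natl.
  apply: (@le_trans _ _ (\sum_(a <- iota 0 D.+1) ((k%:R * (2 * D%:R / P%:R) + 1) * D.+1%:R ^+ k * B))).
    apply: ler_sum => a _; case: (hL a) => _ _; apply: le_trans.
    apply: ler_sum => s _; rewrite tensor_cost_cons -[leRHS]mul1r.
    by rewrite ler_wpM2r ?tensor_cost_ge0// poly_normZXn.
  by rewrite big_const_seq count_predT iter_addr_0 size_iota [leRHS]mulr_natl.
Qed.

End TensorLists.

(** * Sums of words, for scalars and operators at once *)

Section WordSums.
Context {R : realType}.
Local Notation C := R[i].

Lemma triangular_sum (V : nmodType) D (F : nat -> nat -> V) :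
  (forall r a, (D < r + a)%N -> F r a = 0) ->
  \sum_(a < D.+1) \sum_(r < D.+1) F r a = \sum_(t < D.+1) \sum_(a < t.+1) F (t - a)%N a.
Proof.
move=> F0.
transitivity (\sum_(a < D.+1) \sum_(t < D.+1 | (a <= t)%N) F (t - a)%N a).
  apply: eq_bigr => a _; have aD := ltn_ord a.
  rewrite -(big_mkord xpredT (fun r => F r a)).
  rewrite -(big_mkord (fun t => (a <= t)%N) (fun t => F (t - a)%N a)).
  rewrite [RHS](@big_cat_nat _ _ _ a _ D.+1)//=; last exact: ltnW.
  rewrite [X in _ = X + _]big_nat_cond [X in _ = X + _]big1 ?add0r; last first.
    by move=> t /andP[/andP[_ h1] h2]; move: h1; rewrite ltnNge h2.
  transitivity (\sum_(a <= t < D.+1) F (t - a)%N a); last first.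
    rewrite [LHS]big_nat_cond [RHS]big_nat_cond; apply: eq_bigl => t.
    by case: (leqP a t) => //= _; rewrite ?andbT ?andbF.
  have := big_addn 0 D.+1 a xpredT (fun t => F (t - a)%N a); rewrite add0n => ->.
  rewrite (@big_cat_nat _ _ _ (D.+1 - a)%N 0%N D.+1)//=; last exact: leq_subr.
  rewrite [X in _ + X = _]big_nat [X in _ + X = _]big1 ?addr0; last first.
    by move=> r /andP[h _]; apply: F0; lia.
  by apply: eq_bigr => r _; rewrite addnK.
rewrite (exchange_big_dep xpredT)//=; apply: eq_bigr => t _.
by rewrite (big_ord_widen_cond D.+1 xpredT (fun a => F (t - a)%N a)) ?ltnS//; have := ltn_ord t.
Qed.

Section Recursion.
Variables (V : lmodType C) (lam : seq {poly C} -> V).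
Variables (tau : nat -> V -> V) (kappa : V -> V) (X : nat -> nat -> V).
Hypothesis X0 : forall l, X 0 l = lam [:: 'X^l].
Hypothesis XS0 : forall k, X k.+1 0 = 0.
Hypothesis XSS : forall k l, X k.+1 l.+1 = tau k (X k.+1 l) + kappa (X k l).
Hypothesis ltau : forall k, linear (tau k).
Hypothesis lkappa : linear kappa.
Hypothesis lam_cons : forall k a s, size s = k.+1 ->
  lam ('X^a :: s) = iter a (tau k) (kappa (lam s)).

Lemma words_lt k l : (l < k)%N -> X k l = 0.
Proof.
elim: l k => [|l ih] [|k]//; rewrite ltnS => lk.
rewrite XSS !ih//; last exact: leqW.
by rewrite (lin0 (ltau _)) (lin0 lkappa) addr0.
Qed.

Lemma iter_linear k a : linear (iter a (tau k)).
Proof. by elim: a => // a ih b x y /=; rewrite ih ltau. Qed.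

(** Words are sorted by the number [a] of letters [tau k] that follow the last [kappa]; words
    shorter than their number of [kappa] vanish. *)
Lemma words_closed k t :
  X k.+1 (k.+1 + t)%N = \sum_(a < t.+1) iter a (tau k) (kappa (X k (k + (t - a))%N)).
Proof.
elim: t => [|t ih].
  rewrite addn0 XSS words_lt// (lin0 (ltau _)) add0r big_ord_recl big_ord0 addr0.
  by rewrite addn0.
rewrite addnS XSS ih [RHS]big_ord_recl /= subn0 addrC addSnnS; congr (_ + _).
by rewrite (lin_sum (ltau _)).
Qed.

(** The head exponent [a] contributes the outer power of [tau], and the terms are regrouped by total
    degree [t = r + a]. The shift [k + r] counts the [k] letters [kappa] in the length of the
    word. *)
Lemma multi_sum_words k c D : (forall l, (D < l)%N -> c l = 0) ->
  multi_sum lam c k.+1 D = \sum_(r < D.+1) c r *: X k (k + r)%N.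
Proof.
elim: k c => [|k ih] c c0.
  rewrite multi_sumS big_mkord; apply: eq_bigr => a _.
  by rewrite /multi_sum big_seq1/= addn0 add0n X0.
rewrite multi_sumS big_mkord.
transitivity (\sum_(a < D.+1) \sum_(r < D.+1) c (a + r)%N *: iter a (tau k) (kappa (X k (k + r)%N))).
  apply: eq_bigr => a _.
  transitivity (iter a (tau k) (kappa (multi_sum lam (fun l => c (a + l)%N) k.+1 D))).
    rewrite /multi_sum (lin_sum lkappa) (lin_sum (iter_linear k a)).
    rewrite big_seq_cond [RHS]big_seq_cond; apply: eq_bigr => s /andP[/multi_index_size ss _].
    by rewrite (@lam_cons k) ?size_map// (linZ lkappa) (linZ (iter_linear k a)).
  rewrite ih; last by move=> l Dl; apply: c0; rewrite ltn_addl.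
  rewrite (lin_sum lkappa) (lin_sum (iter_linear k a)); apply: eq_bigr => r _.
  by rewrite (linZ lkappa) (linZ (iter_linear k a)).
rewrite (triangular_sum (F := fun r a => c (a + r)%N *: iter a (tau k) (kappa (X k (k + r)%N)))).
  apply: eq_bigr => t _; rewrite words_closed scaler_sumr; apply: eq_bigr => a _.
  by rewrite subnKC// -ltnS.
by move=> r a Dra; rewrite c0 ?scale0r// addnC.
Qed.

End Recursion.

End WordSums.

Section ScalarWords.
Context {R : realType}.
Local Notation C := R[i].
Implicit Types (z : nat -> C).

Fixpoint scalar_eval z (s : seq {poly C}) : C^o :=
  if s is f :: s' then scalar_eval z s' * f.[z (size s')] else 1.

Lemma scalar_eval_multilinear z : multilinear (scalar_eval z).
Proof.
move=> s1 s2 a p q; elim: s1 => [|f s1 ih] /=.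
  by rewrite hornerD hornerZ mulrDr mulrCA.
by rewrite ih mulrDl !size_cat /= -scalerAl.
Qed.

(* The complete homogeneous symmetric polynomial of degree [l - k] in [z 0, ..., z k]. *)
Fixpoint scalar_words z k l : C^o :=
  match k, l with
  | 0, _ => z 0%N ^+ l
  | _.+1, 0 => 0
  | k'.+1, l'.+1 => scalar_words z k l' * z k + scalar_words z k' l'
  end.

Lemma scalar_words0 z l : scalar_words z 0 l = z 0%N ^+ l.
Proof. by case: l. Qed.

Lemma multi_sum_scalar z k c D : (forall l, (D < l)%N -> c l = 0) ->
  multi_sum (scalar_eval z) c k.+1 D = \sum_(r < D.+1) c r *: scalar_words z k (k + r)%N.
Proof.
apply: (@multi_sum_words _ _ _ (fun k (x : C^o) => (x * z k.+1 : C^o)) id).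
- by move=> l; rewrite scalar_words0 /= hornerXn mul1r.
- by [].
- by [].
- by move=> m a x y; rewrite mulrDl -scalerAl.
- by [].
- move=> m a s /= ->; rewrite hornerXn.
  by elim: a => [|a ih]; rewrite ?mulr1// exprSr mulrA ih.
Qed.

(** This is the identity between complete homogeneous symmetric polynomials that turns a quotient of
    differences into one with an additional point [y]; induction on [l] through the recursion in the
    last variable. *)
Lemma scalar_words_swap z k l (y : C) : 
  let z' := fun i => if i == k then y else z i in
  let z2 := fun i => if i == k.+1 then y else z i in
  scalar_words z k l - scalar_words z' k l = (z k - y) * scalar_words z2 k.+1 l.
Proof.
move=> z' z2.
have lo (u v : nat -> C) m n : (forall i, (i <= m)%N -> u i = v i) ->
  scalar_words u m n = scalar_words v m n.
  elim: m n => [|m ih] n h; first by rewrite !scalar_words0 h.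
  have {}ih n' : scalar_words u m n' = scalar_words v m n' by apply: ih => i im; rewrite h// leqW.
  by elim: n => //= n ->; rewrite h// ih.
have e2 n : scalar_words z2 k n = scalar_words z k n.
  by apply: lo => i ik; rewrite /z2; case: eqP => // E; move: ik; rewrite E ltnn.
have ez' : z' k = y by rewrite /z' eqxx.
have ez2 : z2 k.+1 = y by rewrite /z2 eqxx.
case: k @z' @z2 e2 ez' ez2 lo => [|k] z' z2 e2 ez' ez2 lo.
  elim: l => [|l ih]; first by rewrite /= !expr0 subrr mulr0.
  rewrite -[scalar_words z2 1 l.+1]/(scalar_words z2 1 l * z2 1%N + scalar_words z2 0 l).
  rewrite ez2 e2 mulrDr mulrA -ih !scalar_words0 ez' !exprSr.
  by ring.
have ek n : scalar_words z' k n = scalar_words z k n.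
  by apply: lo => i ik; rewrite /z'; case: eqP => // E; move: ik; rewrite E ltnn.
elim: l => [|l ih]; first by rewrite /= subrr mulr0.
rewrite -[scalar_words z2 k.+2 l.+1]/(scalar_words z2 k.+2 l * z2 k.+2 + scalar_words z2 k.+1 l).
rewrite ez2 e2 mulrDr mulrA -ih.
rewrite -[scalar_words z k.+1 l.+1]/(scalar_words z k.+1 l * z k.+1 + scalar_words z k l).
rewrite -[scalar_words z' k.+1 l.+1]/(scalar_words z' k.+1 l * z' k.+1 + scalar_words z' k l).
by rewrite ek ez'; ring.
Qed.

Lemma divdiff_poly (p : {poly C}) k z N : (size p <= N)%N ->
  (forall i j, (i <= k)%N -> (j <= k)%N -> z i = z j -> i = j) ->
  divdiff (fun w => p.[w]) k z = \sum_(l < N) p`_l * scalar_words z k l.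
Proof.
move=> sp; elim: k z => [|k ih] z zinj; first by rewrite /= (horner_coef_wide _ sp);
  under [RHS]eq_bigr do rewrite scalar_words0.
rewrite /= !ih; last first.
- by move=> i j ik jk; apply: zinj; apply: leqW.
- move=> i j ik jk; case: eqP => [->|ne]; case: eqP => [->|ne'] //.
  + by move=> /zinj h; have := h (leqnn _) (leqW jk) => E; move: jk; rewrite -E ltnn.
  + by move=> /zinj h; have := h (leqW ik) (leqnn _) => E; move: ik; rewrite E ltnn.
  + by apply: zinj; apply: leqW.
rewrite -sumrB.
have z2E : (fun i => if i == k.+1 then z k.+1 else z i) = z.
  by apply/funext => i; case: eqP => // ->.
rewrite (eq_bigr (fun l : 'I_N => (z k - z k.+1) * (p`_l * scalar_words z k.+1 l))); last first.
  move=> l _; have := scalar_words_swap z k l (z k.+1); rewrite z2E => h.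
  by rewrite [RHS]mulrCA -h mulrBr.
rewrite -mulr_sumr mulrAC divff ?mul1r; last first.
  by rewrite subr_eq0; apply/eqP => /zinj h; have := h (leqnSn _) (leqnn _) => /eqP;
    rewrite -[X in X == _]addn0 -addn1 eqn_add2l.
by [].
Qed.

End ScalarWords.

Section OperatorWords.
Context {R : realType} {H : hilbertType R}.
Implicit Types (T Q : H -> H).

Lemma poly_op_wide (p : {poly R[i]}) T N : (size p <= N)%N ->
  poly_op p T = \sum_(i < N) p`_i *: iter i T.
Proof.
move=> sN; rewrite /poly_op (big_ord_widen N (fun i => p`_i *: iter i T) sN) big_mkcond.
apply: eq_bigr => i _; case: ltnP => // h; by rewrite nth_default// scale0r.
Qed.

Lemma poly_opD a (p q : {poly R[i]}) T : poly_op (a *: p + q) T = a *: poly_op p T + poly_op q T.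
Proof.
pose N := maxn (size (a *: p + q)) (maxn (size p) (size q)).
rewrite !(@poly_op_wide _ T N) ?leq_maxl ?leq_max ?leqnn ?orbT//.
rewrite scaler_sumr -big_split/=; apply: eq_bigr => i _.
by rewrite coefD coefZ scalerDl scalerA.
Qed.

Lemma poly_opXn T k : poly_op 'X^k T = iter k T.
Proof.
rewrite (@poly_op_wide _ T k.+1) ?size_polyXn// big_ord_recr big1/=.
  by rewrite add0r coefXn eqxx scale1r.
by move=> i _; rewrite coefXn ltn_eqF ?ltn_ord// scale0r.
Qed.

(** The head acts first and so is the rightmost factor, matching the last variable of [scalar_eval];
    the inner match puts [Q] only between two factors. *)
Fixpoint op_eval T Q (s : seq {poly R[i]}) : H -> H :=
  if s is f :: s' then
    if s' is [::] then poly_op f T else (op_eval T Q s' \o Q) \o poly_op f T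
  else id.

Lemma op_eval_linear T Q s : linear T -> linear Q -> linear (op_eval T Q s).
Proof.
move=> lT lQ; elim: s => //= f s ih; have lf := poly_op_linear f lT.
by case: s ih => // g s ih; apply: linear_comp => //; apply: linear_comp.
Qed.

Lemma op_eval_multilinear T Q : linear T -> linear Q -> multilinear (op_eval T Q).
Proof.
move=> lT lQ s1 s2 a p q; elim: s1 => [|f s1 ih].
  case: s2 => [|g s2]; first by rewrite /= poly_opD.
  have E r x : op_eval T Q ([::] ++ r :: g :: s2) x =
    op_eval T Q (g :: s2) (Q (poly_op r T x)) by [].
  have lE := op_eval_linear (g :: s2) lT lQ.
  apply/funext => x; rewrite !fctE !E poly_opD !fctE (linD lQ) (linZ lQ).
  by rewrite (linD lE) (linZ lE).
rewrite /=.
have : (s1 ++ (a *: p + q) :: s2) <> [::] by case: (s1).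
have : (s1 ++ p :: s2) <> [::] by case: (s1).
have : (s1 ++ q :: s2) <> [::] by case: (s1).
move: ih; case: (s1 ++ _) => //= g1 t1; case: (s1 ++ _) => //= g2 t2; case: (s1 ++ _) => //= g3 t3.
by move=> -> _ _ _.
Qed.

(* The sum of the words of length [l] with [k] letters [Q] and [l - k] letters [T], that is
   the coefficient of [h ^ k] in [(T + h Q) ^ l]. *)
Fixpoint op_words T Q k l : H -> H :=
  match k, l with
  | 0, _ => iter l T
  | _.+1, 0 => 0
  | k'.+1, l'.+1 => (op_words T Q k l' \o T) + (op_words T Q k' l' \o Q)
  end.

Lemma op_words0 T Q l : op_words T Q 0 l = iter l T.
Proof. by case: l. Qed.

Lemma op_wordsSS T Q k l : op_words T Q k.+1 l.+1 =
  (op_words T Q k.+1 l \o T) + (op_words T Q k l \o Q).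
Proof. by []. Qed.

Lemma op_words_linear T Q k l : linear T -> linear Q -> linear (op_words T Q k l).
Proof.
move=> lT lQ; elim: l k => [|l ih] [|k]; [by []|exact: linear_zero|exact: linear_iter|].
by rewrite op_wordsSS; apply: linear_add; apply: linear_comp.
Qed.

Lemma op_words_lt T Q k l : (l < k)%N -> op_words T Q k l = 0.
Proof.
elim: l k => [|l ih] [|k]//; rewrite ltnS => lk.
by rewrite op_wordsSS !ih//; [apply/funext => x; rewrite !fctE /= addr0|exact: leqW].
Qed.

Lemma multi_sum_op T Q k c D : linear T -> linear Q -> (forall l, (D < l)%N -> c l = 0) ->
  multi_sum (op_eval T Q) c k.+1 D = \sum_(r < D.+1) c r *: op_words T Q k (k + r)%N.
Proof.
move=> lT lQ.
apply: (@multi_sum_words _ _ _ (fun _ (A : H -> H) => A \o T) (fun A => A \o Q)).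
- by move=> l; rewrite op_words0 /= poly_opXn.
- by [].
- by [].
- by [].
- by [].
- move=> m a [//|g s] _ /=; rewrite poly_opXn.
  elim: a => [|a ih]//=; rewrite -ih.
  by apply/funext => x; rewrite /= -iterS iterSr.
Qed.

(** The coefficient of [h ^ k] in [p(T + h Q)]: a directional derivative without its factor [k!]. *)
Definition op_deriv T Q k (p : {poly R[i]}) := \sum_(l < size p) p`_l *: op_words T Q k l.

Lemma sum_shift_words (V : lmodType R[i]) (X : nat -> V) (p : {poly R[i]}) k D :
  (forall l, (l < k)%N -> X l = 0) -> (size p <= k + D.+1)%N ->
  \sum_(r < D.+1) p`_(k + r) *: X (k + r)%N = \sum_(l < size p) p`_l *: X l.
Proof.
move=> X0 sp; transitivity (\sum_(l < k + D.+1) p`_l *: X l).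
  rewrite big_split_ord/= [X in _ = X + _]big1 ?add0r// => i _.
  by rewrite X0 ?scaler0.
rewrite (big_ord_widen _ (fun l => p`_l *: X l) sp) [RHS]big_mkcond.
by apply: eq_bigr => i _; case: ltnP => // h; rewrite nth_default// scale0r.
Qed.

End OperatorWords.

(** * Tensor lists of controlled cost for dyadic blocks *)

Section TensorRepresentation.
Context {R : realType}.
Local Notation cn z := (rnorm (z : R[i]^o)).

(** A single list stands for the operator words and for the divided difference, so one bound on its
    cost controls both. *)
Definition represents k (p : {poly R[i]}) (L : seq (seq {poly R[i]})) :=
  [/\ all (fun s => size s == k.+1) L,
    forall (H : hilbertType R) (T Q : H -> H), linear T -> linear Q ->
      \sum_(s <- L) op_eval T Q s = op_deriv T Q k p &
    forall z, \sum_(s <- L) scalar_eval z s = \sum_(l < size p) p`_l * scalar_words z k l].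

Lemma scalar_words_lt (z : nat -> R[i]) k l : (l < k)%N -> scalar_words z k l = 0.
Proof.
elim: l k => [|l ih] [|k]//; rewrite ltnS => lk.
by rewrite /= !ih ?mul0r ?addr0//; exact: leqW.
Qed.

Lemma represents_multi_sum k D (p : {poly R[i]}) L : (size p <= k + D.+1)%N ->
  all (fun s => size s == k.+1) L ->
  (forall (V : lmodType R[i]) (lam : seq {poly R[i]} -> V), multilinear lam ->
    \sum_(s <- L) lam s = multi_sum lam (fun r => p`_(k + r)) k.+1 D) ->
  represents k p L.
Proof.
move=> sp sL hL.
have c0 l : (D < l)%N -> p`_(k + l) = 0.
  by move=> Dl; rewrite nth_default// (leq_trans sp)// leq_add2l.
split=> // [H T Q lT lQ|z].
  rewrite hL; last exact: op_eval_multilinear.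
  rewrite multi_sum_op// /op_deriv (sum_shift_words (X := op_words T Q k))//.
  by move=> l; exact: op_words_lt.
rewrite hL; last exact: scalar_eval_multilinear.
rewrite multi_sum_scalar// (sum_shift_words (V := R[i]^o) (X := scalar_words z k))//.
by move=> l; exact: scalar_words_lt.
Qed.

(** The plain expansion into monomials, without control of the cost: enough for the finitely many
    blocks that start too low. *)
Lemma represents_exists k (p : {poly R[i]}) : exists L, represents k p L.
Proof.
pose D := size p; pose hd (a : seq nat) := if a is i :: a' then (p`_(k +
  sumn a) *: 'X^i : {poly R[i]}) :: [seq 'X^j | j <- a'] else [::].
exists [seq hd a | a <- multi_index k.+1 D].
apply: (@represents_multi_sum k D).
- by rewrite addnS leqW// leq_addl.
- rewrite all_map; apply/allP => a /multi_index_size; case: a => // i a /= [<-].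
  by rewrite size_map.
- move=> V lam hlam; rewrite big_map /multi_sum big_seq_cond [RHS]big_seq_cond.
  apply: eq_bigr => a /andP[/multi_index_size]; case: a => // i a _ _ /=.
  by rewrite multilinearZ.
Qed.

Lemma represents_bounded k D P (p : {poly R[i]}) B : (0 < P)%N -> (size p <= k + D.+1)%N ->
  (forall l, (l < k * P + k)%N -> p`_l = 0) -> (forall z, cn z = 1 -> cn p.[z] <= B) ->
  exists2 L, represents k p L &
    \sum_(s <- L) tensor_cost s <= (k%:R * (2 * D%:R / P%:R) + 1) * D.+1%:R ^+ k * B.
Proof.
move=> P0 sp p0 hB.
have [||z z1|L [h1 h2 h3]] := @tensor_decomposition R k D P (drop_poly k p) B P0.
- by rewrite size_drop_poly leq_subLR.
- by move=> l lk; rewrite coef_drop_poly p0// ltn_add2r.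
- by rewrite drop_poly_circle// ?hB// => l lk; apply: p0; rewrite (leq_trans lk)// leq_addl.
exists L => //; apply: (@represents_multi_sum k D) => // V lam hlam; rewrite h2//.
by apply: eq_bigr => a _; rewrite coef_drop_poly addnC.
Qed.

Lemma dyadic_represents n k (p : nat -> {poly R[i]}) (b : nat -> R) S : (k <= n)%N ->
  (forall m, 0 <= b m) ->
  (forall m, (size (p m.+1) <= (2 ^ m.+2).+1)%N) ->
  (forall m l, (l < 2 ^ m)%N -> (p m.+1)`_l = 0) ->
  (forall m z, cn z = 1 -> cn (p m).[z] <= b m) ->
  (forall M, \sum_(0 <= m < M) 2 ^+ (m * n) * b m <= S) ->
  exists L : nat -> seq (seq {poly R[i]}), (forall m, represents k (p m) (L m)) /\
    exists K, forall M, \sum_(0 <= m < M) \sum_(s <- L m) tensor_cost s <= K.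
Proof.
move=> kn b0 sp p0 hb hS.
(* Here [D = 2 ^ m.+1] and, for [m >= n.+2], [P = 2 ^ (m - n.+2)]. Then [2 D / P = 2 ^ (n + 4)], and
   [D.+1 <= 2 ^ m.+2] yields [2 ^ (m * k)] times [2 ^ (2 * k)]. *)
pose K : R := (k%:R * 2 ^+ (n.+1 + 3) + 1) * 2 ^+ (2 * k).
have K0 : 0 <= K by rewrite mulr_ge0// addr_ge0// mulr_ge0.
have hL m : exists L, represents k (p m) L /\
    ((n.+2 <= m)%N -> \sum_(s <- L) tensor_cost s <= K * (2 ^+ (m * n) * b m)).
  have [mn|nm] := leqP n.+2 m; last first.
    have [L hL] := represents_exists k (p m); by exists L; split.
  have [m' em] : exists m', m = (m' + n.+1).+1 by exists (m - n.+2)%N; lia.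
  have P0 : (0 < 2 ^ m')%N by rewrite expn_gt0.
  have [|l lk|L h1 h2] := @represents_bounded k (2 ^ m.+1) (2 ^ m') (p m) (b m) P0 _ _ (hb m).
  - by rewrite em (leq_trans (sp _))// leq_addl.
  - rewrite em p0// (leq_trans lk)//.
    (* The block starts at [2 ^ (m' + n.+1)], which dominates [2 n 2 ^ m'] and hence [k P + k]. *)
    have : (k * 2 ^ m' + k <= n * 2 ^ m' + n * 2 ^ m')%N.
      rewrite leq_add ?leq_mul2r ?kn ?orbT// (leq_trans kn)// leq_pmulr//.
    move/leq_trans; apply; rewrite -mulnDr addnn -mul2n mulnA expnD mulnC leq_mul2l.
    by rewrite mulnC expnS leq_mul2l/= ltnW ?orbT// ltn_expl.
  exists L; split=> // _; apply: (le_trans h2).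
  have e1 : (2 * (2 ^ m.+1)%N%:R / (2 ^ m')%N%:R : R) = 2 ^+ (n.+1 + 3).
    rewrite !natrX -exprS em (_ : (m' + n.+1).+3 = (m' + (n.+1 + 3))%N); last by lia.
    by rewrite exprD mulrAC divff ?mul1r// expf_neq0// pnatr_eq0.
  rewrite e1 /K -!mulrA; apply: ler_wpM2l; first by rewrite addr_ge0// mulr_ge0.
  rewrite !mulrA ler_wpM2r// -exprD.
  apply: (@le_trans _ _ ((2 ^+ m.+2) ^+ k)).
    have e2 : ((2 ^ m.+1).+1 <= 2 ^ m.+2)%N.
      have : (0 < 2 ^ m.+1)%N by rewrite expn_gt0.
      by rewrite [X in _ -> (_ <= X)%N]expnS; set X := (2 ^ m.+1)%N; lia.
    by rewrite lerXn2r ?nnegrE// -natrX ler_nat.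
  rewrite -exprM ler_eXn2l ?ltr1n//.
  by rewrite -addn2 mulnDl addnC leq_add2l leq_mul2l kn orbT.
have /choice[L hL'] := hL; exists L; split=> [m|]; first by case: (hL' m).
exists (\sum_(0 <= m < n.+2) \sum_(s <- L m) tensor_cost s + K * S) => M.
have c0 m : 0 <= \sum_(s <- L m) tensor_cost s by apply: sumr_ge0 => s _; apply: tensor_cost_ge0.
apply: (@le_trans _ _ (\sum_(0 <= m < M + n.+2) \sum_(s <- L m) tensor_cost s)).
  by rewrite [leRHS](@big_cat_nat _ _ _ M)//= ?leq_addr// lerDl sumr_ge0.
rewrite (@big_cat_nat _ _ _ n.+2)//= ?leq_addl// lerD2l.
apply: (@le_trans _ _ (\sum_(n.+2 <= m < M + n.+2) K * (2 ^+ (m * n) * b m))).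
  rewrite big_nat [leRHS]big_nat; apply: ler_sum => m /andP[h _].
  by case: (hL' m) => _; apply.
rewrite -mulr_sumr ler_wpM2l// (le_trans _ (hS (M + n.+2)%N))//.
rewrite [leRHS](@big_cat_nat _ _ _ n.+2)//= ?leq_addl// lerDr sumr_ge0// => m _.
by rewrite mulr_ge0// exprn_ge0.
Qed.

End TensorRepresentation.

(** * Termwise differentiation *)

Section WordDerivative.
Context {R : realType} {H : hilbertType R}.
Implicit Types (T Q : H -> H).

Lemma op_words_bnd T Q q k l : 0 <= q -> opbnd T 1 -> opbnd Q q ->
  opbnd (op_words T Q k l) ((1 + q) ^+ l).
Proof.
move=> q0 bT bQ; have q1 : 1 <= 1 + q by rewrite lerDl.
elim: l k => [|l ih] [|k].
- exact: opbnd_iter.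
- by apply: opbnd_le (@opbnd0 _ H H).
- by apply: opbnd_le (opbnd_iter _ bT); rewrite exprn_ege1.
- rewrite op_wordsSS exprSr mulrDr; have p0 : 0 <= (1 + q) ^+ l by rewrite exprn_ge0// addr_ge0.
  by apply: opbndD; apply: opbnd_comp.
Qed.

Lemma op_words_remainder q k l : 0 <= q -> exists K, 0 <= K /\ forall T Q (h : R),
  linear T -> linear Q -> opbnd T 1 -> opbnd (T + h%:C *: Q) 1 -> opbnd Q q -> `|h| <= 1 ->
  opbnd (op_words (T + h%:C *: Q) Q k l - op_words T Q k l -
    (h *+ k.+1)%:C *: op_words T Q k.+1 l) (K * h ^+ 2).
Proof.
move=> q0; elim: l k => [|l ih] k.
  exists 0; split=> // T Q h *; rewrite mul0r; case: k => [|k].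
    by rewrite /= scaler0 subr0 subrr; apply: opbnd0.
  by rewrite /= scaler0 subr0 subrr; apply: opbnd0.
have W0 : 0 <= (1 + q) ^+ l by rewrite exprn_ge0// addr_ge0.
have [K1 [K10 hK1]] := ih k.
pose K2 : R := K1 + (K1 + k.+1%:R * (1 + q) ^+ l) * q.
have K20 : 0 <= K2 by rewrite addr_ge0// mulr_ge0// addr_ge0// mulr_ge0.
(* The part common to [k = 0] and [k > 0]: the letter acting first is [T + h Q], its [T] leaves the
   remainder of length [l], its [h Q] a first-order difference. *)
have main T Q (h : R) : linear T -> linear Q -> opbnd T 1 -> opbnd (T + h%:C *: Q) 1 ->
  opbnd Q q -> `|h| <= 1 ->
    opbnd ((op_words (T + h%:C *: Q) Q k l - op_words T Q k l -
      (h *+ k.+1)%:C *: op_words T Q k.+1 l) \o T +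
      (h%:C *: (op_words (T + h%:C *: Q) Q k l - op_words T Q k l) \o Q)) (K2 * h ^+ 2).
  move=> lT lQ bT bT' bQ h1; have {}hK1 := hK1 T Q h lT lQ bT bT' bQ h1.
  have hh : `|h| * `|h| = h ^+ 2 by rewrite -expr2 real_normK// num_real.
  rewrite mulrDl; apply: opbndD.
    by rewrite -[_ * h ^+ 2]mulr1; apply: opbnd_comp => //; rewrite mulr_ge0// sqr_ge0.
  rewrite -[_ * q * _]mulrA [q * _]mulrC mulrA; apply: opbnd_comp => //.
    by rewrite mulr_ge0 ?sqr_ge0// addr_ge0// mulr_ge0.
  rewrite -(subrK ((h *+ k.+1)%:C *: op_words T Q k.+1 l) (_ - _)) -hh mulrA mulrC -cnR.
  apply: opbndZ; rewrite mulrDl; apply: opbndD.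
    apply: opbnd_le hK1; rewrite cnR -hh mulrA ler_piMr// mulr_ge0//.
  apply: opbnd_le (opbndZ _ (op_words_bnd _ _ q0 bT bQ)).
  by rewrite !cnR normrMn -[_ *+ k.+1]mulr_natl mulrAC.
case: k => [|k] in K1 K10 hK1 K2 K20 main *.
  exists K2; split=> // T Q h lT lQ bT bT' bQ h1.
  have := main T Q h lT lQ bT bT' bQ h1; congr (opbnd _ _).
  have lU : linear (iter l (T + h%:C *: Q)).
    by apply: linear_iter; apply: linear_add => //; apply: linear_scale.
  have UE y : (T + h%:C *: Q) y = T y + h%:C *: Q y by [].
  move: (T + h%:C *: Q) lU UE => U lU UE.
  apply/funext => x; rewrite op_wordsSS !op_words0 !fctE.
  rewrite [iter l.+1 U x]iterSr [iter l.+1 T x]iterSr UE.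
  rewrite (linD lU) (linZ lU) scalerBr scalerDr mulr1n /=.
  by rewrite opprD !addrA; congr (_ - _); rewrite [LHS]addrAC; congr (_ - _); rewrite addrAC.
have [K0 [K00 hK0]] := ih k.
exists (K2 + K0 * q); split; first by rewrite addr_ge0// mulr_ge0.
move=> T Q h lT lQ bT bT' bQ h1; rewrite mulrDl.
have bG : opbnd ((op_words (T + h%:C *: Q) Q k l - op_words T Q k l -
    (h *+ k.+1)%:C *: op_words T Q k.+1 l) \o Q) (K0 * q * h ^+ 2).
  rewrite mulrAC; apply: opbnd_comp => //; first by rewrite mulr_ge0// sqr_ge0.
  exact: hK0.
have := opbndD (main T Q h lT lQ bT bT' bQ h1) bG; congr (opbnd _ _).
have lU : linear (op_words (T + h%:C *: Q) Q k.+1 l).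
  by apply: op_words_linear => //; apply: linear_add => //; apply: linear_scale.
have UE y : (T + h%:C *: Q) y = T y + h%:C *: Q y by [].
move: (T + h%:C *: Q) lU UE => U lU UE.
apply/funext => x; rewrite !op_wordsSS !fctE /= UE (linD lU) (linZ lU).
rewrite scalerBr scalerDr.
(* One copy of [h] belongs to [main], the other [k.+1] to the remainder of order [k] followed by
   [Q]. *)
have -> : (h *+ k.+2)%:C *: op_words T Q k.+1 l (Q x) =
    h%:C *: op_words T Q k.+1 l (Q x) + (h *+ k.+1)%:C *: op_words T Q k.+1 l (Q x).
  by rewrite [h *+ k.+2]mulrS rmorphD scalerDl.
rewrite !opprD !addrA; rewrite [LHS](ACl (1*4*6*2*7*3*5*8)).
by [].
Qed.

End WordDerivative.

Section TermwiseDerivative.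
Context {R : realType} {H : hilbertType R}.

Lemma sub_telescope (V : zmodType) (x y z w : V) : x - z = x - y - (z - w) + (y - w).
Proof. by rewrite opprB -addrA [(w - z) + _]addrC !subrKA. Qed.

Definition quadratic_remainder (F F' : R -> H -> H) (K : R) :=
  forall t s, 0 <= t <= 1 -> 0 <= s <= 1 ->
    opbnd (F s - F t - (s - t)%:C *: F' t) (K * (s - t) ^+ 2).

(* Subdividing the interval makes the quadratic errors negligible. *)
Lemma lipschitz_of_remainder (F F' : R -> H -> H) K B : 0 <= K ->
  quadratic_remainder F F' K -> (forall t, 0 <= t <= 1 -> opbnd (F' t) B) ->
  forall t s, 0 <= t <= 1 -> 0 <= s <= 1 -> opbnd (F s - F t) (B * `|s - t|).
Proof.
move=> K0 hF hB t s t01 s01; apply: (@opbnd_eps _ _ _ _ _ (K * (s - t) ^+ 2)).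
  by rewrite mulr_ge0// sqr_ge0.
move=> e e0; have [N _ hN] := near_infty_natSinv_lt (PosNum e0).
have {hN} Ne : N.+1%:R^-1 <= e by apply/ltW/(hN N)/leqnn.
pose u i := t + (s - t) * (i%:R / N.+1%:R); pose d := (s - t) / N.+1%:R.
have u01 i : (i <= N.+1)%N -> 0 <= u i <= 1.
  move=> iN; have l0 : 0 <= (i%:R / N.+1%:R : R) by rewrite divr_ge0.
  have l1 : (i%:R / N.+1%:R : R) <= 1 by rewrite ler_pdivrMr// mul1r ler_nat.
  move: t01 s01 => /andP[t0 t1] /andP[s0 s1]; rewrite /u; set l := _ / _ in l0 l1 *.
  have -> : t + (s - t) * l = t * (1 - l) + s * l by ring.
  rewrite addr_ge0 ?mulr_ge0 ?subr_ge0//=.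
  rewrite [leRHS](_ : 1 = 1 * (1 - l) + 1 * l); last by ring.
  by rewrite lerD ?ler_wpM2r ?subr_ge0.
have ud i : u i.+1 - u i = d.
  by rewrite /u /d -natr1 opprD addrACA subrr add0r -mulrBr -mulrBl addrAC subrr add0r mul1r.
have -> : F s - F t = \sum_(0 <= i < N.+1) (F (u i.+1) - F (u i)).
  rewrite telescope_sumr// /u mul0r mulr0 addr0 divff ?pnatr_eq0// mulr1.
  by rewrite [t + _]addrC subrK.
apply: (@opbnd_le _ _ _ _ (\sum_(0 <= i < N.+1) (K * d ^+ 2 + B * `|d|))).
  rewrite big_const_nat subn0 iter_addr_0 -[_ *+ N.+1]mulr_natl mulrDr.
  have e1 : N.+1%:R * (B * `|d|) = B * `|s - t|.
    by rewrite /d normrM normfV (ger0_norm (ler0n _ N.+1)); field; rewrite ?natr1 ?nat1r pnatr_eq0.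
  have e2 : N.+1%:R * (K * d ^+ 2) = K * (s - t) ^+ 2 * N.+1%:R^-1.
    by rewrite /d; field; rewrite ?natr1 ?nat1r pnatr_eq0.
  by rewrite e1 e2 addrC lerD2l ler_wpM2l// mulr_ge0// sqr_ge0.
rewrite big_nat [X in opbnd _ X]big_nat; apply: opbnd_sum => i /andP[_ iN].
rewrite -(subrK ((u i.+1 - u i)%:C *: F' (u i)) (_ - _)); apply: opbndD.
  by rewrite -(ud i); apply: hF; apply: u01 => //; exact: ltnW.
by rewrite ud mulrC -cnR; apply/opbndZ/hB/u01/ltnW.
Qed.

(** The tail estimate refers to the majorant [b] alone, which will not depend on [t]. *)
Lemma op_series (F : nat -> H -> H) (b : nat -> R) C : (forall m, linear (F m)) ->
  (forall m, 0 <= b m) -> (forall m, opbnd (F m) (b m)) ->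
  (forall M, \sum_(0 <= m < M) b m <= C) ->
  exists S, [/\ linear S, opbnd S C & forall e M,
    (forall N, (M <= N)%N -> \sum_(M <= m < N) b m <= e) ->
    opbnd (S - \sum_(0 <= m < M) F m) e].
Proof.
move=> lF b0 bF hC; pose A M := \sum_(0 <= m < M) F m.
have lA M : linear (A M) by apply: linear_sum.
have bA M : opbnd (A M) C by apply: opbnd_le (hC M) _; apply: opbnd_sum.
have C0 : 0 <= C by have := hC 0%N; rewrite big_geq.
have AB M N : (M <= N)%N -> A N - A M = \sum_(M <= m < N) F m.
  by move=> MN; rewrite /A (@big_cat_nat _ _ _ M 0%N N)//= [LHS]addrC addKr.
have bAB M N e : (M <= N)%N -> (forall N, (M <= N)%N -> \sum_(M <= m < N) b m <= e) ->
    opbnd (A N - A M) e.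
  by move=> MN he; rewrite AB//; apply: opbnd_le (he N MN) _; apply: opbnd_sum.
have tail := nneseries_tail b0 (nneseries_lt_pinfty b0 hC).
have [e e0|S [lS bS hS]] := op_cauchy lA bA C0.
  have e2 : 0 < e / 2 by rewrite divr_gt0.
  have [N hN] := tail _ e2; exists N => j k Nj Nk.
  rewrite (splitr e); apply: (@opbnd_tri _ _ _ (A N)); first exact: bAB.
  by apply: opbnd_distC; apply: bAB.
exists S; split=> // e M he; apply: (@opbnd_eps _ _ _ _ _ 2) => // d d0.
have d2 : 0 < d / 2 by rewrite divr_gt0.
have [N1 hN1] := tail _ d2; pose N := maxn N1 M.
have -> : e + 2 * d = 2 * d + e by rewrite addrC.
apply: (@opbnd_tri _ _ _ (A N)); last by apply: bAB => //; exact: leq_maxr.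
apply: (@opbnd_le _ _ _ _ d); first by lra.
apply: (hS d N1) => [j k Nj Nk|]; last exact: leq_maxl.
rewrite (splitr d); apply: (@opbnd_tri _ _ _ (A N1)); first exact: bAB.
by apply: opbnd_distC; apply: bAB.
Qed.

(** The [K m] need not be summable. The head of the series is differentiated with them; the
    increments of its tail are at most [b' m * |s - t|] by [lipschitz_of_remainder]. *)
Lemma op_derivative_series (F F' : nat -> R -> H -> H) (S S' : R -> H -> H)
    (b b' K : nat -> R) C C' :
  (forall m t, 0 <= t <= 1 -> linear (F m t)) ->
  (forall m t, 0 <= t <= 1 -> linear (F' m t)) ->
  (forall t, linear (S t)) -> (forall t, 0 <= t <= 1 -> bounded_op (S' t)) ->
  (forall m, 0 <= b m) -> (forall m, 0 <= b' m) -> (forall m, 0 <= K m) ->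
  (forall m t, 0 <= t <= 1 -> opbnd (F' m t) (b' m)) ->
  (forall M, \sum_(0 <= m < M) b m <= C) -> (forall M, \sum_(0 <= m < M) b' m <= C') ->
  (forall m, quadratic_remainder (F m) (F' m) (K m)) ->
  (forall t e M, 0 <= t <= 1 -> (forall N, (M <= N)%N -> \sum_(M <= m < N) b m <= e) ->
    opbnd (S t - \sum_(0 <= m < M) F m t) e) ->
  (forall t e M, 0 <= t <= 1 -> (forall N, (M <= N)%N -> \sum_(M <= m < N) b' m <= e) ->
    opbnd (S' t - \sum_(0 <= m < M) F' m t) e) ->
  forall t, 0 <= t <= 1 -> op_derivative S t (S' t).
Proof.
move=> lF lF' lS bS' b0 b0' K0 bF' hC hC' rem hS hS' t t01; split; first exact: bS'.
have lS't : linear (S' t) by case: (bS' t t01).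
apply/opcvgP.
  by move=> s; apply: linear_sub => //; apply: linear_scale; apply: linear_sub.
move=> e e0; have e4 : 0 < e / 4 by rewrite divr_gt0.
have [M hM] := nneseries_tail b0' (nneseries_lt_pinfty b0' hC') e4.
pose KM := \sum_(0 <= m < M) K m; have KM0 : 0 <= KM by apply: sumr_ge0.
have KM1 : 0 < KM + 1 by rewrite ltr_wpDl.
have tailF s : 0 <= s <= 1 ->
    opbnd ((S s - S t) - (\sum_(0 <= m < M) F m s - \sum_(0 <= m < M) F m t)) (e / 4 * `|s - t|).
  (* Beyond a further index [N] both series are within [d] of their sums; between [M] and [N] the
     Lipschitz bounds apply, and [d] is arbitrary. *)
  move=> s01; apply: (@opbnd_eps _ _ _ _ _ 2) => // d d0.
  have [N1 hN1] := nneseries_tail b0 (nneseries_lt_pinfty b0 hC) d0.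
  pose N := maxn N1 M; have MN : (M <= N)%N by apply: leq_maxr.
  have tl P : (N <= P)%N -> \sum_(N <= m < P) b m <= d.
    move=> NP; have N1N : (N1 <= N)%N by apply: leq_maxl.
    apply: le_trans (hN1 P (leq_trans N1N NP)).
    by rewrite [leRHS](@big_cat_nat _ _ _ N)//= lerDr sumr_ge0.
  have -> : S s - S t - (\sum_(0 <= m < M) F m s - \sum_(0 <= m < M) F m t) =
      ((S s - \sum_(0 <= m < N) F m s) - (S t - \sum_(0 <= m < N) F m t)) +
      \sum_(M <= m < N) (F m s - F m t).
    rewrite !(@big_cat_nat _ _ _ M 0%N N)//= sumrB !opprD !opprK !addrA.
    set x := S s; set y := S t; set a := \sum_(0 <= m < M) F m s.
    set b1 := \sum_(0 <= m < M) F m t; set c := \sum_(M <= m < N) F m s.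
    set d1 := \sum_(M <= m < N) F m t.
    rewrite [RHS](ACl (1*4*2*5*(3*7)*(6*8))) /= addNr subrr !addr0.
    by rewrite addrAC.
  have -> : e / 4 * `|s - t| + 2 * d = (d + d) + e / 4 * `|s - t| by lra.
  apply: opbndD.
    by apply: opbndB; apply: hS.
  apply: (@opbnd_le _ _ _ _ (\sum_(M <= m < N) (b' m * `|s - t|))).
    by rewrite -mulr_suml ler_wpM2r// hM.
  apply: opbnd_sum => m _; apply: (lipschitz_of_remainder (K0 m) (rem m)) => //.
  by move=> r r01; apply: bF'.
(* Within this radius the quadratic errors of the first [M] terms add up to at most
   [e / 4 * |s - t|]. *)
have r0 : 0 < e / 4 / (KM + 1) by rewrite divr_gt0.
rewrite near_withinE /= /dnbhs near_withinE.
near=> s; move=> st s01'; have {s01'} s01 : 0 <= s <= 1 by move: s01'; rewrite /= in_itv.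
have hs0 : s - t != 0 by rewrite subr_eq0.
have ns0 : 0 < `|s - t| by rewrite normr_gt0.
have hs : `|s - t| < e / 4 / (KM + 1).
  by rewrite distrC; near: s; apply: (@cvgr_dist_lt _ _ _ _ _ id) => //; exact: cvg_id.
have key : opbnd (S s - S t - (s - t)%:C *: S' t) (`|s - t| * e).
  have t2 : opbnd ((s - t)%:C *: (S' t - \sum_(0 <= m < M) F' m t)) (`|s - t| * (e / 4)).
    by rewrite -cnR; apply: opbndZ; apply: hS'.
  have t3 : opbnd (\sum_(0 <= m < M) (F m s - F m t - (s - t)%:C *: F' m t)) (`|s - t| * (e / 4)).
    apply: (@opbnd_le _ _ _ _ (\sum_(0 <= m < M) K m * (s - t) ^+ 2)).
      rewrite -mulr_suml -/KM -(real_normK (num_real _)) expr2 mulrA mulrC ler_wpM2l//.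
      move: hs; rewrite ltr_pdivlMr// => /ltW; apply: le_trans.
      by rewrite mulrC ler_wpM2l// lerDl.
    by apply: opbnd_sum => m _; apply: rem.
  have -> : S s - S t - (s - t)%:C *: S' t =
    ((S s - S t) - (\sum_(0 <= m < M) F m s - \sum_(0 <= m < M) F m t)) -
    (s - t)%:C *: (S' t - \sum_(0 <= m < M) F' m t) +
    \sum_(0 <= m < M) (F m s - F m t - (s - t)%:C *: F' m t).
    rewrite !sumrB -scaler_sumr scalerBr.
    set x := S s - S t; set y := \sum_(0 <= m < M) F m s - _; set z := _ *: S' t; set w := _ *: _.
    exact: sub_telescope.
  apply: opbnd_le (opbndD (opbndB (tailF s s01) t2) t3).
  by rewrite [e / 4 * _]mulrC -!mulrDr ler_wpM2l//; lra.
have -> : (s - t)^-1%:C *: (S s - S t) - S' t =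
    (s - t)^-1%:C *: (S s - S t - (s - t)%:C *: S' t).
  by rewrite [RHS]scalerBr scalerA -rmorphM mulVf// rmorph1 scale1r.
have -> : e = `|(s - t)^-1| * (`|s - t| * e).
  by rewrite mulrA -normrM mulVf// normr1 mul1r.
by rewrite -cnR; apply: opbndZ.
Unshelve. all: by end_near. Qed.

End TermwiseDerivative.

(** * Littlewood-Paley blocks of a Besov function *)

Section CircleIntegral.
Context {R : realType}.
Local Notation C := R[i].

Definition integrable_arc (h : R -> C) : Prop :=
  (arclen (R := R)).-integrable setT (EFin \o (fun x => complex.Re (h x))) /\
  (arclen (R := R)).-integrable setT (EFin \o (fun x => complex.Im (h x))).

Lemma integrable_arcD h g : integrable_arc h -> integrable_arc g ->
  integrable_arc (fun x => h x + g x).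
Proof.
move=> [h1 h2] [g1 g2]; split.
  have := integrableD measurableT h1 g1; congr (_.-integrable _ _).
  by apply/funext => x /=; rewrite -EFinD; case: (h x) (g x) => [a b] [c d].
have := integrableD measurableT h2 g2; congr (_.-integrable _ _).
by apply/funext => x /=; rewrite -EFinD; case: (h x) (g x) => [a b] [c d].
Qed.

Lemma circle_intD h g : integrable_arc h -> integrable_arc g ->
  circle_int (fun x => h x + g x) = circle_int h + circle_int g.
Proof.
move=> [h1 h2] [g1 g2]; rewrite /circle_int.
apply: (congr2 (@Complex R)).
  apply: etrans (RintegralD measurableT h1 g1); congr Rintegral.
  by apply/funext => x; case: (h x) (g x) => [a b] [c d].
apply: etrans (RintegralD measurableT h2 g2); congr Rintegral.
by apply/funext => x; case: (h x) (g x) => [a b] [c d].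
Qed.

Lemma integrable_arc_comb (h : R -> C) (a b : R) : integrable_arc h ->
  (arclen (R := R)).-integrable setT
    (EFin \o (fun x => a * complex.Re (h x) + b * complex.Im (h x))).
Proof.
move=> [h1 h2].
have := integrableD measurableT (integrableZl measurableT a h1) (integrableZl measurableT b h2).
by congr (_.-integrable _ _); apply/funext => x /=; rewrite -!EFinM -EFinD.
Qed.

Lemma Rintegral_comb (h : R -> C) (a b : R) : integrable_arc h ->
  \int[arclen]_x (a * complex.Re (h x) + b * complex.Im (h x)) =
  a * complex.Re (circle_int h) + b * complex.Im (circle_int h).
Proof.
move=> [h1 h2] /=; rewrite RintegralD ?RintegralZl//.
  have := integrableZl measurableT a h1.
  by congr (_.-integrable _ _); apply/funext => x /=; rewrite -EFinM.
have := integrableZl measurableT b h2.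
by congr (_.-integrable _ _); apply/funext => x /=; rewrite -EFinM.
Qed.

Let ReM (u v : C) : complex.Re (u * v) =
  complex.Re u * complex.Re v + (- complex.Im u) * complex.Im v.
Proof. by case: u v => [a b] [c d] /=; rewrite mulNr. Qed.

Let ImM (u v : C) : complex.Im (u * v) =
  complex.Im u * complex.Re v + complex.Re u * complex.Im v.
Proof. by case: u v => [a b] [c d] /=; rewrite addrC. Qed.

Lemma integrable_arcZ a h : integrable_arc h -> integrable_arc (fun x => a * h x).
Proof.
move=> hh; split; [have := integrable_arc_comb (complex.Re a) (- complex.Im a) hh
 | have := integrable_arc_comb (complex.Im a) (complex.Re a) hh];
congr (_.-integrable _ _); apply/funext => x /=; rewrite ?ReM ?ImM//.
Qed.

Lemma circle_intZ a h : integrable_arc h ->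
  circle_int (fun x => a * h x) = a * circle_int h.
Proof.
move=> hh; rewrite [LHS]/circle_int; apply/eqP; rewrite eq_complex /= ReM ImM.
rewrite -!Rintegral_comb//; apply/andP; split; apply/eqP; congr Rintegral; apply/funext => x.
  exact: ReM.
exact: ImM.
Qed.

Lemma integrable_arc0 : integrable_arc (fun=> 0).
Proof. by split; exact: integrable0. Qed.

Lemma circle_int0 : circle_int (fun=> 0 : C) = 0.
Proof. by rewrite /circle_int /Rintegral /= integral0. Qed.

Lemma circle_int_sum N (a : nat -> C) (h : nat -> R -> C) :
  (forall k, integrable_arc (h k)) ->
  integrable_arc (fun x => \sum_(k < N) a k * h k x) /\
  circle_int (fun x => \sum_(k < N) a k * h k x) = \sum_(k < N) a k * circle_int (h k).
Proof.
move=> hh; elim: N => [|N [IH1 IH2]].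
  rewrite big_ord0; have -> : (fun x => \sum_(k < 0) a k * h k x) = fun=> 0.
    by apply/funext => x; rewrite big_ord0.
  by split; [exact: integrable_arc0 | exact: circle_int0].
have -> : (fun x => \sum_(k < N.+1) a k * h k x) =
    fun x => (\sum_(k < N) a k * h k x) + a N * h N x.
  by apply/funext => x; rewrite big_ord_recr.
have hN : integrable_arc (fun x => a N * h N x) by apply: integrable_arcZ.
split; first exact: integrable_arcD.
by rewrite circle_intD// IH2 circle_intZ// big_ord_recr.
Qed.

Lemma expi_exprN (x : R) (k : nat) : expi x ^ (- k%:Z) = (expi (x *+ k))^*.
Proof.
rewrite -exprnN -exprVn expi_mulrn rmorphXn /=; congr (_ ^+ _).
by rewrite -(conj_circle (cn_expi x)).
Qed.

Lemma integrable_arc_expi h (k : nat) : integrable_arc h ->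
  integrable_arc (fun x => h x * expi x ^ (- k%:Z)).
Proof.
have mk (u : R -> R) : continuous u -> (forall x, `|u x| <= 1) ->
    forall g, (arclen (R := R)).-integrable setT (EFin \o g) ->
    (arclen (R := R)).-integrable setT (EFin \o (fun x => u x * g x)).
  move=> cu bu g hg; have bdd : [bounded u x | x in [set: R]].
    by exists 1; split => // M M1 x _ /=; apply: le_trans (bu x) (ltW M1).
  have mu := measurable_realfun.continuous_measurable_fun cu.
  have := @integrableMr _ _ _ (arclen (R := R)) _ measurableT u _ mu bdd hg.
  by congr (_.-integrable _ _); apply/funext => x /=; rewrite EFinM.
have ck : continuous (fun x : R => x *+ k).
  move=> x; have -> : (fun x : R => x *+ k) = (fun x : R => x * k%:R).
    by apply/funext => y; rewrite mulr_natr.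
  by apply: cvgMl; exact: cvg_id.
pose u x := cos (x *+ k) : R; pose v x := sin (x *+ k) : R.
have hu := mk u _ (fun x => cos_max _); have hv := mk v _ (fun x => sin_max _).
have {}hu : forall g, (arclen (R := R)).-integrable setT (EFin \o g) ->
    (arclen (R := R)).-integrable setT (EFin \o (fun x => u x * g x)).
  by apply: hu => x; apply: continuous_comp (ck x) _; exact: continuous_cos.
have {}hv : forall g, (arclen (R := R)).-integrable setT (EFin \o g) ->
    (arclen (R := R)).-integrable setT (EFin \o (fun x => v x * g x)).
  by apply: hv => x; apply: continuous_comp (ck x) _; exact: continuous_sin.
move=> [h1 h2]; split.
  have := integrableD measurableT (hu _ h1) (hv _ h2); congr (_.-integrable _ _).
  apply/funext => x /=; rewrite -EFinD; congr EFin; rewrite expi_exprN ReM /= mulrNN.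
  by rewrite [X in X + _]mulrC [complex.Im _ * _]mulrC.
have := integrableB measurableT (hu _ h2) (hv _ h1); congr (_.-integrable _ _).
apply/funext => x /=; rewrite -EFinB; congr EFin; rewrite expi_exprN ImM /=.
by rewrite [X in X - _]mulrC mulrN [complex.Re _ * _]mulrC.
Qed.

Lemma circle_conv_poly phi N (a : nat -> C) z : integrable_arc (phi \o expi) ->
  circle_conv phi (fun z => \sum_(k < N) a k * z ^+ k) z =
  (\poly_(k < N) (a k * fourier phi k%:Z)).[z].
Proof.
move=> hphi; rewrite /circle_conv.
pose h k x := phi (expi x) * expi x ^ (- k%:Z).
have := circle_int_sum N (fun k => a k * z ^+ k) (fun k => integrable_arc_expi k hphi).
case=> [_ h2]; rewrite horner_poly; apply: etrans (etrans h2 _).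
  congr circle_int; apply/funext => x; rewrite mulr_sumr; apply: eq_bigr => k _ /=.
  rewrite exprMn.
  have -> : Num.conj (expi x) ^+ k = expi x ^ (- k%:Z).
    by rewrite -exprnN -exprVn; congr (_ ^+ _); apply: (conj_circle (cn_expi x)).
  by rewrite [RHS]mulrCA !mulrA.
by apply: eq_bigr => k _; rewrite mulrAC.
Qed.

End CircleIntegral.

(** * Essential suprema of continuous functions on the circle *)

Section EssentialBounds.
Context {R : realType}.
Local Notation cn z := (rnorm (z : R[i]^o)).

Lemma arclen_itv_gt0 (a b : R) : 0 <= a -> a < b -> b <= 2 * pi ->
  (0 < (arclen (R := R)) `[a, b]%classic)%E.
Proof.
move=> a0 ab b2; rewrite /arclen /uniform_prob /=.
rewrite (eq_integral (fun=> ((2 * pi - 0)^-1)%:E)).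
  rewrite integral_cst//= lebesgue_measure_itv/= lte_fin ab -EFinB -EFinM lte_fin.
  by rewrite mulr_gt0// ?subr_gt0// subr0 invr_gt0 pi2_gt0.
move=> x; rewrite inE /= in_itv /= => /andP[ax xb]; rewrite /uniform_pdf.
by rewrite (le_trans a0 ax) (le_trans xb b2).
Qed.

(** An inequality violated at a point fails on an interval around it by continuity, and such an
    interval has positive measure. *)
Lemma arc_ae_le (g : R -> R) (M : \bar R) : continuous g ->
  (\forall x \ae (arclen (R := R)), ((g x)%:E <= M)%E) ->
  forall x, 0 <= x <= 2 * pi -> ((g x)%:E <= M)%E.
Proof.
move=> cg [A [mA A0 sA]] x /andP[x0 x2]; rewrite leNgt; apply/negP => Mg.
have : \forall y \near x, (M < (g y)%:E)%E.
  case: M Mg {sA} => [r|//|] Mg; last by near=> y; rewrite ltNyr.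
  near=> y; rewrite lte_fin; near: y.
  by apply: (cvgr_gt (g x)); [exact: cg | rewrite -lte_fin].
move=> /nbhs_ballP[d /= d0 hd].
suff [a [b [a0 ab b2 hab]]] : exists a b, [/\ 0 <= a, a < b, b <= 2 * pi &
    forall y, a <= y <= b -> `|x - y| < d].
  have := arclen_itv_gt0 a0 ab b2; apply/negP; rewrite -leNgt -[leRHS]A0.
  apply: (@le_measure _ _ _ arclen); rewrite ?inE//.
  move=> y /=; rewrite in_itv /= => /hab yx; apply: sA => /=.
  by apply/negP; rewrite -ltNge; apply: hd.
(* The interval is taken to the right of [x] if [x <= pi] and to the left otherwise; since [e <= 1]
   it stays inside [[0, 2 pi]]. *)
pose e := Num.min (d / 2) 1.
have e0 : 0 < e by rewrite lt_min ltr01 divr_gt0.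
have ed : e < d by rewrite gt_min ltr_pdivrMr// ltr_pMr// ltr1n.
have e1 : e <= 1 by rewrite ge_min lexx orbT.
have p2 := pi_ge2 R.
have [xp|px] := leP x pi.
  exists x, (x + e); split => //; first by rewrite ltrDl.
    by rewrite mulr_natl mulr2n lerD// (le_trans e1)// (le_trans _ p2)// ler1n.
  by move=> y /andP[xy yx]; rewrite distrC ger0_norm ?subr_ge0//; lra.
exists (x - e), x; split => //; first by lra.
  by rewrite ltrBlDr ltrDl.
by move=> y /andP[xy yx]; rewrite ger0_norm ?subr_ge0//; lra.
Unshelve. all: by end_near. Qed.

Lemma circle_expi (z : R[i]) : cn z = 1 -> exists x, 0 <= x <= 2 * pi /\ expi x = z.
Proof.
case: z => a b; rewrite /rnorm normc_def /= => h.
have {h} ab : a ^+ 2 + b ^+ 2 = 1.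
  by rewrite -[LHS]sqr_sqrtr ?h ?expr1n// addr_ge0// sqr_ge0.
have a1 : -1 <= a <= 1.
  by rewrite -ler_norml -(@ler_pXn2r _ 2)// ?nnegrE// real_normK ?num_real// expr1n -ab lerDl sqr_ge0.
have [/andP[c0 c1] c2] := acos_def a1.
have sb : sin (acos a) = `|b|.
  rewrite sin_acos// -sqrtr_sqr; congr Num.sqrt.
  by rewrite -ab addrAC subrr add0r.
have [b0|b0] := leP 0 b.
  exists (acos a); split; first by rewrite c0 (le_trans c1)// mulr_natl mulr2n lerDl pi_ge0.
  by rewrite /expi c2 sb ger0_norm.
exists (2 * pi - acos a); split.
  rewrite subr_ge0 gerBl c0 andbT (le_trans c1)// mulr_natl mulr2n lerDl.
  exact: pi_ge0.
rewrite /expi cosB sinB mulr_natl cos2pi sin2pi; rewrite !(mul1r, mul0r, addr0, add0r, sub0r).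
by rewrite c2 sb ltr0_norm// opprK.
Qed.

Lemma continuous_expi : continuous (expi : R -> R[i]^o).
Proof.
move=> x; apply/cvg_rnorm => e e0.
have e4 : 0 < e / 4 by rewrite divr_gt0.
near=> y.
have -> : expi x - expi y = (cos x - cos y)%:C + 'i * (sin x - sin y)%:C :> R[i].
  by rewrite /expi; simpc.
suff : cn ((cos x - cos y)%:C + 'i * (sin x - sin y)%:C : R[i]) <= e / 4 + e / 4.
  by move=> h; apply: le_lt_trans h _; lra.
apply: le_trans (rnormD _ _) _.
rewrite cnM cn_i mul1r !cnR.
apply: lerD; apply: ltW; near: y.
  by apply: (@cvgr_dist_lt _ _ _ _ _ cos) => //; exact: continuous_cos.
by apply: (@cvgr_dist_lt _ _ _ _ _ sin) => //; exact: continuous_sin.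
Unshelve. all: by end_near. Qed.

Lemma circle_Lnorm_poly (p : {poly R[i]}) z : cn z = 1 ->
  ((cn p.[z])%:E <= circle_Lnorm +oo (fun z => p.[z]))%E.
Proof.
move=> /circle_expi[x [hx <-]]; rewrite /circle_Lnorm unlock.
have -> : (0 < (arclen (R := R)) setT)%E.
  apply: (eq_ind_r (fun u => (0 < u)%E) _ (@probability_setT _ _ _ (arclen (R := R)))).
  by rewrite lte_fin.
move: x hx; apply: arc_ae_le.
  move=> x; apply: (@continuous_comp _ _ _ (expi : R -> R[i]^o) (fun z : R[i]^o => cn p.[z])).
    exact: continuous_expi.
  apply: (@continuous_comp _ _ _ (fun z : R[i]^o => p.[z] : R[i]^o) (fun z => cn z)).
    exact: continuous_poly_fun.
  exact: continuous_cn.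
have := ess_sup_inf.ess_sup_ge (arclen (R := R))
  (abse \o (fun x => (cn p.[expi x])%:E)).
apply: filterS => x /=; apply: le_trans.
by rewrite lee_fin ler_norm.
Qed.

End EssentialBounds.

Section BesovBlocks.
Context {R : realType}.
Variable phi : R[i] -> R[i].
Local Notation cn z := (rnorm (z : R[i]^o)).
Local Notation c k := (fourier phi (Posz k)).

(* [besov_block m] is [phi * W_m]; for [m = 0] because [fourier phi (-1) = 0]. *)
Definition besov_block (m : nat) : {poly R[i]} :=
  if m is j.+1 then
    \poly_(k < (2 ^ j.+2).+1) ((tent (k%:R / 2 ^+ j.+1 : R))%:C * c k)
  else \poly_(k < 2) c k.

Lemma size_besov_block m : (size (besov_block m.+1) <= (2 ^ m.+2).+1)%N.
Proof. exact: size_poly. Qed.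

Lemma besov_block_low m l : (l < 2 ^ m)%N -> (besov_block m.+1)`_l = 0.
Proof.
move=> lm; rewrite coef_poly; case: ifP => // _; rewrite /tent.
have -> : 2^-1 <= (l%:R / 2 ^+ m.+1 : R) = false.
  apply/negbTE; rewrite -ltNge ltr_pdivrMr ?exprn_gt0// exprS mulKf ?pnatr_eq0//.
  by rewrite -natrX ltr_nat.
have -> : 1 <= (l%:R / 2 ^+ m.+1 : R) = false.
  apply/negbTE; rewrite -ltNge ltr_pdivrMr ?exprn_gt0// mul1r -natrX ltr_nat.
  by apply: ltn_trans lm _; rewrite ltn_exp2l.
by rewrite /= mul0r.
Qed.

Lemma besov_block_bound n : besov_plus n%:R +oo%E 1%E phi ->
  exists b : nat -> R,
    [/\ forall m, 0 <= b m,
        forall m z, cn z = 1 -> cn (besov_block m).[z] <= b m &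
        exists S, forall M, \sum_(0 <= m < M) 2 ^+ (m * n) * b m <= S].
Proof.
move=> [[hphi h1 _] _].
pose L m := circle_Lnorm +oo (circle_conv phi (kernelW m)).
have L0 m : (0 <= L m)%E by apply: Lnorm_ge0.
pose u (m : nat) : \bar R := ((2 `^ (m%:R * n%:R))%:E * L m)%E.
have u0 m : (0 <= u m)%E by rewrite mule_ge0// lee_fin powR_ge0.
have us : (\sum_(0 <= m <oo) u m < +oo)%E.
  move: h1; rewrite Lnorm1 ge0_integral_count; last by move=> k; apply: abse_ge0.
  by under eq_eseriesr => k _ do rewrite gee0_abs ?u0//.
have psum M : (\sum_(0 <= m < M) u m <= \sum_(0 <= m <oo) u m)%E.
  exact: nneseries_lim_ge.
have ufin m : (u m < +oo)%E.
  apply: le_lt_trans us; apply: le_trans (psum m.+1); rewrite big_nat_recr//=.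
  by apply: leeDr; apply: sume_ge0.
have w0 m : (0 : R) < 2 `^ (m%:R * n%:R) by rewrite powR_gt0.
have Lfin m : L m \is a fin_num.
  rewrite ge0_fin_numE// ltNge leye_eq; apply/negP => /eqP Ly.
  by have := ufin m; rewrite /u Ly gt0_muley ?lte_fin// ltxx.
(* Block [0] carries two coefficients only and is bounded by their moduli; the other bounds are the
   Besov norms of the blocks. *)
pose b m := if m is 0 then cn (c 0) + cn (c 1) else fine (L m).
have b0 m : 0 <= b m by case: m => [|m] /=; rewrite ?addr_ge0 ?rnorm_ge0// fine_ge0.
exists b; split => //.
  case=> [|m] z z1.
    rewrite /besov_block horner_poly big_ord_recr/= big_ord1 expr0 mulr1 expr1.
    by apply: le_trans (rnormD _ _) _; rewrite cnM z1 mulr1.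
  rewrite -lee_fin /= fineK//.
  have -> : L m.+1 = circle_Lnorm +oo (fun z => (besov_block m.+1).[z]).
    by congr circle_Lnorm; apply/funext => y; rewrite [RHS]/= -circle_conv_poly.
  exact: circle_Lnorm_poly.
exists (b 0%N + fine (\sum_(0 <= m <oo) u m)%E) => M.
have ufinE m : u m \is a fin_num by rewrite ge0_fin_numE.
apply: (@le_trans _ _ (b 0%N + \sum_(0 <= m < M) fine (u m))); last first.
  rewrite lerD2l -lee_fin fineK; last by rewrite ge0_fin_numE// nneseries_ge0.
  by rewrite -sumEFin; under eq_bigr => m _ do rewrite fineK//.
have fu m : fine (u m) = 2 ^+ (m * n) * fine (L m).
  by rewrite /u -[L m]fineK// -EFinM /= -natrM powR_mulrn.
elim: M => [|M IH]; first by rewrite !big_geq// addr0.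
case: M IH => [|M] IH.
  rewrite !big_nat1 mul0n expr0 mul1r lerDl fine_ge0//.
rewrite big_nat_recr//= [\sum_(0 <= m < M.+2) fine _]big_nat_recr//= addrA.
by apply: lerD => //; rewrite fu.
Qed.

Lemma coef_bound (p : {poly R[i]}) B k : (forall z, cn z = 1 -> cn p.[z] <= B) ->
  cn p`_k <= B.
Proof.
move=> pB; pose M := maxn (size p) k.+1.
have kM : (k < M)%N by rewrite leq_maxr.
have sM : (size p <= k + M)%N by apply: leq_trans (leq_maxl _ _) (leq_addl _ _).
rewrite -(root_avg_coef (leq_ltn_trans (leq0n k) kM) sM kM).
apply: le_trans (@root_avg_le _ _ _ (fun=> B) (leq_ltn_trans (leq0n k) kM) _) _.
  by move=> w w1; rewrite cnM cnV cnX w1 expr1n invr1 mulr1 pB.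
by rewrite root_avg_cst ?(leq_ltn_trans (leq0n k) kM).
Qed.

Let theta (x : R) : R := if x <= 1 then 1 else if x <= 2 then 2 - x else 0.

Let theta_half (x : R) : 0 <= x -> theta (x / 2) = theta x + tent (x / 2).
Proof.
rewrite /theta /tent => x0; set y := x / 2; have -> : x = y * 2 by rewrite /y; lra.
by do ![case: ifPn]; lra.
Qed.

Lemma besov_block_coef m k : (besov_block m.+1)`_k = (tent (k%:R / 2 ^+ m.+1 : R))%:C * c k.
Proof.
rewrite coef_poly; case: ltnP => // hk; rewrite /tent.
have h2 : 2 < k%:R / 2 ^+ m.+1 :> R.
  by rewrite ltr_pdivlMr ?exprn_gt0// -exprS -natrX ltr_nat.
by do ![case: ifPn => ?]; rewrite ?mul0r//; exfalso; lra.
Qed.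

(* The tents telescope: [theta] is their partial sum. *)
Let besov_block_psum M k :
  (\sum_(0 <= m < M.+1) besov_block m)`_k = (theta (k%:R / 2 ^+ M))%:C * c k.
Proof.
elim: M => [|M IH].
  rewrite big_nat1 coef_poly expr0 divr1 /theta.
  case: k => [|[|k]] /=; rewrite ?ler01 ?lexx ?mul1r//.
  rewrite -[k.+2%:R]natr1 -[k.+1%:R]natr1.
  have : (0 : R) <= k%:R by [].
  by do ![case: ifPn => ?] => ?; rewrite ?mul0r//; try (exfalso; lra);
    (have -> : 2 - (k%:R + 1 + 1) = 0 :> R by lra); rewrite mul0r.
rewrite big_nat_recr//= coefD IH besov_block_coef -mulrDl -rmorphD /=.
by rewrite exprSr invfM mulrA theta_half ?divr_ge0 ?exprn_ge0.
Qed.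

Lemma besov_block_sum M k : (k <= 2 ^ M)%N ->
  (\sum_(0 <= m < M.+1) besov_block m)`_k = c k.
Proof.
move=> kM; rewrite besov_block_psum /theta.
by rewrite ler_pdivrMr ?exprn_gt0// mul1r -natrX ler_nat kM mul1r.
Qed.

Lemma size_besov_sum M : (size (\sum_(0 <= m < M.+1) besov_block m)%R <= (2 ^ M.+1).+1)%N.
Proof.
apply: (leq_trans (size_sum _ _ _)); rewrite big_mkord; apply/bigmax_leqP => -[[|m] /= mM] _.
  by apply: leq_trans (size_poly _ _) _; rewrite ltnS expnS muln_gt0 expn_gt0.
apply: leq_trans (size_besov_block _) _; rewrite ltnS leq_exp2l//.
Qed.

(** A truncated block is bounded crudely by its number of coefficients; the factor of order [2 ^ m]
    is affordable when [n >= 1]. *)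
Lemma coef_sum_bound (p : {poly R[i]}) B D N z : (forall z, cn z = 1 -> cn p.[z] <= B) ->
  (size p <= D)%N -> cn z <= 1 -> cn (\sum_(k < N) p`_k * z ^+ k) <= D%:R * B.
Proof.
move=> pB pD z1.
have B0 : 0 <= B by apply: le_trans (rnorm_ge0 _) (pB 1 _); exact: cn1.
apply: (@le_trans _ _ (\sum_(k < N) (k < D)%:R * B)).
  apply: le_trans (rnorm_sum _ _ _) _; apply: ler_sum => k _.
  rewrite cnM cnX; case: ltnP => kD.
    rewrite mul1r; apply: le_trans (coef_bound k pB).
    by rewrite ler_piMr ?rnorm_ge0// exprn_ile1 ?rnorm_ge0.
  by rewrite nth_default ?(leq_trans pD)// rnorm0 !mul0r.
rewrite -mulr_suml ler_wpM2r// -natr_sum ler_nat.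
elim: N => [|N IH]; rewrite ?big_ord0// big_ord_recr/=.
case: ltnP => ND; last by rewrite addn0.
by apply: leq_trans ND; rewrite addn1 ltnS -[leqRHS]muln1 -[X in
  (_ <= X * _)%N](card_ord N) -sum_nat_const leq_sum// => i _; case: (_ < _)%N.
Qed.

(** [analytic_ext] is a limit of partial Fourier sums, which cut through blocks, so truncated blocks
    have to be summed uniformly as well. *)
Lemma analytic_ext_cvg n b : (1 <= n)%N -> (forall m, 0 <= b m) ->
  (forall m z, cn z = 1 -> cn (besov_block m).[z] <= b m) ->
  (exists S, forall M, \sum_(0 <= m < M) 2 ^+ (m * n) * b m <= S) ->
  forall e, 0 < e -> exists M0, forall M, (M0 <= M)%N -> forall z, cn z <= 1 ->
  cn (analytic_ext phi z - (\sum_(0 <= m < M) besov_block m).[z]) <= e.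
Proof.
move=> n1 b0 hb [S hS].
have key : forall e, 0 < e -> exists M0, forall M z, (M0 <= M)%N -> cn z <= 1 ->
    forall N, ((2 ^ M.+1).+1 <= N)%N ->
    cn (\sum_(k < N) c k * z ^+ k - (\sum_(0 <= m < M.+1) besov_block m).[z]) <= e.
  move=> e e0.
have u0 m : 0 <= 2 ^+ (m * n) * b m by rewrite mulr_ge0// exprn_ge0.
have e3 : 0 < e / 3 by rewrite divr_gt0.
have [M0 hM0] := nneseries_tail u0 (nneseries_lt_pinfty u0 hS) e3.
exists M0 => M z.
  (* With [N <= 2 ^ M'] the blocks up to [M'] reproduce all coefficients below [N]. *)
  move=> MM z1 N hN; pose M' := maxn M N.
  have -> : \sum_(k < N) c k * z ^+ k - (\sum_(0 <= m < M.+1) besov_block m).[z] =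
      \sum_(M.+1 <= m < M'.+1) \sum_(k < N) (besov_block m)`_k * z ^+ k.
    rewrite exchange_big /=.
    rewrite (@horner_coef_wide _ N); last exact: leq_trans (size_besov_sum M) hN.
    rewrite -sumrB; apply: eq_bigr => k _; rewrite -mulr_suml -mulrBl; congr (_ * _).
    have kM : (k <= 2 ^ M')%N.
      apply: leq_trans (ltnW (ltn_ord k)) _; apply: leq_trans (leq_maxr M N) _.
      exact: ltnW (ltn_expl _ _).
    rewrite -(besov_block_sum kM) (@big_cat_nat _ _ _ M.+1 0 M'.+1)//=; last first.
      by rewrite ltnS leq_maxl.
    by rewrite coefD addrAC subrr add0r coef_sum.
  apply: le_trans (rnorm_sum _ _ _) _.
  (* Block [m.+1] has at most [2 ^ m.+2 + 1 <= 3 * 2 ^ m.+1] coefficients, and [n >= 1] turns this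
     into [3 * 2 ^ (m.+1 * n)]. *)
  apply: (@le_trans _ _ (\sum_(M.+1 <= m < M'.+1) 3 * (2 ^+ (m * n) * b m))).
    rewrite big_nat_cond [leRHS]big_nat_cond; apply: ler_sum => -[//|m] /andP[_ _].
    apply: le_trans (coef_sum_bound _ (hb _) (size_besov_block _) z1) _.
    rewrite mulrA ler_wpM2r//.
    apply: (@le_trans _ _ (3 * 2 ^+ m.+1)).
      rewrite -natrX -natrM ler_nat [(2 ^ m.+2)%N]expnS.
      by have := expn_gt0 2 m.+1; lia.
    by rewrite ler_wpM2l// ler_weXn2l ?ler1n// leq_pmulr.
  rewrite -mulr_sumr; have -> : e = 3 * (e / 3) by lra.
  rewrite ler_wpM2l//.
  apply: le_trans (hM0 M'.+1 _); last first.
    by apply: leq_trans MM _; apply: leq_trans (leq_maxl M N) _; exact: leqnSn.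
  have -> : \sum_(M0 <= m < M'.+1) 2 ^+ (m * n) * b m =
     \sum_(M0 <= m < M.+1) 2 ^+ (m * n) * b m + \sum_(M.+1 <= m < M'.+1) 2 ^+ (m * n) * b m.
    by rewrite -big_cat_nat//= ?ltnS ?leq_maxl//; apply: leqW.
  by rewrite lerDr sumr_ge0.
have cv z : cn z <= 1 ->
    (\sum_(k < N) c k * z ^+ k : R[i]^o) @[N --> \oo] --> (analytic_ext phi z : R[i]^o).
  move=> z1; have [|l hl] := @complex_cauchy _ (fun N => \sum_(k < N) c k * z ^+ k).
    move=> e e0; have e2 : 0 < e / 2 by rewrite divr_gt0.
    have [M0 hM0] := key _ e2; exists (2 ^ M0.+1).+1 => j k hj hk.
    apply: le_trans (rnorm_triB ((\sum_(0 <= m < M0.+1) besov_block m).[z] : R[i]^o) _ _) _.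
    have -> : e = e / 2 + e / 2 by lra.
    by apply: lerD; [|rewrite rnormB]; apply: hM0.
  by rewrite /analytic_ext (cvg_lim (@norm_hausdorff _ R[i]^o) hl).
move=> e e0; have [M0 hM0] := key _ e0.
exists M0.+1 => -[//|M]; rewrite ltnS => MM z z1.
exact: cvg_rnorm_le (cv z z1) (hM0 M z MM z1).
Qed.

End BesovBlocks.

(** * Divided differences on the torus *)

Section TorusDensity.
Context {R : realType}.
Local Notation cn z := (rnorm (z : R[i]^o)).

(* Rotating the [j]-th point by [w ^ j], with [w] close to [1], separates the points:
   for each pair there is at most one bad [w] among the [expi (1 / k)]. *)
Lemma torus_separate n (l : 'rV[R[i]^o]_n.+1) : torus l ->
  ProperFilter (within (@torus R n.+1 `&` @distinct_points R n.+1) (nbhs l)).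
Proof.
move=> tl; apply: within_nbhs_proper => U /nbhs_ballP[e /= e0 he].
pose w k : R[i] := expi (k.+1%:R^-1 : R).
have w1 k : cn (w k) = 1 by apply: cn_expi.
have nz (u : R[i]) : cn u = 1 -> u != 0.
  by move=> u1; apply/eqP => u0; move: u1; rewrite u0 rnorm0 => /esym/eqP; rewrite oner_eq0.
have w0 k : w k != 0 by apply: nz.
have l1 j : cn (l 0 j) = 1 by apply/circleE; exact: tl.
have l0 j : l 0 j != 0 by apply: nz.
(* For [k >= n] the angle [d / k.+1] is at most [1], so the quotient of the two powers has an angle
   strictly between [0] and [2 pi]. *)
have wpow d k k' : (0 < d)%N -> (d <= n)%N -> (n <= k)%N -> (k < k')%N ->
    w k ^+ d != w k' ^+ d.
  move=> d0 dn nk kk; apply/eqP => E.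
  have : expi ((k.+1%:R^-1 - k'.+1%:R^-1 : R) *+ d) = 1.
    rewrite expi_mulrn expiD exprMn E -exprMn.
    by rewrite -expiD subrr expi0 expr1n.
  apply/eqP; apply: expi_neq1; apply/andP; split.
    by rewrite pmulrn_rgt0// subr_gt0 ltf_pV2 ?posrE// ltr_nat.
  apply: (@lt_le_trans _ _ 1).
    apply: (@lt_le_trans _ _ (k.+1%:R^-1 *+ d)).
      by rewrite ltrMn2r d0 /= ltrBlDr ltrDl invr_gt0.
    rewrite -[_ *+ d]mulr_natl ler_pdivrMr// mul1r ler_nat.
    by apply: leq_trans dn _; apply: leqW.
  by have := pi_ge2 R; lra.
have sep (ij : 'I_n.+1 * 'I_n.+1) : \forall k \near \oo, (ij.1 < ij.2)%N ->
    l 0 ij.1 * w k ^+ ij.1 != l 0 ij.2 * w k ^+ ij.2.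
  case: ij => i j /=; case: ltnP => ij; last by near=> k.
  have dn : (j - i <= n)%N by rewrite (leq_trans (leq_subr _ _))// -ltnS.
  have red k : l 0 i * w k ^+ i = l 0 j * w k ^+ j -> w k ^+ (j - i) = l 0 i / l 0 j.
    rewrite -{1}(subnK (ltnW ij)) exprD mulrA => /(mulIf (expf_neq0 i (w0 k))) ->.
    by rewrite mulrC mulKf// .
  have [[k0 [nk0 /red hk0]]|no] := pselect (exists k0, (n <= k0)%N /\
      l 0 i * w k0 ^+ i = l 0 j * w k0 ^+ j).
    exists k0.+1 => // k /= kk _; apply/eqP => /red hk.
    have := wpow (j - i)%N k0 k; rewrite subn_gt0 => /(_ ij dn nk0 kk) /negP; apply.
    by rewrite hk hk0.
  by exists n => // k /= nk _; apply/eqP => E; apply: no; exists k.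
have cw : (w k : R[i]^o) @[k --> \oo] --> (1 : R[i]^o).
  rewrite -expi0; apply: (@cvg_comp _ _ _ (fun k => k.+1%:R^-1 : R) (expi : R -> R[i]^o)).
    exact: cvg_harmonic.
  exact: continuous_expi.
have near_l (j : 'I_n.+1) : \forall k \near \oo, `|l 0 j - l 0 j * w k ^+ j| < e.
  have := cvg_comp (fun k => w k : R[i]^o) _ cw (@continuous_poly_fun _ ((l 0 j)%:P * 'X^j) 1).
  move=> /cvgrPdist_lt/(_ e e0); apply: filterS => k /=.
  by rewrite !hornerM !hornerC !hornerXn expr1n mulr1.
near \oo => k.
have nl : forall j, `|l 0 j - l 0 j * w k ^+ j| < e.
  by near: k; apply: filter_forall.
have ns : forall ij : 'I_n.+1 * 'I_n.+1, (ij.1 < ij.2)%N ->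
    l 0 ij.1 * w k ^+ ij.1 != l 0 ij.2 * w k ^+ ij.2.
  by near: k; apply: filter_forall.
exists (\row_j (l 0 j * w k ^+ j)); split.
  split=> [j|j j' /=].
    by rewrite mxE; apply/circleE; rewrite cnM l1 cnX w1 expr1n mul1r.
  rewrite !mxE => E; apply: val_inj; case: (ltngtP (val j) (val j')) => // jj.
    by have /eqP := ns (j, j') jj.
  by have /eqP := ns (j', j) jj; case.
by apply: he; split => // i j; rewrite ord1 mxE /ball /= nl.
Unshelve. all: by end_near. Qed.

End TorusDensity.

Section DividedDifferenceSeries.
Context {R : realType}.
Local Notation cn z := (rnorm (z : R[i]^o)).

Lemma divdiff_cvg (f : R[i] -> R[i]) (g : nat -> R[i] -> R[i]) k z :
  (forall i, (g m (z i) : R[i]^o) @[m --> \oo] --> (f (z i) : R[i]^o)) ->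
  (divdiff (g m) k z : R[i]^o) @[m --> \oo] --> (divdiff f k z : R[i]^o).
Proof.
elim: k z => [|k IH] z hz; first exact: hz.
have h1 := IH z hz.
have h2 := IH (fun i => if i == k then z k.+1 else z i)
  (fun i => match i == k as b return
     (g m (if b then z k.+1 else z i) : R[i]^o) @[m --> \oo] -->
     (f (if b then z k.+1 else z i) : R[i]^o) with true => hz _ | false => hz _ end).
exact: cvgM (cvgB h1 h2) (cvg_cst _).
Qed.

Lemma scalar_eval_bnd z (s : seq {poly R[i]}) : (forall i, cn (z i) = 1) ->
  cn (scalar_eval z s) <= tensor_cost s.
Proof.
move=> z1; elim: s => [|f s IH]; first by rewrite /= /tensor_cost big_nil cn1.
rewrite tensor_cost_cons [poly_norm f * _]mulrC [scalar_eval _ _]/= cnM.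
by apply: ler_pM; rewrite ?rnorm_ge0// cn_poly_norm.
Qed.

Lemma continuous_scalar_eval n (s : seq {poly R[i]}) :
  continuous (fun l : 'rV[R[i]^o]_n.+1 => scalar_eval (fun i => l 0 (inord i)) s).
Proof.
elim: s => [|f s IH] l; first exact: cst_continuous.
have h1 := IH l.
have h2 : {for l, continuous (fun l : 'rV[R[i]^o]_n.+1 => f.[l 0 (inord (size s))] : R[i]^o)}.
  apply: (@continuous_comp _ _ _ (fun l : 'rV[R[i]^o]_n.+1 => l 0 (inord (size s)))
    (fun w : R[i]^o => f.[w] : R[i]^o)); first exact: coord_continuous.
  exact: continuous_poly_fun.
exact: cvgM h1 h2.
Qed.

Lemma continuous_scalar_evals n (L : seq (seq {poly R[i]})) :
  continuous (fun l : 'rV[R[i]^o]_n.+1 =>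
    \sum_(s <- L) scalar_eval (fun i => l 0 (inord i)) s).
Proof.
elim: L => [|s L IH] l.
  have -> : (fun l : 'rV[R[i]^o]_n.+1 =>
      \sum_(s <- [::]) scalar_eval (fun i => l 0 (inord i)) s) = cst 0.
    by apply/funext => l'; rewrite big_nil.
  exact: cst_continuous.
have -> : (fun l : 'rV[R[i]^o]_n.+1 =>
    \sum_(s' <- s :: L) scalar_eval (fun i => l 0 (inord i)) s') =
    (fun l => scalar_eval (fun i => l 0 (inord i)) s +
      \sum_(s <- L) scalar_eval (fun i => l 0 (inord i)) s).
  by apply/funext => l'; rewrite big_cons.
have h1 := @continuous_scalar_eval n s l; have h2 := IH l.
exact: cvgD h1 h2.
Qed.

(* The tensor series converges uniformly on the torus, so its sum is the continuous
   extension of the divided difference. *)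
Lemma divided_difference_series n (f : R[i] -> R[i]) (p : nat -> {poly R[i]}) L K :
  (forall e, 0 < e -> exists M0, forall M, (M0 <= M)%N -> forall z, cn z <= 1 ->
    cn (f z - (\sum_(0 <= m < M) p m).[z]) <= e) ->
  (forall m, represents n (p m) (L m)) ->
  (forall M, \sum_(0 <= m < M) \sum_(s <- L m) tensor_cost s <= K) ->
  forall l, torus l ->
  (\sum_(0 <= m < M) \sum_(s <- L m) scalar_eval (fun i => l 0 (inord i)) s : R[i]^o)
    @[M --> \oo] --> (divided_difference f (n := n) l : R[i]^o).
Proof.
move=> hf hL hK.
pose g m (z : nat -> R[i]) : R[i] := \sum_(s <- L m) scalar_eval z s.
pose u m := \sum_(s <- L m) tensor_cost s.
have u0 m : 0 <= u m by apply: sumr_ge0 => s _; apply: tensor_cost_ge0.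
have tail := nneseries_tail u0 (nneseries_lt_pinfty u0 hK).
pose G M z := \sum_(0 <= m < M) g m z.
have gu m z : (forall i, cn (z i) = 1) -> cn (g m z) <= u m.
  move=> z1; apply: le_trans (rnorm_sum _ _ _) _; apply: ler_sum => s _.
  exact: scalar_eval_bnd.
have GB e : 0 < e -> exists N1, forall N z, (N1 <= N)%N -> (forall i, cn (z i) = 1) ->
    cn (G N z - G N1 z) <= e.
  move=> /tail[N1 h]; exists N1 => N z N1N z1.
  rewrite /G (@big_cat_nat _ _ _ N1)//= addrAC subrr add0r.
  apply: le_trans (h N N1N); apply: le_trans (rnorm_sum _ _ _) _.
  by apply: ler_sum => m _; apply: gu.
have cv z : (forall i, cn (z i) = 1) -> exists l : R[i],
    (G M z : R[i]^o) @[M --> \oo] --> (l : R[i]^o).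
  move=> z1; apply: complex_cauchy => e e0; have e2 : 0 < e / 2 by rewrite divr_gt0.
  have [N1 h] := GB _ e2; exists N1 => j k hj hk.
  apply: le_trans (rnorm_triB (G N1 z : R[i]^o) _ _) _.
  have -> : e = e / 2 + e / 2 by lra.
  by apply: lerD; [|rewrite rnormB]; apply: h.
have [S hS] : exists S : (nat -> R[i]) -> R[i], forall z, (forall i, cn (z i) = 1) ->
    (G M z : R[i]^o) @[M --> \oo] --> (S z : R[i]^o).
  have : forall z, exists l : R[i], (forall i, cn (z i) = 1) ->
      (G M z : R[i]^o) @[M --> \oo] --> (l : R[i]^o).
    move=> z; have [/cv[l hl]|h] := pselect (forall i, cn (z i) = 1); first by exists l.
    by exists 0.
  by move=> /choice[S hS]; exists S.
have SG e : 0 < e -> exists N1, forall z, (forall i, cn (z i) = 1) ->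
    cn (S z - G N1 z) <= e.
  move=> e0; have [N1 h] := GB _ e0; exists N1 => z z1.
  by apply: (cvg_rnorm_le (hS z z1) (N := N1)) => k hk; apply: h.
pose pt (l : 'rV[R[i]^o]_n.+1) i := l 0 (inord i).
have tpt l : torus l -> forall i, cn (pt l i) = 1.
  by move=> tl i; apply/circleE; apply: tl.
(* At distinct points the partial tensor sums are exactly the divided differences of the partial
   sums of blocks. *)
have divS l : torus l -> distinct_points l -> divdiff f n (pt l) = S (pt l).
  move=> tl dl; have h1 := hS _ (tpt l tl).
  have h2 : (divdiff (fun z => (\sum_(0 <= m < M) p m).[z]) n (pt l) : R[i]^o)
      @[M --> \oo] --> (divdiff f n (pt l) : R[i]^o).
    apply: divdiff_cvg => i; apply/cvg_rnorm_seq => e e0.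
    have e2 : 0 < e / 2 by rewrite divr_gt0.
    have [M0 hM0] := hf _ e2; exists M0 => M MM; apply: le_lt_trans (hM0 M MM _ _) _.
      by rewrite (tpt l tl).
    by rewrite ltr_pdivrMr// ltr_pMr// ltr1n.
  apply: (@cvg_unique _ (@norm_hausdorff _ R[i]^o) _ _ _ _ h2); apply: cvg_trans h1.
  apply: near_eq_cvg; near=> M.
  set N := maxn (\max_(m < M) size (p m)) (size (\sum_(0 <= m < M) p m)).
  rewrite (@divdiff_poly _ _ _ _ N) ?leq_maxr//; last first.
    move=> i j ik jk /dl /(congr1 val) /=.
    by rewrite !inordK.
  rewrite /G [RHS](eq_bigr (fun l0 : 'I_N => \sum_(0 <= m < M) (p m)`_l0 * scalar_words (pt l) n l0)).
    rewrite exchange_big /=; rewrite !big_mkord; apply: eq_bigr => m _.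
    rewrite /g; have [_ _ ->] := hL m.
    have sN : (size (p m) <= N)%N.
      by apply: leq_trans (leq_maxl _ _); apply: (leq_bigmax m).
    rewrite (big_ord_widen_cond N xpredT (fun l0 => (p m)`_l0 * scalar_words (pt l) n l0))//.
    rewrite [RHS](bigID (fun l0 : 'I_N => (l0 < size (p m))%N)) /=.
    rewrite [X in _ = _ + X]big1 ?addr0// => l0; rewrite -leqNgt => hl.
    by rewrite nth_default// mul0r.
  by move=> l0 _; rewrite coef_sum mulr_suml.
move=> l tl; have PF := torus_separate tl.
suff -> : divided_difference f (n := n) l = S (pt l) by exact: hS (tpt l tl).
apply: (@cvg_lim _ (@norm_hausdorff _ R[i]^o)).
apply/(@cvg_rnorm R R[i]^o _ (within (@torus R n.+1 `&` @distinct_points R n.+1) (nbhs l))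
  _ (fun l' => divdiff f n (pt l'))) => e e0.
have e4 : 0 < e / 4 by rewrite divr_gt0.
have [N1 h] := SG _ e4.
have cG : \forall l' \near l, cn (G N1 (pt l) - G N1 (pt l')) < e / 4.
  (* The first [N1] lists are joined into one, whose finite sum is continuous. *)
  have hh := @continuous_scalar_evals n (flatten [seq L m | m <- iota 0 N1]) l.
  move/cvg_rnorm: hh => /(_ _ e4).
  apply: filterS => l' /=.
  suff E (l0 : 'rV[R[i]^o]_n.+1) : \sum_(s <- flatten [seq L m | m <- iota 0 N1])
     scalar_eval (fun i => l0 0 (inord i)) s = G N1 (pt l0) by rewrite !E.
  by rewrite big_flatten big_map /G /index_iota subn0.
rewrite near_withinE; apply: filterS cG => l' hl' [tl' dl'].
rewrite [divdiff _ _ _](divS l' tl' dl').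
apply: le_lt_trans (rnorm_triB (G N1 (pt l) : R[i]^o) _ _) _.
apply: (@le_lt_trans _ _ (e / 4 + (e / 4 + e / 4))); last by lra.
apply: lerD; first exact: h (tpt l tl).
apply: le_trans (rnorm_triB (G N1 (pt l') : R[i]^o) _ _) _.
apply: lerD; first exact: ltW.
by rewrite rnormB; apply: h (tpt l' tl').
Unshelve. all: by end_near. Qed.

End DividedDifferenceSeries.

(** * The derivatives of the calculus *)

Section WordPolynomials.
Context {R : realType} {H : hilbertType R}.
Local Notation cn z := (rnorm (z : R[i]^o)).
Implicit Types (T Q : H -> H).

Lemma op_eval_bnd T Q E q (f : {poly R[i]}) s : semispectral_measure_of T E -> 0 <= q ->
  opbnd Q q -> opbnd (op_eval T Q (f :: s)) (tensor_cost (f :: s) * q ^+ size s).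
Proof.
move=> hE q0 bQ.
have bf g : opbnd (poly_op g T) (poly_norm g).
  by apply: (von_Neumann hE) => z z1; apply: cn_poly_norm.
elim: s f => [|g s IH] f.
  by rewrite /= expr0 mulr1 /tensor_cost big_seq1; apply: bf.
rewrite tensor_cost_cons; have := IH g; set c := tensor_cost _ => bs.
have c0 : 0 <= c * q ^+ size s by rewrite mulr_ge0 ?exprn_ge0 ?tensor_cost_ge0.
rewrite [X in opbnd _ X](_ : _ = (c * q ^+ size s * q) * poly_norm f); last first.
  by rewrite [size _]/= exprSr [poly_norm f * c]mulrC mulrAC !mulrA.
change (opbnd ((op_eval T Q (g :: s) \o Q) \o poly_op f T) (c * q ^+ size s * q * poly_norm f)).
exact: opbnd_comp (mulr_ge0 c0 q0) (bf f) (opbnd_comp c0 bQ bs).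
Qed.

Lemma op_deriv_linear T Q k p : linear T -> linear Q -> linear (op_deriv T Q k p).
Proof.
move=> lT lQ; apply: linear_sum => l _; apply: linear_scale; exact: op_words_linear.
Qed.

(** Here the tensor lists pay off: every factor is bounded by von Neumann's inequality, so only the
    cost of the list remains. *)
Lemma op_deriv_bnd T Q E q k p L : linear T -> linear Q -> semispectral_measure_of T E ->
  0 <= q -> opbnd Q q -> represents k p L ->
  opbnd (op_deriv T Q k p) ((\sum_(s <- L) tensor_cost s) * q ^+ k).
Proof.
move=> lT lQ hE q0 bQ [/allP sL <- _]//; rewrite mulr_suml big_seq [X in opbnd _ X]big_seq.
apply: opbnd_sum => s /sL; case: s => [//|f s]; rewrite eqSS => /eqP <-.
exact: op_eval_bnd hE _ _.
Qed.

Lemma op_deriv_remainder q k (p : {poly R[i]}) : 0 <= q -> exists K, 0 <= K /\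
  forall T Q (h : R), linear T -> linear Q -> opbnd T 1 -> opbnd (T + h%:C *: Q) 1 ->
  opbnd Q q -> `|h| <= 1 ->
  opbnd (op_deriv (T + h%:C *: Q) Q k p - op_deriv T Q k p -
    (h *+ k.+1)%:C *: op_deriv T Q k.+1 p) (K * h ^+ 2).
Proof.
move=> q0; have /choice[K hK] l := @op_words_remainder R H q k l q0.
exists (\sum_(l < size p) cn p`_l * K l); split.
  by apply: sumr_ge0 => l _; rewrite mulr_ge0 ?rnorm_ge0//; case: (hK l).
move=> T Q h lT lQ bT bT' bQ h1.
rewrite /op_deriv scaler_sumr -!sumrB mulr_suml; apply: opbnd_sum => l _.
rewrite scalerA [_ * p`_l]mulrC -scalerA -!scalerBr -mulrA.
by apply: opbndZ; apply: (hK l).2.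
Qed.

End WordPolynomials.

Section InterleavedWords.
Context {R : realType} {H : hilbertType R}.

Lemma scalar_eval_prod (z : nat -> R[i]) (s : seq {poly R[i]}) :
  scalar_eval z s = \prod_(j < size s) (nth 0 s (size s - j.+1)).[z j].
Proof.
elim: s => [|f s IH]; first by rewrite big_ord0.
rewrite [LHS]/= IH [size _]/= big_ord_recr /= subnn; congr (_ * _).
by apply: eq_bigr => j _; rewrite subSn.
Qed.

Lemma tensor_cost_prod n (s : seq {poly R[i]}) : size s = n.+1 ->
  tensor_cost s = \prod_(j < n.+1) poly_norm (nth 0 s (n - j)).
Proof.
move=> sn; rewrite /tensor_cost (big_nth 0) sn big_mkord (reindex_inj rev_ord_inj) /=.
by apply: eq_bigr => j _; rewrite subSS.
Qed.

(** [interleave] unfolds from the left, whereas lists have their head at the right end of the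
    product. *)
Lemma interleave_recr n (A : 'I_n.+2 -> H -> H) (Q : H -> H) :
  interleave A (fun=> Q) =
  (interleave (fun j => A (widen_ord (leqnSn _) j)) (fun=> Q) \o Q) \o A ord_max.
Proof.
elim: n A => [|n IH] A.
  rewrite interleaveS !interleave0; congr (_ \o _); last by congr A; apply: val_inj.
  by congr (_ \o _); congr A; apply: val_inj.
rewrite interleaveS IH [in RHS]interleaveS.
rewrite (_ : widen_ord (leqnSn n.+2) ord0 = ord0); last exact: val_inj.
rewrite (_ : lift ord0 ord_max = ord_max); last exact: val_inj.
rewrite (_ : (fun j => A (lift ord0 (widen_ord (leqnSn n.+1) j))) =
  (fun j => A (widen_ord (leqnSn n.+2) (lift ord0 j))))//.
by apply/funext => j; congr A; apply: val_inj.
Qed.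

Lemma interleave_op_eval n (T Q : H -> H) (s : seq {poly R[i]}) : size s = n.+1 ->
  interleave (fun j : 'I_n.+1 => poly_op (nth 0 s (n - j)) T) (fun=> Q) = op_eval T Q s.
Proof.
elim: n s => [|n IH] [//|f s] [sn].
  by case: s sn => //; rewrite interleave0.
case: s sn => [//|g s] sn; rewrite interleave_recr.
transitivity ((op_eval T Q (g :: s) \o Q) \o poly_op f T); last by [].
rewrite -(IH _ sn) /= subnn; congr ((_ \o _) \o _).
by congr (interleave _ _); apply/funext => j; rewrite /= subSn// -ltnS.
Qed.

End InterleavedWords.

Section FlattenSeries.
Variables (I : eqType) (s0 : I) (L : nat -> seq I).

(* Each block is padded with [s0], so that no block is empty. *)
Let blocks M := flatten [seq rcons (L m) s0 | m <- iota 0 M].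

Definition block_end M := size (blocks M).
(** The first [i.+1] blocks are nonempty, so together they reach position [i]. *)
Definition flat_series i := nth s0 (blocks i.+1) i.

Let blocksD a b : exists t, blocks (a + b) = blocks a ++ t.
Proof.
by eexists; rewrite /blocks iotaD map_cat flatten_cat; reflexivity.
Qed.

Let blocksS M : blocks M.+1 = blocks M ++ rcons (L M) s0.
Proof. by rewrite /blocks -addn1 iotaD map_cat flatten_cat /= cats0. Qed.

Lemma leq_block_end M : (M <= block_end M)%N.
Proof.
elim: M => // M IH; rewrite /block_end blocksS size_cat size_rcons addnS ltnS.
exact: leq_trans IH (leq_addr _ _).
Qed.

Let flat_seriesE M i : (i < block_end M)%N -> flat_series i = nth s0 (blocks M) i.
Proof.
move=> iM; rewrite /flat_series; case: (leqP i.+1 M) => [h|h].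
  have [t ht] := blocksD i.+1 (M - i.+1); rewrite -(subnKC h) ht nth_cat ifT//.
  exact: leq_block_end.
have [t ht] := blocksD M (i.+1 - M); rewrite -(subnKC (ltnW h)) ht nth_cat ifT//.
Qed.

Lemma flat_series_sum (V : nmodType) (F : I -> V) M : F s0 = 0 ->
  \sum_(i < block_end M) F (flat_series i) = \sum_(0 <= m < M) \sum_(s <- L m) F s.
Proof.
move=> F0; transitivity (\sum_(s <- blocks M) F s).
  by rewrite (big_nth s0) big_mkord; apply: eq_bigr => i _; rewrite -(flat_seriesE (M := M)).
elim: M => [|M IH]; first by rewrite /blocks big_nil big_geq.
by rewrite blocksS big_cat IH big_nat_recr//= -cats1 big_cat/= big_seq1 F0 addr0.
Qed.

Lemma flat_series_all (P : pred I) : P s0 -> (forall m, all P (L m)) ->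
  forall i, P (flat_series i).
Proof.
move=> P0 PL i; have : all P (blocks i.+1).
  elim: i.+1 => // M IH; rewrite blocksS all_cat IH /= all_rcons P0 PL//.
by move=> /all_nthP; apply; apply: leq_block_end.
Qed.

End FlattenSeries.

(** * Values of the disk calculus and of the multiple operator integral *)

Section CalculusValues.
Context {R : realType} {H : hilbertType R}.
Local Notation cn z := (rnorm (z : R[i]^o)).
Variables (T : H -> H) (E : set R[i] -> H -> H).
Hypotheses (lT : linear T) (hE : semispectral_measure_of T E).

Let poly_opB (p r : {poly R[i]}) : poly_op (p - r) T = poly_op p T - poly_op r T.
Proof. by rewrite addrC -scaleN1r poly_opD scaleN1r addrC. Qed.

(** Two polynomial sequences that approach [f] uniformly are uniformly close to each other, and von
    Neumann's inequality transfers this to [T]. *)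
Lemma disk_calc_uniq f (p : nat -> {poly R[i]}) A : bounded_op A ->
  (forall e, 0 < e -> exists M0, forall M, (M0 <= M)%N -> forall z, cn z <= 1 ->
    cn (f z - (p M).[z]) <= e) ->
  (forall e, 0 < e -> exists M0, forall M, (M0 <= M)%N -> opbnd (poly_op (p M) T - A) e) ->
  disk_calc f T = A.
Proof.
move=> bA hf hA; have lA := bA.1; rewrite /disk_calc; set X := [set _ | _].
have XA : X A.
  split => //; exists p; split; last by apply/op_cvgP => // k; apply: poly_op_linear.
  apply/cvge0P => [t|e e0]; first exact: supnorm_ge0.
  have [M0 h] := hf e e0; exists M0 => // M /= MM; apply: supnorm_le => z z1.
  by rewrite rnormB h.
case: xgetP => [B _ [bB [r [hr hB]]]|no]; last by case: (no A).
apply: (@opbnd_eq _ _ _ _ _ 4) => // e e0.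
have [N1 h1] := hf e e0; have [N2 h2] := hA e e0.
have [|N3 h3] := (op_cvgP _ bB.1).1 hB e e0; first by move=> k; apply: poly_op_linear.
have [N4 _ h4] := (cvge0P (fun k => supnorm_ge0 (fun z => (r k).[z] - f z))).1 hr e e0.
pose k := (N1 + N2 + N3 + N4)%N.
have b3 : opbnd (B - poly_op (r k) T) e.
  by apply/opbnd_distC/h3; rewrite /k; lia.
have b2 : opbnd (poly_op (p k) T - A) e by apply: h2; rewrite /k; lia.
have b1 : opbnd (poly_op (r k) T - poly_op (p k) T) (e + e).
  rewrite -poly_opB; apply: (von_Neumann hE) => z z1; rewrite hornerD hornerN.
  apply: le_trans (rnorm_triB (f z : R[i]^o) _ _) _; apply: lerD.
    have kN : (N4 <= k)%N by rewrite /k; lia.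
    have := h4 k kN; apply: contraTT; rewrite -!ltNge => h.
    apply: lt_le_trans (supnorm_ge _ (z := z) _); first by rewrite lte_fin.
    by apply/closed_diskE; rewrite z1.
  by apply: h1; rewrite ?z1//; rewrite /k; lia.
have := opbnd_tri (opbnd_tri b3 b1) b2; apply: opbnd_le; lra.
Qed.

Variables (Q : H -> H) (q : R).
Hypotheses (lQ : linear Q) (q0 : 0 <= q) (bQ : opbnd Q q).

Lemma multiple_op_int_series n f (p : nat -> {poly R[i]}) L K S :
  (forall e, 0 < e -> exists M0, forall M, (M0 <= M)%N -> forall z, cn z <= 1 ->
    cn (f z - (\sum_(0 <= m < M) p m).[z]) <= e) ->
  (forall m, represents n (p m) (L m)) ->
  (forall M, \sum_(0 <= m < M) \sum_(s <- L m) tensor_cost s <= K) ->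
  bounded_op S ->
  (forall e, 0 < e -> exists M0, forall M, (M0 <= M)%N ->
    opbnd (S - \sum_(0 <= m < M) op_deriv T Q n (p m)) e) ->
  multiple_op_int (divided_difference f (n := n)) (fun=> E) (fun=> Q) = S.
Proof.
move=> hf hL hK bS hS.
have DD := divided_difference_series hf hL hK.
(* The padding list of zeros has the right length, zero cost and zero values, so it changes no
   sum. *)
pose s0 : seq {poly R[i]} := nseq n.+1 0.
pose g := flat_series s0 L; pose N_ := block_end s0 L.
have sg i : size (g i) = n.+1.
  apply/eqP; apply: (flat_series_all (P := fun s => size s == n.+1)).
    by rewrite size_nseq.
  by move=> m; have [] := hL m.
have cost0 : tensor_cost s0 = 0.
  rewrite /s0 /= tensor_cost_cons (_ : poly_norm 0 = 0) ?mul0r//.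
  by apply/le_anti; rewrite poly_norm_ge0 andbT poly_supnorm// => z _; rewrite horner0 rnorm0.
have scal0 z : scalar_eval z s0 = 0 by rewrite /s0 /= horner0 mulr0.
have op0 : op_eval T Q s0 = 0.
  apply/funext => x; apply: rnorm_eq0; apply/le_anti; rewrite rnorm_ge0 andbT.
  by have := op_eval_bnd 0 (nseq n 0) hE q0 bQ x; rewrite -/(nseq n.+1 0) -/s0 cost0 !mul0r.
(* Entry [n - j], since the lists begin with the last variable. *)
pose ff i (j : 'I_n.+1) (z : R[i]) := (nth 0 (g i) (n - j)).[z].
have costS M : \sum_(i < N_ M) tensor_cost (g i) = \sum_(0 <= m < M) \sum_(s <- L m) tensor_cost s.
  exact: flat_series_sum.
have c0 i : 0 <= tensor_cost (g i) by apply: tensor_cost_ge0.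
have costK N : \sum_(0 <= i < N) tensor_cost (g i) <= K.
  apply: le_trans (hK N); rewrite -costS -(big_mkord xpredT (fun i => tensor_cost (g i))).
  rewrite [leRHS](@big_cat_nat _ _ _ N)//=; last exact: leq_block_end.
  by rewrite lerDl sumr_ge0.
have tail := nneseries_tail c0 (nneseries_lt_pinfty c0 costK).
have tailN e : 0 < e -> exists N1, forall M N, (N1 <= M)%N -> (N_ M <= N)%N ->
    \sum_(N_ M <= i < N) tensor_cost (g i) <= e.
  move=> /tail[N1 h]; exists N1 => M N N1M MN.
  have N1N : (N1 <= N_ M)%N by apply: leq_trans N1M (leq_block_end _ _ _).
  apply: le_trans (h N (leq_trans N1N MN)).
  by rewrite [leRHS](@big_cat_nat _ _ _ (N_ M))//= lerDr sumr_ge0.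
have rep : tensor_rep (divided_difference f (n := n)) ff.
  split; first by move=> i j; apply: disk_algebra_poly.
    under eq_eseriesr => i _ do rewrite -(tensor_cost_prod (sg i)).
    exact: nneseries_lt_pinfty costK.
  move=> l tl; pose z i := l 0 (inord i) : R[i].
  have z1 i : cn (z i) = 1 by apply/circleE; apply: tl.
  have E1 i : \prod_(j < n.+1) ff i j (l 0 j) = scalar_eval z (g i).
    rewrite scalar_eval_prod sg; apply: eq_bigr => j _.
    by rewrite /ff /z inord_val subSS.
  apply/cvg_rnorm_seq => e e0; have e4 : 0 < e / 4 by rewrite divr_gt0.
  have [N1 h1] := tailN _ e4; have [M0 h2] := (cvg_rnorm_seq _ _).1 (DD l tl) _ e4.
  (* A partial sum may end inside a block: it is compared with the last sum at [N_ M], and the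
     excess is bounded by the tail of the costs. *)
  pose M := maxn N1 M0; exists (N_ M) => N MN.
  rewrite (eq_bigr (fun i : 'I_N => scalar_eval z (g i))); last by move=> i _; apply: E1.
  rewrite -(big_mkord xpredT (fun i => scalar_eval z (g i))) (@big_cat_nat _ _ _ (N_ M))//=.
  rewrite opprD addrA; apply: le_lt_trans (rnormD _ _) _; rewrite rnormN.
  apply: (@le_lt_trans _ _ (e / 4 + e / 4)); last by lra.
  apply: lerD.
    rewrite big_mkord (flat_series_sum _ _ _ (F := scalar_eval z))//.
    by apply/ltW/h2; rewrite leq_maxr.
  apply: le_trans (h1 M N (leq_maxl _ _) MN); apply: le_trans (rnorm_sum _ _ _) _.
  by apply: ler_sum => i _; apply: scalar_eval_bnd.
have intE i : interleave (fun j => semispectral_int E (ff i j)) (fun=> Q) = op_eval T Q (g i).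
  rewrite -(interleave_op_eval T Q (sg i)); congr (interleave _ _); apply/funext => j.
  exact: ssint_poly.
have lO i : linear (op_eval T Q (g i)) by apply: op_eval_linear.
have bO i : opbnd (op_eval T Q (g i)) (tensor_cost (g i) * q ^+ n).
  case: (g i) (sg i) => [//|p0 s] [<-]; exact: op_eval_bnd hE q0 bQ.
have opS : op_cvg (fun N => \sum_(i < N)
    interleave (fun j => semispectral_int E (ff i j)) (fun=> Q)) S.
  under eq_fun do under eq_bigr do rewrite intE.
  apply/op_cvgP => [k||e e0]; [exact: linear_sum | exact: bS.1 |].
  have d0 : 0 < e / 2 / (q ^+ n + 1).
    by rewrite !divr_gt0// ltr_wpDl// exprn_ge0.
  have [N1 h1] := tailN _ d0.
  have e2 : 0 < e / 2 by rewrite divr_gt0.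
  have [M0 h2] := hS _ e2.
  pose M := maxn N1 M0; exists (N_ M) => N MN; apply: opbnd_distC.
  rewrite -(big_mkord xpredT (fun i => op_eval T Q (g i))) (@big_cat_nat _ _ _ (N_ M))//=.
  rewrite opprD addrA; have -> : e = e / 2 + e / 2 by lra.
  apply: opbndB.
    rewrite big_mkord (flat_series_sum _ _ _ (F := op_eval T Q))//.
    rewrite (eq_bigr (fun m => op_deriv T Q n (p m))); last first.
      by move=> m _; have [_ -> //] := hL m.
    by apply: h2; rewrite leq_maxr.
  apply: (@opbnd_le _ _ _ _ (\sum_(N_ M <= i < N) tensor_cost (g i) * q ^+ n)).
    rewrite -mulr_suml; apply: (@le_trans _ _ (e / 2 / (q ^+ n + 1) * q ^+ n)).
      by rewrite ler_wpM2r ?exprn_ge0// h1// leq_maxl.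
    rewrite mulrAC ler_pdivrMr; last by rewrite ltr_wpDl// exprn_ge0.
    by rewrite ler_wpM2l// ?lerDl// ltW.
  exact: opbnd_sum.
rewrite /multiple_op_int; set X := [set _ | _].
have XS : X S by split => //; exists ff.
case: xgetP => [B _ [bB [f' rep' opB]]|no]; last by case: (no S).
pose F b := if b then f' else ff; pose A b := if b then B else S.
have h1 : forall b, tensor_rep (divided_difference f (n := n)) (F b) by case.
have h2 : forall b, linear (A b) by case; [exact: bB.1 | exact: bS.1].
have h3 : forall b, op_cvg (fun N => \sum_(m < N)
     interleave (fun j => semispectral_int E (F b m j)) (fun=> Q)) (A b) by case.
have dE := measure_dilatable hE.
exact: (@multiple_op_int_uniq R H n (divided_difference f (n := n)) (fun=> E) (fun=> Q) F A
  (fun=> dE) (fun=> lQ) (fun=> ex_intro _ q (conj q0 bQ)) h1 h2 h3).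
Qed.

End CalculusValues.

Unset Implicit Arguments.

(* [R0] is the field of real numbers; [T] and [R] are the contractions. *)
Theorem theorem5p3 (R0 : realType) (H : hilbertType R0) (n : nat)
    (T R : H -> H) (E : R0 -> set R0[i] -> H -> H) (phi : R0[i] -> R0[i]) :
  let Tt (t : R0) : H -> H := (1 - t)%:C *: T + t%:C *: R in
  (1 <= n)%N ->
  contractive T -> contractive R ->
  (forall t, t \in `[0, 1] -> semispectral_measure_of (Tt t) (E t)) ->
  besov_plus n%:R +oo%E 1%E phi ->
  nth_op_derivative n
    (fun t => disk_calc (analytic_ext phi) (Tt t))
    (fun t => n`!%:R *:
      multiple_op_int (divided_difference (analytic_ext phi) (n := n))
        (fun=> E t) (fun=> R - T)).
Proof.
move=> Tt n1 /contractiveP[lT bT] /contractiveP[lR bR] hE /[dup] hphi /besov_block_bound.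
case=> b [b0 hb [S0 hS0]].
have hf := analytic_ext_cvg n1 b0 hb (ex_intro _ S0 hS0).
set f := analytic_ext phi in hf *; set p := besov_block phi in hb hf *.
pose Q := R - T; have lQ : linear Q by apply: linear_sub.
have bQ : opbnd Q 2 by have := opbndB bR bT; apply: opbnd_le; lra.
have lTt t : linear (Tt t) by apply: linear_add; apply: linear_scale.
have bTt t : 0 <= t <= 1 -> opbnd (Tt t) 1.
  move=> /andP[t0 t1]; have -> : 1 = `|1 - t| * 1 + `|t| * 1 :> R0.
    by rewrite !ger0_norm ?subr_ge0// !mulr1 subrK.
  by rewrite -!cnR; apply: opbndD; apply: opbndZ.
(* Recentred at [t], the segment has the form [T + h Q] of the remainder estimates. *)
have TtE t s : Tt s = Tt t + (s - t)%:C *: Q.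
  apply/funext => x; rewrite /Tt /Q !fctE scalerBr -scaleNr [RHS](AC (2*2) ((1*4)*(2*3))) /= -!scalerDl.
  by congr (_ *: _ + _ *: _); rewrite -?rmorphN -!rmorphD; congr (_%:C); ring.
have hE' t : 0 <= t <= 1 -> semispectral_measure_of (Tt t) (E t).
  by move=> t01; apply: hE; rewrite in_itv.
have two0 : 0 <= (2 : R0) by [].
have ex_L k : exists L : nat -> seq (seq {poly R0[i]}), exists K, (k <= n)%N ->
    (forall m, represents k (p m) (L m)) /\
    forall M, \sum_(0 <= m < M) \sum_(s <- L m) tensor_cost s <= K.
  have [kn|kn] := leqP k n; last by exists (fun=> [::]), 0.
  have [L [hL [K hK]]] := dyadic_represents kn b0 (size_besov_block phi)
    (@besov_block_low _ phi) hb hS0.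
  by exists L, K.
have /choice[L /choice[K hLK]] := ex_L.
have {ex_L} hL k kn := (hLK k kn).1; have {}hK k kn := (hLK k kn).2.
pose w k m := (\sum_(s <- L k m) tensor_cost s) * 2 ^+ k.
have w0 k m : 0 <= w k m.
  by rewrite mulr_ge0 ?exprn_ge0// sumr_ge0// => s _; apply: tensor_cost_ge0.
have wK k : (k <= n)%N -> forall M, \sum_(0 <= m < M) w k m <= K k * 2 ^+ k.
  by move=> kn M; rewrite -mulr_suml ler_wpM2r ?exprn_ge0// hK.
pose G k m t := op_deriv (Tt t) Q k (p m).
have lG k m t : linear (G k m t) by apply: op_deriv_linear.
have bG k m t : (k <= n)%N -> 0 <= t <= 1 -> opbnd (G k m t) (w k m).
  by move=> kn t01; apply: op_deriv_bnd (hE' t t01) _ _ (hL k kn m).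
(* Linearity is required for every [t], because the criterion for operator convergence asks it of
   all difference quotients, also off the interval. *)
have ex_S k t : exists S : H -> H, linear S /\ ((k <= n)%N -> 0 <= t <= 1 ->
    opbnd S (K k * 2 ^+ k) /\ forall e M,
    (forall N, (M <= N)%N -> \sum_(M <= m < N) w k m <= e) ->
    opbnd (S - \sum_(0 <= m < M) G k m t) e).
  have [[kn t01]|no] := pselect ((k <= n)%N /\ 0 <= t <= 1).
    have [S [lS bS hS]] := op_series (lG k ^~ t) (w0 k) (fun m => bG k m t kn t01) (wK k kn).
    by exists S.
  by exists 0; split; [exact: linear_zero | move=> kn t01; case: no].
have /choice[S hS] : forall kt : nat * R0, exists S : H -> H, _ := fun kt => ex_S kt.1 kt.2.
have lS k t : linear (S (k, t)) by case: (hS (k, t)).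
have bS k t kn t01 := ((hS (k, t)).2 kn t01).1; have tS k t kn t01 := ((hS (k, t)).2 kn t01).2.
have {hS} bdS k t : (k <= n)%N -> 0 <= t <= 1 -> bounded_op (S (k, t)).
  move=> kn t01; apply/bounded_opP; split=> //; exists (K k * 2 ^+ k); split.
    by have := wK k kn 0%N; rewrite big_geq.
  exact: bS.
have cvS k t : (k <= n)%N -> 0 <= t <= 1 -> forall e, 0 < e ->
    exists M0, forall M, (M0 <= M)%N -> opbnd (S (k, t) - \sum_(0 <= m < M) G k m t) e.
  move=> kn t01 e e0.
  have [M0 h] := nneseries_tail (w0 k) (nneseries_lt_pinfty (w0 k) (wK k kn)) e0.
  exists M0 => M MM; apply: tS => // N MN; apply: le_trans (h N (leq_trans MM MN)).
  by rewrite [leRHS](@big_cat_nat _ _ _ M)//= lerDr sumr_ge0.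
have scaled k t : (k <= n)%N -> 0 <= t <= 1 -> forall e M,
    (forall N, (M <= N)%N -> \sum_(M <= m < N) k`!%:R * w k m <= e) ->
    opbnd (k`!%:R *: S (k, t) - \sum_(0 <= m < M) k`!%:R *: G k m t) e.
  move=> kn t01 e M he; have f0 : 0 < (k`!%:R : R0) by rewrite ltr0n fact_gt0.
  rewrite -scaler_sumr -scalerBr (_ : e = k`!%:R * (e / k`!%:R)); last by rewrite mulrC divfK ?gt_eqF.
  rewrite -cn_nat; apply: opbndZ; apply: tS => // N MN.
  by rewrite cn_nat ler_pdivlMr// mulrC mulr_sumr he.
(* The [k]-th derivative: [S (k, t)] sums Taylor coefficients, hence the factorial. *)
exists (fun k t => k`!%:R *: S (k, t)); split.
- move=> t; rewrite in_itv /= => t01; rewrite fact0 scale1r; symmetry.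
  apply: (disk_calc_uniq (lTt t) (hE' t t01) (p := fun M => \sum_(0 <= m < M) p m)) => //.
    exact: bdS.
  move=> e e0; have [M0 h] := cvS 0%N t (leq0n n) t01 e e0; exists M0 => M MM.
  apply: opbnd_distC; rewrite (_ : poly_op _ _ = \sum_(0 <= m < M) G 0%N m t); first exact: h.
  elim: M {MM} => [|M IH].
    by rewrite !big_geq// /poly_op size_poly0 big_ord0.
  rewrite big_nat_recr//= [RHS]big_nat_recr//= addrC -[p M]scale1r poly_opD scale1r IH addrC.
  by congr (_ + _); rewrite /G /op_deriv /poly_op; apply: eq_bigr => i _; rewrite op_words0.
- move=> k t kn; rewrite in_itv /= => t01.
  have f0 j : 0 <= (j`!%:R : R0) by [].
  have /choice[KK hKK] m := @op_deriv_remainder R0 H 2 k (p m) two0.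
  apply: (@op_derivative_series _ _ (fun m t => k`!%:R *: G k m t)
    (fun m t => k.+1`!%:R *: G k.+1 m t) (fun t => k`!%:R *: S (k, t))
    (fun t => k.+1`!%:R *: S (k.+1, t)) (fun m => k`!%:R * w k m)
    (fun m => k.+1`!%:R * w k.+1 m) (fun m => k`!%:R * KK m)
    (k`!%:R * (K k * 2 ^+ k)) (k.+1`!%:R * (K k.+1 * 2 ^+ k.+1))) => //.
  + by move=> *; apply: linear_scale.
  + by move=> *; apply: linear_scale.
  + by move=> *; apply: linear_scale.
  + move=> s s01; apply/bounded_opP; split; first exact: linear_scale.
    exists (k.+1`!%:R * (K k.+1 * 2 ^+ k.+1)); split.
      by rewrite mulr_ge0//; have := wK k.+1 kn 0%N; rewrite big_geq.
    by rewrite -cn_nat; apply: opbndZ; apply: bS.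
  + by move=> m; rewrite mulr_ge0.
  + by move=> m; rewrite mulr_ge0.
  + by move=> m; rewrite mulr_ge0//; case: (hKK m).
  + by move=> m s s01; rewrite -cn_nat; apply: opbndZ; apply: bG.
  + by move=> M; rewrite -mulr_sumr ler_wpM2l// wK// ltnW.
  + by move=> M; rewrite -mulr_sumr ler_wpM2l// wK.
  + move=> m t' s' t01' s01'; have [_ hm] := hKK m.
    have -> : k`!%:R *: G k m s' - k`!%:R *: G k m t' - (s' - t')%:C *: (k.+1`!%:R *: G k.+1 m t') =
        k`!%:R *: (op_deriv (Tt t' + (s' - t')%:C *: Q) Q k (p m) - op_deriv (Tt t') Q k (p m) -
          ((s' - t') *+ k.+1)%:C *: op_deriv (Tt t') Q k.+1 (p m)).
      (* The factor [k.+1] in the remainder of the words turns [k!] into [k.+1!]. *)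
      rewrite -TtE !scalerBr !scalerA; congr (_ - _); congr (_ *: _).
      by rewrite factS natrM rmorphMn /= -mulr_natr; ring.
    rewrite -mulrA -cn_nat; apply: opbndZ; apply: hm => //; rewrite -?TtE; try exact: bTt.
    by move: t01' s01' => /andP[? ?] /andP[? ?]; rewrite ler_norml; lra.
  + by move=> *; apply: scaled => //; apply: ltnW.
  + by move=> *; apply: scaled.
- move=> t; rewrite in_itv /= => t01; congr (_ *: _); symmetry.
  apply: (multiple_op_int_series (lTt t) (hE' t t01) lQ two0 bQ hf (hL n (leqnn n))
    (hK n (leqnn n)) (bdS n t (leqnn n) t01) (cvS n t (leqnn n) t01)).
Qed.
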